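(* Suppose that the heavy-tailed Lipschitz condition holds with $p=2$, that $X^*\neq\emptyset$, that $T$ is pseudo-monotone on $X$, and that in Algorithm 1 the samples $\{\xi^k_j\}$ and $\{\eta^k_j\}$ are i.i.d. from $\mathbf P$ and independent of each other. Let $N_k:=N\lceil(k+\mu)(\ln(k+\mu))^{1+b}\rceil$ with $b>0$, $\mu>2$ and $N:=\mathcal O(d)$, $N\in\mathbb N$. Given $\epsilon>0$, Algorithm 1 achieves the tolerance $$\min_{i=0,\dots,K}\mathbb E[r(x^i)^2]\le\epsilon$$ after $K=b^{-1}\mathcal O(\epsilon^{-1})$ iterations and with a.s. an oracle complexity $\sum_{i=0}^K(1+\ell_i)N_i$ bounded above by $$b^{-2}\cdot\log_{\frac1\theta}\left(\frac{\hat\alpha\max_{i=0,\dots,K}\widehat L_i}{(\lambda\theta)\wedge\hat\alpha}\right)\cdot\left[\ln\left(b^{-1}\epsilon^{-1}\right)\right]^{1+b}\cdot\mathcal O(d\epsilon^{-2}),$$ where $\ell_k$ is the number of oracle calls used in the line search at iteration $k$ and $\widehat L_k:=\frac1{N_k}\sum_{j=1}^{N_k}\mathsf L(\xi^k_j)$. Moreover, the mean oracle complexity $\sum_{i=0}^K(1+\mathbb E[\ell_i])N_i$ satisfies the same upper bound with $\max_{i=0,\dots,K}\widehat L_i$ replaced by $L$.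
   Context: Setting. $X\subset\mathbb R^d$ is a nonempty closed convex set, $\mathbf P$ is a probability distribution on $\Xi$, $F:\Xi\times X\to\mathbb R^d$ is a measurable random operator, $\xi\sim\mathbf P$, $T(x):=\mathbb E[F(\xi,x)]$. $X^*$ is the set of $x^*\in X$ with $\langle T(x^* ),x-x^*\rangle\ge0$ for all $x\in X$. $\|\cdot\|$ is the Euclidean norm, $\Pi$ the Euclidean projection onto $X$, $a\wedge b=\min\{a,b\}$, $r(x):=\|x-\Pi[x-T(x)]\|$, $\lceil x\rceil$ the smallest integer greater than $x$. For a sample $\xi^N=\{\xi_j\}_{j=1}^N$, $\widehat F(\xi^N,x):=\frac1N\sum_jF(\xi_j,x)$. Heavy-tailed Lipschitz condition with $p=2$: there is $\mathsf L:\Xi\to\mathbb R_+$ such that for almost every $\xi$, $\mathsf L(\xi)\ge1$ and $\|F(\xi,x)-F(\xi,y)\|\le\mathsf L(\xi)\|x-y\|$ for all $x,y\in X$; and, with $\mathsf a:=1$ if $X$ is compact and $\mathsf a:=2$ for a general $X$, there is $x_*\in X$ with $\mathbb E\|F(\xi,x_* )\|^{2\mathsf a}<\infty$, $\mathbb E[\mathsf L(\xi)^{2\mathsf a}]<\infty$. $L:=\mathbb E[\mathsf L(\xi)]$. Pseudo-monotonicity: for all $x,z\in X$, $\langle T(x),z-x\rangle\ge0$ implies $\langle T(z),z-x\rangle\ge0$. Algorithm 1. Inputs: $x^0\in X$ (deterministic), $\hat\alpha\in(0,1]$, $\theta\in(0,1)$, $\lambda\in(0,1/\sqrt6)$, sample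 sizes $N_k$. Given $x^k$, draw $\xi^k=\{\xi^k_j\}_{j=1}^{N_k}$ from $\mathbf P$. If $x^k=\Pi[x^k-\hat\alpha\widehat F(\xi^k,x^k)]$, stop. Otherwise put $z^k(\alpha):=\Pi[x^k-\alpha\widehat F(\xi^k,x^k)]$ and let $\alpha_k=\theta^{\ell_k}\hat\alpha$ be the maximum $\alpha\in\{\theta^\ell\hat\alpha:\ell\in\mathbb N\cup\{0\}\}$ with $\alpha\|\widehat F(\xi^k,z^k(\alpha))-\widehat F(\xi^k,x^k)\|\le\lambda\|z^k(\alpha)-x^k\|$ ($\ell_k$ is the number of line search iterations, called the number of oracle calls of the line search). Draw $\eta^k=\{\eta^k_j\}_{j=1}^{N_k}$ from $\mathbf P$ and set $z^k:=\Pi[x^k-\alpha_k\widehat F(\xi^k,x^k)]$, $x^{k+1}:=\Pi[x^k-\alpha_k\widehat F(\eta^k,z^k)]$. The algorithm is assumed to generate (almost surely) an infinite sequence. $\mathcal O$-notation: $u=\mathcal O(v)$ means $u\le Cv$ for a constant $C>0$ not depending on $\epsilon$ (it may depend on the fixed problem data and algorithm parameters); $N:=\mathcal O(d)$ means $N$ is chosen of the order of $d$; the $\epsilon$-asymptotics is for small $\epsilon$.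
   Formalization: The bounds with factor log can fail (the log is 0 if 𝖫=1 and α̂≤λθ); they are proved with 1+log in general, and with log itself when α̂𝖫(ξ)/((λθ)∧α̂)≥δ>1 a.s. for some δ (a.s. bound), or α̂L/((λθ)∧α̂)>1 (mean bound). *)

(* Defs.v *)
From HB Require Import structures.
From mathcomp Require Import all_boot all_order all_algebra.
From mathcomp Require Import all_classical all_reals all_analysis.
Set Implicit Arguments.
Unset Strict Implicit.
Unset Printing Implicit Defensive.
Import Order.TTheory GRing.Theory Num.Theory.
Import numFieldNormedType.Exports.
Local Open Scope classical_set_scope.
Local Open Scope ring_scope.

Section euclidean.
Context {R : realType} {d : nat}.
Implicit Types (x y : 'rV[R]_d) (X : set 'rV[R]_d) (T : 'rV[R]_d -> 'rV[R]_d).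

Definition dot x y : R := \sum_(i < d) x 0 i * y 0 i.

(* The library norm `|x| on 'rV[R]_d is the sup norm; the topology is the same. *)
Definition enorm x : R := Num.sqrt (dot x x).

(* For X closed, convex and nonempty the nearest point exists and is unique,
   so the default value of xget plays no role. *)
Definition proj X x : 'rV[R]_d :=
  xget x [set y | X y /\ forall w, X w -> enorm (x - y) <= enorm (x - w)].

Definition vi_solution X T : set 'rV[R]_d :=
  [set xs | X xs /\ forall x, X x -> 0 <= dot (T xs) (x - xs)].

Definition pseudo_monotone X T : Prop :=
  forall x z, X x -> X z -> 0 <= dot (T x) (z - x) -> 0 <= dot (T z) (z - x).

Definition residual X T x : R := enorm (x - proj X (x - T x)).

Definition borel_rV : measurableType (@open 'rV[R]_d).-sigma :=
  g_sigma_algebraType (@open 'rV[R]_d).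

End euclidean.

Section random_operator.
Context {R : realType} {d : nat} {dXi : measure_display} {Xi : measurableType dXi}.
Implicit Types (P : probability Xi R) (X : set 'rV[R]_d).
Implicit Types (F : Xi -> 'rV[R]_d -> 'rV[R]_d) (Lip : Xi -> R).

Definition measurable_operator X F : Prop :=
  measurable_fun (setT `*` X : set (Xi * @borel_rV R d))
    (fun u : Xi * @borel_rV R d => F u.1 u.2 : @borel_rV R d).

Definition mean_operator P F (x : 'rV[R]_d) : 'rV[R]_d :=
  \row_(i < d) \int[P]_xi (F xi x 0 i).

Definition moment_exponent X : nat := if `[< compact X >] then 1 else 2.

(* Heavy-tailed Lipschitz condition with p = 2 and Lipschitz modulus Lip. *)
Definition heavy_tailed_lipschitz P X F Lip : Prop :=
  [/\ measurable_fun setT Lip /\ (forall xi, 0 <= Lip xi),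
      {ae P, forall xi, 1 <= Lip xi /\
        forall x y, X x -> X y -> enorm (F xi x - F xi y) <= Lip xi * enorm (x - y)},
      exists2 xs, X xs &
        ('E_P[(fun xi => enorm (F xi xs) ^+ (2 * moment_exponent X))%R] < +oo)%E &
      ('E_P[(fun xi => Lip xi ^+ (2 * moment_exponent X))%R] < +oo)%E].

End random_operator.

Section algorithm.
Context {R : realType} {d : nat} {Xi : Type}.
Variables (X : set 'rV[R]_d) (F : Xi -> 'rV[R]_d -> 'rV[R]_d).
Variables (x0 : 'rV[R]_d) (ahat theta lam : R) (Ns : nat -> nat).
Implicit Types (s : nat -> Xi) (x : 'rV[R]_d) (a : R) (n : nat).

Definition Fhat n s x : 'rV[R]_d := n%:R^-1 *: \sum_(j < n) F (s j) x.

Definition ztrial n s x a : 'rV[R]_d := proj X (x - a *: Fhat n s x).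

Definition linesearch_test n s x a : Prop :=
  a * enorm (Fhat n s (ztrial n s x a) - Fhat n s x) <= lam * enorm (ztrial n s x a - x).

(* The exponent l such that theta ^+ l * ahat is the largest accepted stepsize
   (0 if no stepsize is accepted, which has probability zero under the
   Lipschitz condition). *)
Definition linesearch n s x : nat :=
  xget 0 [set l : nat | linesearch_test n s x (theta ^+ l * ahat) /\
    forall m : nat, linesearch_test n s x (theta ^+ m * ahat) ->
      theta ^+ m * ahat <= theta ^+ l * ahat].

(* xi k and eta k are the two samples of iteration k; only their first Ns k
   entries are used. *)
Fixpoint iterate (xi eta : nat -> nat -> Xi) k : 'rV[R]_d :=
  if k is k'.+1 then
    let x := iterate xi eta k' in
    let a := theta ^+ linesearch (Ns k') (xi k') x * ahat in
    proj X (x - a *: Fhat (Ns k') (eta k') (ztrial (Ns k') (xi k') x a))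
  else x0.

Definition oracle_calls (xi eta : nat -> nat -> Xi) k : nat :=
  linesearch (Ns k) (xi k) (iterate xi eta k).

Definition stops_at (xi eta : nat -> nat -> Xi) k : Prop :=
  iterate xi eta k = ztrial (Ns k) (xi k) (iterate xi eta k) ahat.

End algorithm.

Section sampling.
Context {R : realType} {dXi dO : measure_display}.
Context {Xi : measurableType dXi} {Omega : measurableType dO}.
Implicit Types (P : probability Xi R) (Q : probability Omega R).

Definition mutually_independent Q (I : eqType) (D : set I) (Y : I -> Omega -> Xi) :=
  forall (s : seq I) (A : I -> set Xi), uniq s -> (forall i, i \in s -> D i) ->
    (forall i, measurable (A i)) ->
    Q (\bigcap_(i in [set` s]) (Y i @^-1` A i)) = (\prod_(i <- s) Q (Y i @^-1` A i))%E.

Definition iid_family P Q (I : eqType) (D : set I) (Y : I -> Omega -> Xi) : Prop :=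
  [/\ forall i, D i -> measurable_fun setT (Y i),
      forall i, D i -> forall A, measurable A -> Q (Y i @^-1` A) = P A &
      mutually_independent Q D Y].

(* All the sample points together form one i.i.d. family, which covers the
   independence of the xi's from the eta's. *)
Definition iid_samples P Q (Ns : nat -> nat) (xi eta : Omega -> nat -> nat -> Xi) : Prop :=
  iid_family P Q
    [set i : (nat * nat) + (nat * nat) |
      match i with inl (k, j) | inr (k, j) => (j < Ns k)%N end]
    (fun i w => match i with inl (k, j) => xi w k j | inr (k, j) => eta w k j end).

End sampling.

Section rates.
Context {R : realType}.

(* (Num.truncn u).+1 is the smallest integer greater than u, for u >= 0. *)
Definition sample_size (N : nat) (mu b : R) (k : nat) : nat :=
  (N * (Num.truncn ((k%:R + mu) * ln (k%:R + mu) `^ (1 + b))).+1)%N.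

Definition logb (base y : R) : R := ln y / ln base.

Definition search_ratio (ahat theta lam M : R) : R :=
  ahat * M / Num.min (lam * theta) ahat.

Definition search_log (ahat theta lam M : R) : R :=
  logb theta^-1 (search_ratio ahat theta lam M).

(* s is the line-search factor, C the constant of O(d eps^-2).  The natural
   factor is s = search_log ahat theta lam M.  It is 0 when M = 1 and
   ahat <= lam * theta, although every iteration costs at least one call; the
   factor s = 1 + search_log ahat theta lam M has no such degeneracy and is of
   the same order as soon as search_log is bounded away from 0. *)
Definition oracle_bound (b C : R) (d : nat) (eps s : R) : R :=
  b ^- 2 * s * ln (b^-1 * eps^-1) `^ (1 + b) * (C * d%:R * eps ^- 2).

End rates.

(* Main.v *)
(** Fix a solution [p].  By pseudo-monotonicity <T z, p - z> <= 0 on X, and the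
    extragradient step gives, with z the trial point and e the error of the
    second batch,
      |x' - p|^2 + |x - z|^2/2 + |p - z|^2
        <= |x - p|^2 + 3 al^2 |e|^2 + 4 al^2 |h - T z|^2 + |p - z + al e|^2,
    where h is the average of the first batch at z.  As e is centered given the
    past, the expectation of the last term is that of |p - z|^2 up to O(1/n).
    The correlated error h - T z is compared with the error at the points
    proj (x - theta^l ahat T x), which do not depend on the batch: the random
    exponent is removed by summing al_l^2 over all l, a geometric series.  The
    remainder (Lhat - L)^2 |z - zb|^2 is bounded by the diameter if X is compact,
    and otherwise through |z - zb| <= |Fhat x - T x| by integrating the sample
    points one at a time; this is where fourth moments enter.  Hence
      E|x' - p|^2 + E|x - z|^2/2 <= E|x - p|^2 + (C/n)(1 + E|x - p|^2).
    The line search gives al Lhat >= c := min(lam theta, ahat), and the tangent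
    inequality l^-2 >= 3 L^-2 - 2 L^-3 l turns E|x - z|^2 into a multiple of
    E r(x)^2.  As sum_k 1/N_k telescopes against (ln t)^-b, the sum of the
    E r(x^k)^2 is bounded.  For the cost, theta^-ell <= ahat Lhat / c almost
    surely, and ln Lhat <= ln L + Lhat/L - 1 in the mean. *)

Require Import Defs.
From HB Require Import structures.
From mathcomp Require Import all_boot all_order all_algebra.
From mathcomp Require Import all_classical all_reals all_analysis.
From mathcomp Require Import measurable_realfun ring lra.
Set Implicit Arguments.
Unset Strict Implicit.
Unset Printing Implicit Defensive.
Import Order.TTheory GRing.Theory Num.Theory.
Import numFieldNormedType.Exports.
Local Open Scope classical_set_scope.
Local Open Scope ring_scope.
(* MathComp-Analysis also exports a [proj]. *)
Local Notation proj := Defs.proj.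

(** * Euclidean geometry *)

Section euclidean_space.
Context {R : realType} {d : nat}.
Implicit Types (x y z w : 'rV[R]_d) (a c : R).

(** Conditional expectations are avoided. To be known at a given time means to be measurable on
    [Omega] with the sigma-algebra generated by the earlier sample points, and conditioning becomes
    Tonelli: a fresh point may be replaced by an independent variable of law [P]. Since Tonelli asks
    for nonnegative functions only, expectations live in the extended reals, and signed integrals
    occur only for a single sample under [P]. The obstacle is that the trial point depends on the
    first batch twice, through the direction and through the accepted exponent, so the average of
    that batch there is not centered, and the step has no deterministic positive lower bound.
    Replacing the random exponent by a sum over all exponents costs a factor 1 / (1 - theta) and no
    power of n, because the squared steps are summable. The random lower bound c / Lhat on the step
    is handled by a tangent because a tangent is affine in Lhat, whose mean given the past is L,
    while the residual at x is known before the batch is drawn. *)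

Lemma dotC x y : dot x y = dot y x.
Proof. by apply: eq_bigr => i _; rewrite mulrC. Qed.

Lemma dotDl x y z : dot (x + y) z = dot x z + dot y z.
Proof. by rewrite -big_split; apply: eq_bigr => i _; rewrite !mxE mulrDl. Qed.

Lemma dotZl a x y : dot (a *: x) y = a * dot x y.
Proof. by rewrite mulr_sumr; apply: eq_bigr => i _; rewrite !mxE mulrA. Qed.

Lemma dotDr x y z : dot x (y + z) = dot x y + dot x z.
Proof. by rewrite dotC dotDl !(dotC x). Qed.

Lemma dotZr a x y : dot x (a *: y) = a * dot x y.
Proof. by rewrite dotC dotZl dotC. Qed.

Lemma dotNl x y : dot (- x) y = - dot x y.
Proof. by rewrite -scaleN1r dotZl mulN1r. Qed.

Lemma dotNr x y : dot x (- y) = - dot x y.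
Proof. by rewrite dotC dotNl dotC. Qed.

Definition dotE := (dotDl, dotDr, dotNl, dotNr, dotZl, dotZr).

Lemma dot_ge0 x : 0 <= dot x x.
Proof. by apply: sumr_ge0 => i _; rewrite -expr2 sqr_ge0. Qed.

Lemma enorm_ge0 x : 0 <= enorm x. Proof. exact: sqrtr_ge0. Qed.

Lemma sqr_enorm x : enorm x ^+ 2 = dot x x.
Proof. by rewrite sqr_sqrtr// dot_ge0. Qed.

Lemma le_enorm x c : 0 <= c -> dot x x <= c ^+ 2 -> enorm x <= c.
Proof. by move=> c0 h; rewrite -(ler_pXn2r (n := 2))// ?nnegrE ?enorm_ge0// sqr_enorm. Qed.

Lemma coord_le_enorm x i : `|x 0 i| <= enorm x.
Proof.
rewrite -sqrtr_sqr ler_sqrt ?dot_ge0// /dot (bigD1 i)//= -expr2 lerDl.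
by apply: sumr_ge0 => j _; rewrite -expr2 sqr_ge0.
Qed.

Lemma enorm0 : enorm (0 : 'rV[R]_d) = 0.
Proof. by rewrite /enorm /dot big1 ?sqrtr0// => i _; rewrite mxE mul0r. Qed.

Lemma enorm0_eq0 x : enorm x = 0 -> x = 0.
Proof.
move=> x0; apply/rowP => i; rewrite mxE; apply/eqP.
by rewrite -normr_eq0 eq_le normr_ge0 andbT (le_trans (coord_le_enorm x i))// x0.
Qed.

Lemma cauchy_schwarz x y : dot x y <= enorm x * enorm y.
Proof.
have [y0|y0] := eqVneq (enorm y) 0.
  by rewrite (enorm0_eq0 y0) enorm0 mulr0 /dot big1// => i _; rewrite mxE mulr0.
have y1 : 0 < enorm y by rewrite lt_neqAle eq_sym y0 enorm_ge0.
have [x0|x0] := eqVneq (enorm x) 0.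
  by rewrite (enorm0_eq0 x0) enorm0 mul0r /dot big1// => i _; rewrite mxE mul0r.
have x1 : 0 < enorm x by rewrite lt_neqAle eq_sym x0 enorm_ge0.
have := dot_ge0 (enorm y *: x - enorm x *: y).
rewrite !dotE -!sqr_enorm (dotC y x) => h.
have : 0 <= 2 * (enorm x * enorm y) * (enorm x * enorm y - dot x y) by lra.
by rewrite pmulr_rge0 ?subr_ge0// !mulr_gt0.
Qed.

Lemma enormN x : enorm (- x) = enorm x.
Proof. by rewrite /enorm !dotE opprK. Qed.

Lemma enormB x y : enorm (x - y) = enorm (y - x).
Proof. by rewrite -enormN opprB. Qed.

Lemma enormZ a x : enorm (a *: x) = `|a| * enorm x.
Proof. by rewrite /enorm !dotE mulrA -expr2 sqrtrM ?sqr_ge0// sqrtr_sqr. Qed.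

Lemma enormD x y : enorm (x + y) <= enorm x + enorm y.
Proof.
apply: le_enorm; first by rewrite addr_ge0 ?enorm_ge0.
rewrite !dotE -!sqr_enorm (dotC y); have := cauchy_schwarz x y; lra.
Qed.

Lemma sqr_enormD x y : enorm (x + y) ^+ 2 <= 2 * enorm x ^+ 2 + 2 * enorm y ^+ 2.
Proof.
by have := dot_ge0 (x - y); rewrite !sqr_enorm !dotE (dotC y); lra.
Qed.

Lemma enorm_sum (I : Type) (s : seq I) (Pr : pred I) (f : I -> 'rV[R]_d) :
  enorm (\sum_(i <- s | Pr i) f i) <= \sum_(i <- s | Pr i) enorm (f i).
Proof.
elim/big_ind2 : _ => [|u a v c h1 h2|//]; first by rewrite enorm0.
by rewrite (le_trans (enormD _ _))// lerD.
Qed.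

Lemma norm_le_enorm x : `|x| <= enorm x.
Proof.
rewrite [leLHS]/Num.norm /= mx_normrE; apply: bigmax_le; first exact: enorm_ge0.
by move=> [i j] _ /=; rewrite (ord1 i) coord_le_enorm.
Qed.

Lemma coord_le_norm x i : `|x 0 i| <= `|x|.
Proof.
by rewrite [leRHS]/Num.norm /= mx_normrE; apply/bigmax_geP; right; exists (0, i).
Qed.

Lemma enorm_le_norm x : enorm x <= Num.sqrt d%:R * `|x|.
Proof.
apply: le_enorm; first by rewrite mulr_ge0 ?sqrtr_ge0.
rewrite exprMn sqr_sqrtr ?ler0n// -[d in d%:R]card_ord -sumr_const mulr_suml.
apply: ler_sum => i _; rewrite mul1r -expr2 -real_normK ?num_real//.
by rewrite lerXn2r ?nnegrE ?normr_ge0// coord_le_norm.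
Qed.

Lemma continuous_enorm_lipschitz m (f : 'rV[R]_d -> 'rV[R]_m) a :
  (forall x y, enorm (f x - f y) <= a * enorm (x - y)) -> continuous f.
Proof.
move=> lf x; apply/(@cvgrPdist_le _ _ _ (nbhs x) (nbhs_filter x)) => e e0.
(* No sign is assumed for [a], hence [Num.max]; the added 1 makes [c] positive. The factor
   [Num.sqrt d%:R] compares the Euclidean norm with the sup norm that defines the topology. *)
pose c := Num.max a 0 * Num.sqrt d%:R + 1.
have c0 : 0 < c by rewrite ltr_wpDl// mulr_ge0 ?sqrtr_ge0// le_max lexx orbT.
have ec0 : 0 < e / c by rewrite divr_gt0.
have xnear : \forall y \near x, `|x - y| < e / c.
  by apply/nbhs_normP; exists (e / c).
apply: filterS xnear => y /ltW xy /=.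
have nfxy : `|f x - f y| <= enorm (f x - f y).
  rewrite [leLHS]/Num.norm /= mx_normrE; apply: bigmax_le; first exact: sqrtr_ge0.
  move=> [i j] _ /=; rewrite (ord1 i) -sqrtr_sqr ler_sqrt; last first.
    by apply: sumr_ge0 => k _; rewrite -expr2 sqr_ge0.
  rewrite /dot (bigD1 j)//= -expr2 lerDl.
  by apply: sumr_ge0 => k _; rewrite -expr2 sqr_ge0.
rewrite (le_trans nfxy)// (le_trans (lf _ _))//.
apply: (@le_trans _ _ (Num.max a 0 * enorm (x - y))).
  by rewrite ler_wpM2r ?enorm_ge0// le_max lexx.
apply: (@le_trans _ _ (Num.max a 0 * (Num.sqrt d%:R * `|x - y|))).
  by rewrite ler_wpM2l ?enorm_le_norm// le_max lexx orbT.
apply: (@le_trans _ _ (c * `|x - y|)).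
  by rewrite mulrA ler_wpM2r// lerDl.
by rewrite mulrC -ler_pdivlMr.
Qed.

Lemma continuous_dot : continuous (fun x => dot x x).
Proof.
apply: continuous_big; first exact: add_continuous.
by move=> i _ x; apply: (@continuousM _ _ (fun x : 'rV[R]_d => x 0 i));
  exact: (@coord_continuous R 1 d 0 i).
Qed.

Lemma continuous_enorm : continuous (@enorm R d).
Proof. by move=> x; apply: continuous_comp (@continuous_dot x) (@sqrt_continuous _ _). Qed.

End euclidean_space.

(** * Projection onto a closed convex set *)

Section projection.
Context {R : realType} {d : nat} (X : set 'rV[R]_d).
Hypotheses (X0 : X !=set0) (Xcl : closed X) (Xcv : convex_set X).
Implicit Types (x y z w : 'rV[R]_d).

Lemma convex_segment x y (t : R) : X x -> X y -> 0 <= t -> t <= 1 ->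
  X (t *: x + (1 - t) *: y).
Proof.
move=> Xx Xy t0 t1.
have t01 : Itv.spec (@Itv.num_sem R) (Itv.Real `[0%Z, 1%Z]) t.
  by rewrite /= /Itv.num_sem /= num_real in_itv/= t0 t1.
have := @Xcv x y (Itv.mk t01) (mem_set Xx) (mem_set Xy).
by rewrite inE.
Qed.

Let nearest x y := X y /\ forall w, X w -> enorm (x - y) <= enorm (x - w).

(** The distance attains its minimum on the part of [X] in the closed ball around [x] through some
    [w0] of [X], which is compact; points of [X] outside this ball are farther than [w0]. *)
Lemma nearest_exists x : exists y, nearest x y.
Proof.
case: X0 => w0 Xw0.
pose f := fun w : 'rV[R]_d => enorm (x - w).
have cf : continuous f.
  move=> w; apply: (@continuous_comp _ _ _ (fun w => x - w) (@enorm R d)).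
    apply: (@continuous_enorm_lipschitz _ _ _ _ 1) => u v.
    by rewrite mul1r (_ : _ - _ = v - u) 1?enormB//; apply/rowP => i; rewrite !mxE; ring.
  exact: continuous_enorm.
pose B := X `&` f @^-1` [set r | r <= enorm (x - w0)].
have Bc : compact B.
  apply: bounded_closed_compact.
    exists (enorm (x - w0) + `|x|); split; first exact: num_real.
    move=> r hr w [_ /= hw]; rewrite -[w](subKr x).
    rewrite (le_trans (ler_normB _ _))// addrC (le_trans _ (ltW hr))//.
    by rewrite lerD2r (le_trans (norm_le_enorm _)).
  apply: closedI => //; apply: preimage_closed => [w _|]; first exact: cf.
  exact: (@closed_le R (enorm (x - w0))).
have [||y yB ymin] := @EVT_min_rV _ _ f B _ Bc _.
- by exists w0; split => //=.
- exact/continuous_subspaceT.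
move: yB; rewrite inE => -[Xy fy]; exists y; split => // w Xw.
have [wB|] := leP (f w) (f w0); first by apply: ymin; rewrite inE; split.
by move=> /ltW; apply: le_trans.
Qed.

Lemma proj_nearest x : nearest x (proj X x).
Proof. exact: (@xgetPex _ x _ (@nearest_exists x)). Qed.

Lemma projX x : X (proj X x).
Proof. by case: (@proj_nearest x). Qed.

Arguments projX : clear implicits.

Lemma proj_dot_le x w : X w -> dot (x - proj X x) (w - proj X x) <= 0.
Proof.
move=> Xw; set y := proj X x; have [Xy ymin] := @proj_nearest x.
rewrite leNgt; apply/negP => h.
set c := dot _ _ in h; set D := dot (w - y) (w - y).
have D0 : 0 <= D := dot_ge0 _.
(* Moving from [y] towards [w] by a fraction t changes the squared distance to [x] by t (t D - 2 c),
   which is negative for this t. The 1 in [D + 1] avoids a division by zero when [w] is [y]. *)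
pose t := Num.min 1 (c / (D + 1)).
have D1 : 0 < D + 1 by lra.
have t0 : 0 < t by rewrite lt_min ltr01 divr_gt0.
have t1 : t <= 1 by rewrite ge_min lexx.
have tc : t * (D + 1) <= c by rewrite -ler_pdivlMr// ge_min lexx orbT.
have := ymin _ (convex_segment Xw Xy (ltW t0) t1).
rewrite -(ler_pXn2r (n := 2))// ?nnegrE ?enorm_ge0// !sqr_enorm.
rewrite (_ : x - (_ + _) = (x - y) - t *: (w - y)); last first.
  by apply/rowP => i; rewrite !mxE; ring.
move: @c @D @t h D0 D1 t0 t1 tc; move: (x - y) (w - y) => u v c D t h D0 D1 t0 t1 tc.
rewrite !dotE (dotC v u) -/c -/D => hh.
have : 0 <= t * (t * D - 2 * c) by lra.
by rewrite pmulr_rge0// => h2; have := mulrDr t D 1; lra.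
Qed.

Arguments proj_dot_le x {w}.

Lemma proj_id x : X x -> proj X x = x.
Proof.
move=> Xx; have := proj_dot_le x Xx; rewrite -sqr_enorm => h.
have : enorm (x - proj X x) = 0.
  by apply/eqP; rewrite -sqrf_eq0 eq_le h sqr_ge0.
by move/enorm0_eq0/eqP; rewrite subr_eq0 => /eqP.
Qed.

(** The sum of the two variational inequalities is firm nonexpansiveness, and Cauchy-Schwarz
    concludes. *)
Lemma proj_lipschitz x y : enorm (proj X x - proj X y) <= enorm (x - y).
Proof.
have hx := proj_dot_le x (projX y); have hy := proj_dot_le y (projX x).
set u := proj X x in hx hy *; set v := proj X y in hx hy *.
have h : dot (u - v) (u - v) <= dot (x - y) (u - v).
  by move: hx hy; rewrite !dotE (dotC v u) (dotC x v); rewrite ?(dotC u x); lra.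
have [->|uv0] := eqVneq (enorm (u - v)) 0; first exact: enorm_ge0.
have uv1 : 0 < enorm (u - v) by rewrite lt_neqAle eq_sym uv0 enorm_ge0.
rewrite -(ler_pM2r uv1) -expr2 sqr_enorm (le_trans h)//; exact: cauchy_schwarz.
Qed.

Lemma nearest_continuous : continuous (proj X).
Proof.
apply: (@continuous_enorm_lipschitz _ _ _ _ 1) => x y.
by rewrite mul1r proj_lipschitz.
Qed.

(* The displacement per unit of step decreases with the step. *)
Lemma proj_step_le x v (a : R) : X x -> 0 < a -> a <= 1 ->
  a * enorm (x - proj X (x - v)) <= enorm (x - proj X (x - a *: v)).
Proof.
move=> Xx a0 a1.
have h1 := proj_dot_le (x - v) (projX (x - a *: v)).
have h2 := proj_dot_le (x - a *: v) (projX (x - v)).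
set u := proj X (x - v) in h1 h2 *; set w := proj X (x - a *: v) in h1 h2 *.
pose p := x - u; pose q := x - w.
have e1 : x - v - u = p - v by rewrite /p; apply/rowP => i; rewrite !mxE; ring.
have e2 : x - a *: v - w = q - a *: v by rewrite /q; apply/rowP => i; rewrite !mxE; ring.
have e3 : w - u = p - q by rewrite /p /q; apply/rowP => i; rewrite !mxE; ring.
have e4 : u - w = q - p by rewrite /p /q; apply/rowP => i; rewrite !mxE; ring.
rewrite e1 e3 in h1; rewrite e2 e4 in h2; rewrite -/p -/q.
clear e1 e2 e3 e4; clearbody p q.
have h3 : a * dot p p + dot q q <= (1 + a) * dot p q.
  have {h1} := ler_wpM2l (ltW a0) h1; move: h2.
  by rewrite !dotE mulr0 (dotC q p) (dotC v p) ?(dotC v q); lra.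
have h4 : a * enorm p ^+ 2 + enorm q ^+ 2 <= (1 + a) * (enorm p * enorm q).
  rewrite !sqr_enorm (le_trans h3)// ler_wpM2l ?cauchy_schwarz//; lra.
have p0 := enorm_ge0 p; have q0 := enorm_ge0 q.
(* [h4] is quadratic in the two norms and factors; so the norm of [q] lies between [a] times that of
   [p] and that of [p]. *)
have h5 : (a * enorm p - enorm q) * (enorm p - enorm q) <= 0 by lra.
rewrite leNgt; apply/negP => h6.
have h7 : enorm q < enorm p.
  by rewrite (lt_le_trans h6)// ler_piMl.
have : 0 < (a * enorm p - enorm q) * (enorm p - enorm q) by rewrite mulr_gt0 ?subr_gt0.
lra.
Qed.

End projection.

Arguments projX {R d X}.
Arguments proj_dot_le {R d X} X0 Xcl Xcv x {w}.

(** * Measurability of vector-valued maps *)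

Section vector_measurability.
Context {R : realType} {n : nat}.

Definition measurable_rV {dT} {T : measurableType dT} (f : T -> 'rV[R]_n) : Prop :=
  measurable_fun setT (f : T -> @borel_rV R n).

Lemma continuous_borel_measurable (g : 'rV[R]_n -> R) :
  continuous g -> measurable_fun setT (g : @borel_rV R n -> R).
Proof.
move=> cg; apply: (measurability _ (RGenOpens.measurableE R)).
move=> _ [_ [a [b ->] <-]]; rewrite setTI; apply: sub_sigma_algebra.
by apply: open_comp => [x _|]; [exact: cg|exact: interval_open].
Qed.

Lemma continuous_measurable_rV m (g : 'rV[R]_n -> 'rV[R]_m) :
  continuous g -> measurable_fun setT (g : @borel_rV R n -> @borel_rV R m).
Proof.
move=> cg; apply: (@measurability _ _ _ (@borel_rV R m) _ _ (@open 'rV[R]_m)); first by [].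
move=> _ [U oU <-]; rewrite setTI; apply: sub_sigma_algebra.
by apply: open_comp => // x _; exact: cg.
Qed.

Let box (u : 'rV[rat]_n * nat) : set 'rV[R]_n :=
  [set y | forall i, `|y 0 i - ratr (u.1 0 i)| < u.2.+1%:R^-1].

(* A vector-valued map is Borel measurable as soon as its coordinates are: every
   open set is a countable union of boxes with rational centers. *)
Lemma measurable_rV_coord {dT} {T : measurableType dT} (f : T -> 'rV[R]_n) :
  (forall i, measurable_fun setT (fun t => f t 0 i)) -> measurable_rV f.
Proof.
move=> mf; apply: (@measurability _ _ _ (@borel_rV R n) _ _ (@open 'rV[R]_n)); first by [].
move=> _ [U oU <-]; rewrite setTI.
have -> : U = \bigcup_(u in [set u | box u `<=` U]) box u.
  apply/seteqP; split => [y Uy|y [u /= uU uy]]; last exact: uU.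
  have /nbhs_normP[e /= e0 eU] : nbhs y U by exact: open_nbhs_nbhs.
  have [k _ /(_ k (leqnn k)) ke] := near_infty_natSinv_lt (PosNum (divr_gt0 e0 (ltr0Sn R 1))).
  rewrite /= in ke.
  have /choice[q hq] : forall i, exists q : rat, `|y 0 i - ratr q| < k.+1%:R^-1.
    move=> i; have k0 : y 0 i - k.+1%:R^-1 < y 0 i + k.+1%:R^-1.
      by rewrite ltrBlDr -addrA ltrDl addr_gt0// invr_gt0.
    have [q] := rat_in_itvoo k0; rewrite in_itv/= => /andP[q1 q2].
    exists q; move: q1 q2; move: (ratr q : R) (_^-1 : R) => a c q1 q2.
    by rewrite ltr_norml; apply/andP; split; lra.
  pose u : 'rV[rat]_n * nat := (\row_i q i, k).
  exists u; last by move=> i; rewrite mxE; exact: hq.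
  move=> z /= hz; apply: eU; rewrite /ball_/=.
  rewrite [ltLHS]/Num.norm /= mx_normrE; apply/bigmax_ltP; split => //.
  move=> [i j] _ /=; rewrite (ord1 i) !mxE.
  have := hz j; rewrite mxE => h1; have h2 := hq j.
  rewrite (_ : _ - _ = (y 0 j - ratr (q j)) - (z 0 j - ratr (q j))); last by ring.
  rewrite (le_lt_trans (ler_normB _ _))//.
  by move: ke h1 h2; move: (_^-1 : R) => c; lra.
rewrite preimage_bigcup bigcup_mkcond.
apply: countable_bigcupT_measurable => [|u]; first exact: countableP.
case: ifPn => // _.
have -> : f @^-1` box u = \bigcap_(i in [set: 'I_n])
    [set t | `|f t 0 i - ratr (u.1 0 i)| < u.2.+1%:R^-1].
  by apply/seteqP; split => [t h i _|t h i]; [exact: h|exact: (h i I)].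
apply: fin_bigcap_measurable => [|i _]; first exact: finite_finset.
rewrite -[X in measurable X]setTI.
have mg : measurable_fun setT (fun t => `|f t 0 i - ratr (u.1 0 i)| < u.2.+1%:R^-1).
  apply: measurable_fun_ltr => //; apply: measurableT_comp => //.
  exact: measurable_funB.
exact: (mg measurableT [set true]).
Qed.

Section maps.
Context {dT : measure_display} {T : measurableType dT}.
Implicit Types f g : T -> 'rV[R]_n.

Lemma coord_measurable f i : measurable_rV f -> measurable_fun setT (fun t => f t 0 i).
Proof.
have mc := continuous_borel_measurable (@coord_continuous R 1 n 0 i).
by move=> mf; exact: (measurableT_comp mc mf).
Qed.

Lemma measurable_rV_cst (x : 'rV[R]_n) : measurable_rV (fun _ : T => x).
Proof. exact: measurable_cst. Qed.

Lemma measurable_rVD f g : measurable_rV f -> measurable_rV g ->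
  measurable_rV (fun t => f t + g t).
Proof.
move=> mf mg; apply: measurable_rV_coord => i.
under eq_fun do rewrite mxE.
by apply: measurable_funD; exact: coord_measurable.
Qed.

Lemma measurable_rVZ (a : T -> R) f : measurable_fun setT a -> measurable_rV f ->
  measurable_rV (fun t => a t *: f t).
Proof.
move=> ma mf; apply: measurable_rV_coord => i.
under eq_fun do rewrite mxE.
by apply: measurable_funM => //; exact: coord_measurable.
Qed.

Lemma measurable_rVB f g : measurable_rV f -> measurable_rV g ->
  measurable_rV (fun t => f t - g t).
Proof.
move=> mf mg; apply: measurable_rVD => //.
under eq_fun do rewrite -scaleN1r.
by apply: measurable_rVZ.
Qed.

Lemma measurable_dot f g : measurable_rV f -> measurable_rV g ->
  measurable_fun setT (fun t => dot (f t) (g t)).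
Proof.
move=> mf mg; apply: measurable_sum => i.
by apply: measurable_funM; exact: coord_measurable.
Qed.

Lemma measurable_enorm f : measurable_rV f -> measurable_fun setT (fun t => enorm (f t)).
Proof.
have ms := continuous_measurable_fun (@sqrt_continuous R).
by move=> mf; exact: (measurableT_comp ms (measurable_dot mf mf)).
Qed.

End maps.

End vector_measurability.

Lemma measurable_rV_comp (R : realType) n m {dT} {T : measurableType dT}
    (g : 'rV[R]_n -> 'rV[R]_m) (f : T -> 'rV[R]_n) :
  continuous g -> measurable_rV f -> measurable_rV (fun t => g (f t)).
Proof. by move=> /continuous_measurable_rV mg mf; exact: measurableT_comp mg mf. Qed.

(** * Independence of the samples from the past *)

Section independence.
Local Open Scope ereal_scope.
Context {R : realType} {dO d1 d2 : measure_display}.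
Context {Omega : measurableType dO} {T1 : measurableType d1} {T2 : measurableType d2}.
Variables (Q : probability Omega R) (P : probability T2 R).

(** The law of the pair and the product of the law of [f] with [P] agree on rectangles, hence
    everywhere; Tonelli then integrates the second variable first. *)
Lemma integral_independent (f : Omega -> T1) (g : Omega -> T2) (h : T1 * T2 -> \bar R) :
  measurable_fun setT f -> measurable_fun setT g ->
  (forall B, measurable B -> Q (g @^-1` B) = P B) ->
  (forall A B, measurable A -> measurable B ->
    Q (f @^-1` A `&` g @^-1` B) = Q (f @^-1` A) * Q (g @^-1` B)) ->
  measurable_fun setT h -> (forall u, 0 <= h u) ->
  \int[Q]_w h (f w, g w) = \int[Q]_w \int[P]_z h (f w, z).
Proof.
move=> mf mg gP fg mh h0.
pose fm : {mfun Omega >-> T1} := HB.pack f (isMeasurableFun.Build _ _ _ _ _ mf).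
have mfg : measurable_fun setT (fun w => (f w, g w)) by exact: measurable_fun_pair.
pose fgm : {mfun Omega >-> (T1 * T2)%type} :=
  HB.pack (fun w => (f w, g w)) (isMeasurableFun.Build _ _ _ _ _ mfg).
pose m1 : probability T1 R := distribution Q fm.
pose m' : probability (T1 * T2)%type R := distribution Q fgm.
have m'E A : measurable A -> (m1 \x P) A = m' A.
  apply: product_measure_unique => {}A B mA mB.
  transitivity (Q (f @^-1` A `&` g @^-1` B)) => //.
  by rewrite fg// gP.
transitivity (\int[m']_u h u).
  by rewrite ge0_integral_pushforward.
rewrite -(@eq_measure_integral _ _ _ setT m' (m1 \x P)); last first.
  by move=> A mA _; exact: m'E.
rewrite fubini_tonelli1// ge0_integral_pushforward//.
- exact: measurable_fun_fubini_tonelli_F.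
- by move=> x _; exact: integral_ge0.
Qed.

End independence.

(** * The sigma-algebra of the past samples *)

Section past.
Context {R : realType} {dXi dO : measure_display}.
Context {Xi : measurableType dXi} {Omega : measurableType dO} {I : choiceType}.
Variables (Y : I -> Omega -> Xi).
Implicit Types J : set I.

(** Finite intersections are taken, rather than events of a single sample, to have a pi-system on
    which Dynkin's argument can start. *)
Definition cylinders J : set (set Omega) :=
  [set B | exists (s : seq I) (A : I -> set Xi),
    [/\ forall i, i \in s -> J i, forall i, measurable (A i) &
        B = \bigcap_(i in [set` s]) (Y i @^-1` A i)]].

(* [Omega] with the sigma-algebra generated by the samples of index in [J]. *)
Definition past J : measurableType (cylinders J).-sigma :=
  g_sigma_algebraType (cylinders J).

Lemma cylindersI J : setI_closed (cylinders J).
Proof.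
move=> B1 B2 [s1 [A1 [s1J mA1 ->]]] [s2 [A2 [s2J mA2 ->]]].
(* An index missing from one list puts no constraint there, and an index common to both receives
   both constraints. *)
pose A i := (if i \in s1 then A1 i else setT) `&` (if i \in s2 then A2 i else setT).
exists (s1 ++ s2), A; split.
- by move=> i; rewrite mem_cat => /orP[/s1J|/s2J].
- by move=> i; rewrite /A; case: ifP => _; case: ifP => _ //; exact: measurableI.
- apply/seteqP; split => w /=.
    by move=> [h1 h2] i /= _; split; [case: ifPn => // /h1|case: ifPn => // /h2].
  move=> h; split => i /= ii.
    by have := h i; rewrite /= mem_cat ii /A ii => /(_ isT)[].
  by have := h i; rewrite /= mem_cat ii orbT /A ii => /(_ isT)[].
Qed.

Lemma cylinders_measurable J : (forall i, J i -> measurable_fun setT (Y i)) ->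
  cylinders J `<=` measurable.
Proof.
move=> mY _ [s [A [sJ mA ->]]]; rewrite bigcap_seq big_seq.
apply: big_ind => [//|B C mB mC|i /sJ Ji]; first exact: measurableI.
by rewrite -[X in measurable X]setTI; exact: mY.
Qed.

Lemma past_measurable J : (forall i, J i -> measurable_fun setT (Y i)) ->
  forall d' (T : measurableType d') (f : Omega -> T),
  measurable_fun setT (f : past J -> T) -> measurable_fun setT f.
Proof.
move=> mY d' T f mf _ B mB; have := mf measurableT B mB.
rewrite !setTI => h.
exact: (smallest_sub (@sigma_algebra_measurable _ Omega) (cylinders_measurable mY) h).
Qed.

Lemma past_mono J J' d' (T : measurableType d') (f : Omega -> T) : J `<=` J' ->
  measurable_fun setT (f : past J -> T) -> measurable_fun setT (f : past J' -> T).
Proof.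
move=> JJ' mf _ B mB; have := mf measurableT B mB; rewrite !setTI => h.
apply: (smallest_sub (@sigma_algebra_measurable _ (past J')) _ h).
move=> _ [s [A [sJ mA ->]]]; apply: sub_gen_smallest.
by exists s, A; split => // i /sJ /JJ'.
Qed.

Lemma sample_past J i : J i -> measurable_fun setT (Y i : past J -> Xi).
Proof.
move=> Ji _ B mB; rewrite setTI; apply: sub_sigma_algebra.
exists [:: i], (fun=> B); split => // [j|]; first by rewrite inE => /eqP ->.
by rewrite bigcap_seq big_seq1.
Qed.

Variables (P : probability Xi R) (Q : probability Omega R) (D : set I).
Hypothesis hY : iid_family P Q D Y.

(** Dynkin induction on [A]. On a cylinder this is the independence of the family for the indices of
    the cylinder together with [i]; complements and disjoint unions follow by additivity. *)
Lemma past_independent J i A B : J `<=` D -> D i -> ~ J i ->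
  measurable (A : set (past J)) -> measurable B ->
  Q (A `&` Y i @^-1` B) = (Q A * Q (Y i @^-1` B))%E.
Proof.
move=> JD Di nJi mA mB; case: hY => mY YP indY; set C := Y i @^-1` B.
have mC : measurable C by rewrite -[C]setTI; exact: mY.
have mYJ j : J j -> measurable_fun setT (Y j) by move=> /JD; exact: mY.
have mcyl := cylinders_measurable mYJ.
have mJ (S : set (past J)) : measurable S -> (measurable (S : set Omega)).
  exact: (smallest_sub (@sigma_algebra_measurable _ Omega) mcyl).
apply: (@dynkin_induction _ (past J) (cylinders J)
  (fun A => Q (A `&` C) = Q A * Q C)%E) mA => //.
- exact: cylindersI.
- by rewrite setTI probability_setT mul1e.
- move=> _ [s [E [sJ mE ->]]].
  (* The product formula is available only for lists without repetition. *)
  pose s' := undup s.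
  have ss' : [set` s] = [set` s'] by apply/seteqP; split => j /=; rewrite mem_undup.
  have is' : i \notin s' by rewrite mem_undup; apply/negP => /sJ.
  have sD j : j \in s' -> D j by rewrite mem_undup => /sJ/JD.
  pose E' j := if j == i then B else E j.
  have E'E j : j \in s' -> E' j = E j.
    by move=> js; rewrite /E'; case: eqP => // ji; move: is'; rewrite -ji js.
  have h := @indY (i :: s') E' _ _ _.
  rewrite ss'; transitivity (Q (\bigcap_(j in [set` i :: s']) (Y j @^-1` E' j))).
    congr (Q _); rewrite !bigcap_seq big_cons setIC {1}/E' eqxx; congr (_ `&` _).
    by rewrite big_seq [RHS]big_seq; apply: eq_bigr => j /E'E ->.
  rewrite h.
  + rewrite big_cons muleC {2}/E' eqxx; congr (_ * _)%E.
    rewrite (@indY s' E _ sD mE) ?undup_uniq//.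
    by rewrite big_seq [RHS]big_seq; apply: eq_bigr => j /E'E ->.
  + by rewrite /= is' undup_uniq.
  + by move=> j; rewrite inE => /predU1P[->//|/sD].
  + by move=> j; rewrite /E'; case: ifP.
- move=> S mS /= QS; rewrite setIC -setDE measureD//; last first.
  + by rewrite -ge0_fin_numE// fin_num_measure.
  + exact: mJ.
  transitivity (Q C - Q S * Q C)%E.
    by congr (_ - _)%E; rewrite setIC; exact: QS.
  rewrite probability_setC; last exact: mJ.
  by rewrite muleBl ?mul1e// fin_num_measure.
- move=> G mG tG QG; rewrite setI_bigcupl measure_bigcup//.
  + rewrite measure_bigcup//; last by move=> k _; exact: mJ.
    have /fineK <- : Q C \is a fin_num by rewrite fin_num_measure.
    rewrite muleC -nneseriesZl//.
    by apply: eq_eseriesr => k _; rewrite fineK ?fin_num_measure// muleC; exact: QG.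
  + by move=> k _; apply: measurableI => //; exact: mJ.
  + exact: trivIset_setIr.
Qed.

(** The substitute for conditioning: the past is the identity map from [Omega] to [past J], so [h]
    may depend on it in any measurable way. *)
Lemma integral_past J i (h : past J * Xi -> \bar R) : J `<=` D -> D i -> ~ J i ->
  measurable_fun setT h -> (forall u, 0 <= h u)%E ->
  (\int[Q]_w h (w, Y i w) = \int[Q]_w \int[P]_z h (w, z))%E.
Proof.
move=> JD Di nJi mh h0; have [mY YP _] := hY.
apply: (@integral_independent _ _ _ _ Omega (past J) Xi Q P idfun (Y i)) => //.
- apply: (@past_measurable J _ _ (past J)); last exact: measurable_id.
  by move=> j /JD; exact: mY.
- exact: mY.
- by move=> B mB; exact: YP.
- by move=> A B mA mB; apply: (@past_independent J).
Qed.

End past.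

(** * Expectations *)

Section expectation_inequalities.
Context {R : realType} {dT : measure_display} {T : measurableType dT}.
Variable mu : probability T R.
Implicit Types (f g : T -> R) (c : R).

(** Extended-valued, so that sums and comparisons of nonnegative functions need measurability but no
    integrability. *)
Definition ex f : \bar R := (\int[mu]_t (f t)%:E)%E.

Lemma ex_ge0 f : (forall t, 0 <= f t) -> (0 <= ex f)%E.
Proof. by move=> f0; apply: integral_ge0 => t _; rewrite lee_fin. Qed.

Lemma ex_eq f g : f =1 g -> ex f = ex g.
Proof. by move=> fg; apply: eq_integral => t _; rewrite fg. Qed.

Lemma ex_le_ae f g : measurable_fun setT f -> measurable_fun setT g ->
  (forall t, 0 <= f t) -> (forall t, 0 <= g t) ->
  {ae mu, forall t, f t <= g t} -> (ex f <= ex g)%E.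
Proof.
move=> mf mg f0 g0 fg; apply: ae_ge0_le_integral => //.
- by move=> t _; rewrite lee_fin.
- exact/measurable_EFinP.
- by move=> t _; rewrite lee_fin.
- exact/measurable_EFinP.
- by apply: filterS fg => t ft _; rewrite lee_fin.
Qed.

Lemma ex_le f g : measurable_fun setT f -> measurable_fun setT g ->
  (forall t, 0 <= f t) -> (forall t, f t <= g t) -> (ex f <= ex g)%E.
Proof.
move=> mf mg f0 fg; apply: ex_le_ae => // [t|]; first exact: le_trans (f0 t) (fg t).
by apply: aeW => t.
Qed.

Lemma exD f g : measurable_fun setT f -> measurable_fun setT g ->
  (forall t, 0 <= f t) -> (forall t, 0 <= g t) ->
  ex (fun t => f t + g t) = (ex f + ex g)%E.
Proof.
move=> mf mg f0 g0; rewrite /ex -ge0_integralD//.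
- by move=> t _; rewrite lee_fin.
- exact/measurable_EFinP.
- by move=> t _; rewrite lee_fin.
- exact/measurable_EFinP.
Qed.

Lemma exZ c f : measurable_fun setT f -> (forall t, 0 <= f t) -> 0 <= c ->
  ex (fun t => c * f t) = (c%:E * ex f)%E.
Proof.
move=> mf f0 c0; rewrite /ex -ge0_integralZl_EFin//.
- by move=> t _; rewrite lee_fin.
- exact/measurable_EFinP.
Qed.

Lemma ex_cst c : ex (fun=> c) = c%:E.
Proof. by rewrite /ex -[LHS]/(\int[mu]_x (cst c%:E x))%E integral_cst// -[RHS]mule1; congr (_ * _)%E; exact: probability_setT. Qed.

Lemma ex_sum (I : Type) (s : seq I) (f : I -> T -> R) :
  (forall i, measurable_fun setT (f i)) -> (forall i t, 0 <= f i t) ->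
  ex (fun t => \sum_(i <- s) f i t) = (\sum_(i <- s) ex (f i))%E.
Proof.
move=> mf f0; rewrite /ex -ge0_integral_sum//.
- by apply: eq_integral => t _; rewrite sumEFin.
- by move=> i; exact/measurable_EFinP.
- by move=> i t _; rewrite lee_fin.
Qed.

Lemma integrable_ex f : measurable_fun setT f -> (ex (fun t => `|f t|)%R < +oo)%E ->
  mu.-integrable setT (EFin \o f).
Proof.
by move=> mf fi; apply/integrableP; split => //; exact/measurable_EFinP.
Qed.

Lemma ex_fine f : (forall t, 0 <= f t) -> (ex f < +oo)%E -> ex f = (fine (ex f))%:E.
Proof. by move=> f0 foo; rewrite fineK// ge0_fin_numE// ex_ge0. Qed.

Lemma ex_Rintegral f : mu.-integrable setT (EFin \o f) ->
  ex f = (\int[mu]_t f t)%:E.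
Proof. by move=> fi; rewrite /Rintegral fineK//; exact: integrable_fin_num. Qed.

Lemma square_integrable f : measurable_fun setT f ->
  (ex (fun t => f t ^+ 2)%R < +oo)%E -> mu.-integrable setT (EFin \o f).
Proof.
move=> mf foo; apply: integrable_ex => //.
apply: (@le_lt_trans _ _ (ex (fun t => 1 + f t ^+ 2))).
  apply: ex_le => //.
  - exact: measurableT_comp.
  - by apply: measurable_funD => //; exact: measurable_funX.
  - move=> t; have := sqr_ge0 (`|f t| - 1); rewrite -(real_normK (num_real (f t))).
    by rewrite sqrrB1; have := normr_ge0 (f t); lra.
rewrite exD ?ex_cst//; first by rewrite lte_add_pinfty// ltry.
- exact: measurable_funX.
- by move=> t; exact: sqr_ge0.
Qed.

Lemma Rintegral_sum_seq (I : Type) (s : seq I) (f : I -> T -> R) :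
  (forall i, mu.-integrable setT (EFin \o f i)) ->
  mu.-integrable setT (EFin \o (fun t => \sum_(i <- s) f i t)) /\
  (\int[mu]_t \sum_(i <- s) f i t) = \sum_(i <- s) \int[mu]_t f i t.
Proof.
move=> fi; elim: s => [|i s [IH1 IH2]].
  have -> : (fun t => \sum_(i <- [::]) f i t) = cst 0 by apply/funext => t; rewrite big_nil.
  by split; [exact: finite_measure_integrable_cst|rewrite big_nil Rintegral_cst ?mul0r].
have -> : (fun t => \sum_(j <- i :: s) f j t) = (fun t => f i t + \sum_(j <- s) f j t).
  by apply/funext => t; rewrite big_cons.
split.
  rewrite (_ : _ \o _ = (EFin \o f i) \+ (EFin \o (fun t => \sum_(j <- s) f j t)))//.
  exact: integrableD.
by rewrite RintegralD// IH2 big_cons.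
Qed.

(** Monotonicity and linearity in one application: the error budgets of an iteration have three
    terms, shorter ones being padded with 0. *)
Lemma ex_le_combination (c1 c2 c3 m1 m2 m3 : R) f g1 g2 g3 :
  measurable_fun setT f -> measurable_fun setT g1 -> measurable_fun setT g2 ->
  measurable_fun setT g3 -> (forall t, 0 <= f t) -> (forall t, 0 <= g1 t) ->
  (forall t, 0 <= g2 t) -> (forall t, 0 <= g3 t) -> 0 <= c1 -> 0 <= c2 -> 0 <= c3 ->
  {ae mu, forall t, f t <= c1 * g1 t + c2 * g2 t + c3 * g3 t} ->
  (ex g1 <= m1%:E)%E -> (ex g2 <= m2%:E)%E -> (ex g3 <= m3%:E)%E ->
  (ex f <= (c1 * m1 + c2 * m2 + c3 * m3)%:E)%E.
Proof.
move=> mf mg1 mg2 mg3 f0 g10 g20 g30 c10 c20 c30 h h1 h2 h3.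
have M c g : measurable_fun setT g -> measurable_fun setT (fun t => c * g t).
  by move=> mg; apply: measurable_funM.
have N c g : 0 <= c -> (forall t, 0 <= g t) -> forall t, 0 <= c * g t.
  by move=> c0 g0 t; exact: mulr_ge0.
apply: (@le_trans _ _ (ex (fun t => c1 * g1 t + c2 * g2 t + c3 * g3 t))).
  apply: ex_le_ae => //.
  - by apply: measurable_funD; [apply: measurable_funD|]; exact: M.
  - by move=> t; rewrite !addr_ge0 ?N.
rewrite exD; last 4 first.
- by apply: measurable_funD; exact: M.
- exact: M.
- by move=> t; rewrite addr_ge0 ?N.
- exact: N.
rewrite exD; last 4 first.
- exact: M.
- exact: M.
- exact: N.
- exact: N.
rewrite !exZ// !EFinD !EFinM.
by apply: leeD; [apply: leeD|]; apply: lee_pmul => //; exact: ex_ge0.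
Qed.

Lemma ex_random_index (f : nat -> T -> R) (l : T -> nat) (c t : R) :
  (forall n, measurable_fun setT (f n)) -> (forall n w, 0 <= f n w) ->
  measurable_fun setT (fun w => f (l w) w) -> 0 <= t < 1 -> 0 <= c ->
  (forall n, (ex (f n) <= (c * t ^+ n)%:E)%E) ->
  (ex (fun w => f (l w) w)%R <= (c / (1 - t))%:E)%E.
Proof.
move=> mf f0 mfl /andP[t0 t1] c0 hf.
apply: (@le_trans _ _ (\int[mu]_w (\sum_(0 <= n <oo) (f n w)%:E))%E).
  rewrite /ex; apply: ge0_le_integral => //.
  - by move=> w _; rewrite lee_fin.
  - exact/measurable_EFinP.
  - apply: ge0_emeasurable_sum => [n w _ _|n _]; first by rewrite lee_fin.
    exact/measurable_EFinP.
  - move=> w _; rewrite (@nneseriesD1 _ _ (l w))//; last by move=> n _; rewrite lee_fin.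
    by rewrite leeDl// nneseries_ge0// => n _ _; rewrite lee_fin.
rewrite integral_nneseries//; last 2 first.
- by move=> n; exact/measurable_EFinP.
- by move=> n w _; rewrite lee_fin.
apply: lime_le.
  by apply: is_cvg_nneseries => n _ _; exact: ex_ge0.
apply: nearW => n.
apply: (@le_trans _ _ (\sum_(0 <= i < n) (c * t ^+ i)%:E)%E).
  by apply: lee_sum => i _; exact: hf.
rewrite sumEFin lee_fin -mulr_sumr ler_wpM2l//.
rewrite -[leRHS]mul1r ler_pdivlMr ?subr_gt0// big_mkord.
have := subrX1 t n; have := exprn_ge0 n t0; move: (\sum_(i < n) _) => S; lra.
Qed.

End expectation_inequalities.

(** * Mean and second moment of a random vector *)

Section vector_mean.
Context {R : realType} {n : nat} {dT : measure_display} {T : measurableType dT}.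
Variables (mu : probability T R) (f : T -> 'rV[R]_n).
Hypotheses (mf : measurable_rV f) (foo : (ex mu (fun t => enorm (f t) ^+ 2)%R < +oo)%E).

Let m : 'rV[R]_n := \row_i \int[mu]_t f t 0 i.

Lemma coord_integrable i : mu.-integrable setT (EFin \o (fun t => f t 0 i)).
Proof.
apply: square_integrable; first exact: coord_measurable.
apply: le_lt_trans foo; apply: ex_le.
- by apply: measurable_funX; exact: coord_measurable.
- by apply: measurable_funX; exact: measurable_enorm.
- by move=> t; exact: sqr_ge0.
- by move=> t; rewrite -[leLHS]real_normK ?num_real// lerXn2r ?nnegrE ?enorm_ge0 ?coord_le_enorm.
Qed.

Lemma dot_integrable w : mu.-integrable setT (EFin \o (fun t => dot w (f t))) /\
  \int[mu]_t dot w (f t) = dot w m.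
Proof.
have h i : mu.-integrable setT (EFin \o (fun t => w 0 i * f t 0 i)).
  rewrite (_ : _ \o _ = (fun t => (w 0 i)%R%:E * (f t 0 i)%R%:E)%E)//.
  by apply: integrableZl => //; exact: coord_integrable.
have [h1 h2] := Rintegral_sum_seq (index_enum 'I_n) h.
split => //; rewrite h2; apply: eq_bigr => i _.
by rewrite RintegralZl ?mxE//; exact: coord_integrable.
Qed.

(** The bias-variance identity, with the term that would be subtracted moved to the left so that
    both sides are sums of nonnegative extended reals. *)
Lemma ex_sqr_shift y (a : R) :
  (ex mu (fun t => enorm (y + a *: (f t - m)) ^+ 2)%R + (a ^+ 2 * enorm m ^+ 2)%:E =
   (enorm y ^+ 2)%:E + (a ^+ 2)%:E * ex mu (fun t => enorm (f t) ^+ 2)%R)%E.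
Proof.
(* With the mean absorbed in [c], the square expands into a constant, one linear term in [f] and the
   square of [f]. *)
pose c := y - a *: m.
have fi : mu.-integrable setT (EFin \o (fun t => enorm (f t) ^+ 2)).
  apply: integrable_ex; first by apply: measurable_funX; exact: measurable_enorm.
  by rewrite (@ex_eq _ _ _ _ _ (fun t => enorm (f t) ^+ 2))// => t; rewrite ger0_norm// sqr_ge0.
have [di dE] := dot_integrable (2 * a *: c).
have cI (r : R) : mu.-integrable setT (EFin \o (fun=> r)).
  exact: finite_measure_integrable_cst.
have ai : mu.-integrable setT (EFin \o (fun t => a ^+ 2 * enorm (f t) ^+ 2)).
  rewrite (_ : _ \o _ = (fun t => (a ^+ 2)%R%:E * (enorm (f t) ^+ 2)%R%:E)%E)//.
  exact: integrableZl.
have e : (fun t => enorm (y + a *: (f t - m)) ^+ 2) =1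
    (fun t => (enorm c ^+ 2 + dot (2 * a *: c) (f t)) + a ^+ 2 * enorm (f t) ^+ 2).
  move=> t; rewrite (_ : y + _ = c + a *: f t); last first.
    by rewrite /c; apply/rowP => i; rewrite !mxE; ring.
  rewrite !sqr_enorm; move: {dE di} c (f t) => c g.
  by rewrite !dotE (dotC g c); ring.
have ci : mu.-integrable setT (EFin \o (fun t => enorm c ^+ 2 + dot (2 * a *: c) (f t))).
  rewrite (_ : _ \o _ = (EFin \o (fun=> enorm c ^+ 2)) \+ (EFin \o (fun t => dot (2 * a *: c) (f t))))//.
  exact: integrableD.
rewrite (ex_eq _ e) ex_Rintegral; last first.
  rewrite (_ : _ \o _ = (EFin \o (fun t => enorm c ^+ 2 + dot (2 * a *: c) (f t))) \+
    (EFin \o (fun t => a ^+ 2 * enorm (f t) ^+ 2)))//.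
  exact: integrableD.
rewrite RintegralD// RintegralD// RintegralZl// dE Rintegral_cst//.
rewrite (_ : fine _ = 1) ?mulr1; last by have /(congr1 fine) := probability_setT mu.
rewrite (ex_Rintegral fi) -EFinM -!EFinD; congr EFin.
rewrite !sqr_enorm /c; move: m => m'.
by rewrite !dotE (dotC m' y); ring.
Qed.

Lemma ex_sqr_shift_le y (a v : R) : (ex mu (fun t => enorm (f t) ^+ 2)%R <= v%:E)%E ->
  (ex mu (fun t => enorm (y + a *: (f t - m)) ^+ 2)%R <= (enorm y ^+ 2 + a ^+ 2 * v)%:E)%E.
Proof.
move=> fv; apply: (@le_trans _ _
    (ex mu (fun t => enorm (y + a *: (f t - m)) ^+ 2)%R + (a ^+ 2 * enorm m ^+ 2)%:E)%E).
  by rewrite leeDl// lee_fin mulr_ge0// sqr_ge0.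
rewrite ex_sqr_shift EFinD (EFinM (a ^+ 2)); apply: leeD2l; apply: lee_pmul => //.
  by rewrite lee_fin sqr_ge0.
by apply: ex_ge0 => t; exact: sqr_ge0.
Qed.

Lemma sqr_mean_le (v : R) : (ex mu (fun t => enorm (f t) ^+ 2)%R <= v%:E)%E ->
  enorm m ^+ 2 <= v.
Proof.
move=> fv; rewrite -lee_fin (le_trans _ fv)//.
have := ex_sqr_shift 0 1.
rewrite enorm0 expr0n expr1n mul1r add0e mul1e => <-.
by rewrite leeDr// ex_ge0// => t; exact: sqr_ge0.
Qed.

End vector_mean.

(** * Integrating the points of a batch one by one *)

Section batches.
Context {R : realType} {dXi dO : measure_display}.
Context {Xi : measurableType dXi} {Omega : measurableType dO} {I : choiceType}.
Variables (Y : I -> Omega -> Xi) (P : probability Xi R) (Q : probability Omega R).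
Variable (D : set I).
Hypothesis hY : iid_family P Q D Y.
Implicit Types J : set I.

Lemma past_measurable_iid J d' (T : measurableType d') (f : Omega -> T) : J `<=` D ->
  measurable_fun setT (f : past Y J -> T) -> measurable_fun setT f.
Proof. by move=> JD; apply: past_measurable => i /JD; case: hY => + _ _; apply. Qed.

Lemma past_mono_prod J J' d' (T : measurableType d') (h : Omega * Xi -> T) : J `<=` J' ->
  measurable_fun setT (h : past Y J * Xi -> T) ->
  measurable_fun setT (h : past Y J' * Xi -> T).
Proof.
move=> JJ' mh.
have id1 : measurable_fun setT ((fun w => w) : past Y J' -> past Y J).
  by apply: (past_mono JJ'); exact: measurable_id.
have m1 := measurableT_comp id1 (@measurable_fst _ _ (past Y J') Xi).
have m2 := measurable_fun_pair m1 (@measurable_snd _ _ (past Y J') Xi).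
have -> : h = h \o (fun u => (u.1, u.2)) by apply/funext => -[].
exact: measurableT_comp mh m2.
Qed.

Lemma past_fst J d' (T : measurableType d') (f : Omega -> T) :
  measurable_fun setT (f : past Y J -> T) ->
  measurable_fun setT ((fun u => f u.1) : past Y J * Xi -> T).
Proof. by move=> mf; exact: measurableT_comp mf (@measurable_fst _ _ _ _). Qed.

Lemma ex_sample J i (h : Omega -> Xi -> R) (H : Omega -> R) :
  J `<=` D -> D i -> ~ J i ->
  measurable_fun setT ((fun u => h u.1 u.2) : past Y J * Xi -> R) ->
  measurable_fun setT (H : past Y J -> R) ->
  (forall w z, 0 <= h w z) -> (forall w, (ex P (h w) <= (H w)%:E)%E) ->
  (ex Q (fun w => h w (Y i w))%R <= ex Q H)%E.
Proof.
move=> JD Di nJi mh mH h0 hH.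
rewrite /ex (@integral_past _ _ _ _ _ _ _ P Q D hY J i (fun u => (h u.1 u.2)%:E))//.
- apply: ge0_le_integral => //.
  + by move=> w _; apply: integral_ge0 => z _; rewrite lee_fin.
  + apply: (@past_measurable_iid J _ _ _ JD).
    apply: (@measurable_fun_fubini_tonelli_F _ _ (past Y J) Xi R P (fun u => (h u.1 u.2)%:E)).
      exact/measurable_EFinP.
    by move=> u; rewrite lee_fin.
  + by apply/measurable_EFinP; exact: past_measurable_iid mH.
  + by move=> w _; exact: hH.
- exact/measurable_EFinP.
- by move=> u; rewrite lee_fin.
Qed.

(** Orthogonality of martingale increments without cross terms: as the bound on [g] holds for every
    shift [y], the partial sum can serve as the shift when the next point is integrated. The
    measurability of the partial sum for the enlarged past is part of the conclusion because the
    induction needs it. *)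
Lemma ex_batch n J (s : seq I) (g : Omega -> Xi -> 'rV[R]_n) (u : Omega -> 'rV[R]_n)
    (v : Omega -> R) :
  J `<=` D -> uniq s -> (forall i, i \in s -> D i /\ ~ J i) ->
  measurable_rV ((fun p => g p.1 p.2) : past Y J * Xi -> 'rV[R]_n) ->
  measurable_rV (u : past Y J -> 'rV[R]_n) ->
  measurable_fun setT (v : past Y J -> R) -> (forall w, 0 <= v w) ->
  (forall w y, (ex P (fun z => enorm (y + g w z) ^+ 2)%R <= (enorm y ^+ 2 + v w)%:E)%E) ->
  measurable_rV ((fun w => u w + \sum_(i <- s) g w (Y i w)) : past Y (J `|` [set` s]) -> _) /\
  (ex Q (fun w => enorm (u w + \sum_(i <- s) g w (Y i w)) ^+ 2)%R <=
   ex Q (fun w => enorm (u w) ^+ 2)%R + (size s)%:R%:E * ex Q v)%E.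
Proof.
move=> JD us sD mg mu mv v0 hg; elim: s us sD => [_ _|i s IH /= /andP[is_ us] sD].
  under [X in measurable_rV X]eq_fun do rewrite big_nil addr0.
  split; first by apply: past_mono mu; exact: subsetUl.
  rewrite mul0e adde0 le_eqVlt; apply/orP; left; apply/eqP.
  by apply: ex_eq => w; rewrite big_nil addr0.
have [|mS IHs] := IH us; first by move=> j js; apply: sD; rewrite inE js orbT.
have [Di nJi] := sD i (mem_head _ _).
pose J' := J `|` [set` s]; pose S w := u w + \sum_(j <- s) g w (Y j w).
have J'D : J' `<=` D.
  by move=> j [/JD//|/= js]; have [] := sD j _; rewrite ?inE ?js ?orbT.
have nJ'i : ~ J' i by case => //= ; apply/negP.
have mg' : measurable_rV ((fun p => g p.1 p.2) : past Y J' * Xi -> 'rV[R]_n).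
  by apply: (past_mono_prod _ mg); exact: subsetUl.
have e w : u w + \sum_(j <- i :: s) g w (Y j w) = S w + g w (Y i w).
  by rewrite big_cons addrCA addrC.
have mv' : measurable_fun setT (v : past Y J' -> R) by apply: past_mono mv; exact: subsetUl.
have mS2 : measurable_fun setT ((fun w => enorm (S w) ^+ 2) : past Y J' -> R).
  by apply: measurable_funX; exact: measurable_enorm.
split.
  pose J'' := J `|` [set` i :: s].
  have JJ : J' `<=` J'' by move=> j [|/= js]; [left|right; rewrite /= inE js orbT].
  under [X in measurable_rV X]eq_fun do rewrite e.
  apply: measurable_rVD; first exact: past_mono JJ mS.
  have m1 : measurable_fun setT ((fun w => (w, Y i w)) : past Y J'' -> past Y J' * Xi).
    apply: measurable_fun_pair; last by apply: sample_past; right; rewrite /= mem_head.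
    by apply: (past_mono JJ); exact: measurable_id.
  exact: measurableT_comp mg' m1.
rewrite (@ex_eq _ _ _ _ _ (fun w => enorm (S w + g w (Y i w)) ^+ 2)); last by move=> w; rewrite e.
apply: (@le_trans _ _ (ex Q (fun w => enorm (S w) ^+ 2 + v w)%R)).
  apply: (@ex_sample J' i (fun w z => enorm (S w + g w z) ^+ 2)) => //.
  - apply: measurable_funX; apply: measurable_enorm; apply: measurable_rVD => //.
    exact: past_fst mS.
  - exact: measurable_funD.
  - by move=> w z; exact: sqr_ge0.
rewrite exD//; last 3 first.
- exact: past_measurable_iid mS2.
- exact: past_measurable_iid mv'.
- by move=> w; exact: sqr_ge0.
rewrite [size _]/= -natr1 EFinD ge0_muleDl ?lee_fin// mul1e [leRHS]addeA.
exact: leeD2r.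
Qed.

End batches.
Global Opaque ex.

(** * Moments of the random operator *)

Section random_operator.
Context {R : realType} {d : nat} {dXi : measure_display} {Xi : measurableType dXi}.
Variables (P : probability Xi R) (X : set 'rV[R]_d).
Variables (F : Xi -> 'rV[R]_d -> 'rV[R]_d) (Lip : Xi -> R).
Hypotheses (X0 : X !=set0) (Xcl : closed X) (Xcv : convex_set X).
Hypothesis mF : measurable_operator X F.
Hypothesis hF : heavy_tailed_lipschitz P X F Lip.

Local Notation T := (mean_operator P F).
Local Notation L := (fine (ex P Lip)).

Lemma measurable_operator_comp dT (S : measurableType dT) (f : S -> Xi) (g : S -> 'rV[R]_d) :
  measurable_fun setT f -> measurable_rV g -> (forall t, X (g t)) ->
  measurable_rV (fun t => F (f t) (g t)).
Proof.
move=> mf mg gX.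
have mX : measurable (X : set (@borel_rV R d)).
  rewrite -[X]setCK; apply: measurableC; apply: sub_sigma_algebra.
  exact: closed_openC.
have mfg : measurable_fun setT (fun t => (f t, g t) : Xi * @borel_rV R d).
  by apply: measurable_fun_pair.
have mSX : measurable (setT `*` X : set (Xi * @borel_rV R d)) by exact: measurableX.
apply: (@measurable_comp _ _ _ _ _ _ (setT `*` X : set (Xi * @borel_rV R d)) _ setT _ mSX _ mF mfg).
by move=> _ [t _ <-]; split => //=.
Qed.

Lemma measurable_operatorS x : X x -> measurable_rV (F ^~ x).
Proof. by move=> Xx; apply: measurable_operator_comp => //; exact: measurable_rV_cst. Qed.

Lemma Lip_measurable : measurable_fun setT Lip.
Proof. by case: hF => -[]. Qed.

Lemma Lip_ge0 z : 0 <= Lip z.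
Proof. by case: hF => -[]. Qed.

Lemma Lip_good : {ae P, forall z, 1 <= Lip z /\
  forall x y, X x -> X y -> enorm (F z x - F z y) <= Lip z * enorm (x - y)}.
Proof. by case: hF. Qed.

Lemma ex_power_lt_pinfty (f : Xi -> R) m k : measurable_fun setT f -> (forall z, 0 <= f z) ->
  (m <= k)%N -> (ex P (fun z => f z ^+ k)%R < +oo)%E -> (ex P (fun z => f z ^+ m)%R < +oo)%E.
Proof.
move=> mf f0 mk foo.
apply: (@le_lt_trans _ _ (ex P (fun z => 1 + f z ^+ k)%R)).
  apply: ex_le.
  - exact: measurable_funX.
  - by apply: measurable_funD => //; exact: measurable_funX.
  - by move=> z; exact: exprn_ge0.
  - move=> z; have [f1|f1] := leP (f z) 1.
      by rewrite (le_trans (exprn_ile1 _ _ _))// lerDl exprn_ge0.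
    by rewrite (le_trans (ler_weXn2l (ltW f1) mk))// lerDr.
rewrite exD ?ex_cst//; first by rewrite lte_add_pinfty// ltry.
- exact: measurable_funX.
- by move=> z; exact: exprn_ge0.
Qed.

Lemma moment_exponent_ge1 : (2 <= 2 * moment_exponent X)%N.
Proof. by rewrite /moment_exponent; case: ifP. Qed.

Lemma moment_exponent_noncompact : ~ compact X -> (4 <= 2 * moment_exponent X)%N.
Proof. by move=> /asboolPn/negbTE h; rewrite /moment_exponent h. Qed.

Lemma ex_Lip_lt_pinfty k : (k <= 2 * moment_exponent X)%N ->
  (ex P (fun z => Lip z ^+ k)%R < +oo)%E.
Proof.
move=> h; apply: ex_power_lt_pinfty h _; [exact: Lip_measurable|exact: Lip_ge0|].
by case: hF => _ _ _; rewrite unlock.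
Qed.

Lemma ex_F_lt_pinfty k : (k <= 2 * moment_exponent X)%N ->
  exists2 xs, X xs & (ex P (fun z => enorm (F z xs) ^+ k)%R < +oo)%E.
Proof.
move=> h; case: hF => _ _ [xs Xxs Foo] _; exists xs => //.
move: Foo; rewrite unlock => Foo.
apply: ex_power_lt_pinfty h Foo; last by move=> z; exact: enorm_ge0.
exact/measurable_enorm/measurable_operatorS.
Qed.
Arguments ex_F_lt_pinfty : clear implicits.

Lemma ex_Lip : ex P Lip = L%:E.
Proof.
apply: ex_fine; first exact: Lip_ge0.
have := @ex_Lip_lt_pinfty 1; rewrite (leq_trans _ moment_exponent_ge1)// => /(_ isT).
by rewrite (@ex_eq _ _ _ _ _ Lip)// => z; rewrite expr1.
Qed.

Lemma L_ge1 : 1 <= L.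
Proof.
rewrite -lee_fin -ex_Lip -(ex_cst P); apply: ex_le_ae => //.
- exact: Lip_measurable.
- exact: Lip_ge0.
- by apply: filterS Lip_good => z [].
Qed.

Lemma operator_growth_ae x xs : X x -> X xs ->
  {ae P, forall z, enorm (F z x) ^+ 2 <=
    2 * enorm (F z xs) ^+ 2 + 2 * enorm (x - xs) ^+ 2 * Lip z ^+ 2}.
Proof.
move=> Xx Xxs; apply: filterS Lip_good => z [_ h].
rewrite -{1}(subrK (F z xs) (F z x)) (le_trans (sqr_enormD _ _))// addrC lerD2l -mulrA.
rewrite ler_wpM2l// -exprMn mulrC lerXn2r ?nnegrE ?enorm_ge0 ?mulr_ge0 ?enorm_ge0 ?Lip_ge0//.
exact: h.
Qed.

Lemma measurable_sqr_enormF x : X x -> measurable_fun setT (fun z => enorm (F z x) ^+ 2).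
Proof. by move=> Xx; apply/measurable_funX/measurable_enorm/measurable_operatorS. Qed.

Lemma measurable_LipX k : measurable_fun setT (fun z => Lip z ^+ k).
Proof. by apply: measurable_funX; exact: Lip_measurable. Qed.

(** The operator at [x] is compared with its value at the point [xs] of finite moment; the center is
    then moved from [xs] to [p], from which the recursion measures distances. *)
Lemma second_moment_growth p : exists2 B : R, 0 < B &
  (ex P (fun z => Lip z ^+ 2)%R <= B%:E)%E /\
  forall x, X x -> (ex P (fun z => enorm (F z x) ^+ 2)%R <= (B * (1 + enorm (x - p) ^+ 2))%:E)%E.
Proof.
have [xs Xxs Foo] := ex_F_lt_pinfty 2 moment_exponent_ge1.
have Loo := ex_Lip_lt_pinfty moment_exponent_ge1.
have F0 z : 0 <= enorm (F z xs) ^+ 2 by exact: sqr_ge0.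
have L0 z : 0 <= Lip z ^+ 2 by exact: sqr_ge0.
have := ex_fine F0 Foo; have := ex_fine L0 Loo.
set kL := fine _; set kF := fine _ => kLE kFE.
have kL0 : 0 <= kL by rewrite -lee_fin -kLE ex_ge0.
have kF0 : 0 <= kF by rewrite -lee_fin -kFE ex_ge0.
pose q := enorm (p - xs) ^+ 2; have q0 : 0 <= q by exact: sqr_ge0.
(* The first two terms come from the comparison with [xs] and the change of center, [kL] lets the
   constant bound the moment of [Lip] as well, and 1 makes it positive. *)
exists (2 * kF + 4 * kL * (1 + q) + kL + 1).
  by rewrite ltr_wpDl// !addr_ge0 ?mulr_ge0 ?addr_ge0.
split.
  by rewrite kLE lee_fin -addrA addrC -addrA lerDl addr_ge0// addr_ge0 ?mulr_ge0 ?addr_ge0.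
move=> x Xx.
apply: (@le_trans _ _ (ex P (fun z => 2 * enorm (F z xs) ^+ 2 + 2 * enorm (x - xs) ^+ 2 * Lip z ^+ 2)%R)).
  apply: ex_le_ae.
  - exact: measurable_sqr_enormF.
  - apply: measurable_funD; apply: measurable_funM => //; first exact: measurable_sqr_enormF.
    exact: measurable_LipX.
  - by move=> z; exact: sqr_ge0.
  - by move=> z; apply: addr_ge0; apply: mulr_ge0 => //; apply: mulr_ge0 => //; exact: sqr_ge0.
  - exact: operator_growth_ae.
rewrite exD; last 4 first.
- by apply: measurable_funM => //; exact: measurable_sqr_enormF.
- by apply: measurable_funM => //; exact: measurable_LipX.
- by move=> z; rewrite mulr_ge0.
- by move=> z; do 2 apply: mulr_ge0 => //; exact: sqr_ge0.
rewrite (exZ _ (measurable_sqr_enormF Xxs) F0 (ler0n R 2)).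
have c0 : 0 <= 2 * enorm (x - xs) ^+ 2 by apply: mulr_ge0 => //; exact: sqr_ge0.
rewrite (exZ _ (@measurable_LipX 2) L0 c0).
rewrite kLE kFE -!EFinM -EFinD lee_fin.
have h : enorm (x - xs) ^+ 2 <= 2 * enorm (x - p) ^+ 2 + 2 * q.
  by rewrite -(subrKA p x (- xs)); exact: sqr_enormD.
move: (enorm (x - p) ^+ 2) (sqr_ge0 (enorm (x - p))) h => a a0 h.
have := ler_wpM2l kL0 h; have := mulr_ge0 kF0 a0; have := mulr_ge0 kL0 a0.
have := mulr_ge0 (mulr_ge0 kL0 q0) a0.
clearbody q; move: (enorm (x - xs) ^+ 2) h => s; lra.
Qed.

(** Testing against [T x - T y] itself reduces the bound to a scalar integral; one factor
    [enorm (T x - T y)] is divided out. *)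
Lemma mean_lipschitz x y : X x -> X y -> enorm (T x - T y) <= L * enorm (x - y).
Proof.
move=> Xx Xy; have [->|n0] := eqVneq (enorm (T x - T y)) 0.
  by rewrite mulr_ge0 ?enorm_ge0// (le_trans _ L_ge1).
have n1 : 0 < enorm (T x - T y) by rewrite lt_neqAle eq_sym n0 enorm_ge0.
rewrite -(ler_pM2r n1) -expr2 sqr_enorm.
pose w := T x - T y; rewrite -/w.
have [Bx _ [_ /(_ _ Xx) hx]] := second_moment_growth x.
have [By _ [_ /(_ _ Xy) hy]] := second_moment_growth y.
have [ix ex_] := dot_integrable (measurable_operatorS Xx) (le_lt_trans hx (ltry _)) w.
have [iy ey_] := dot_integrable (measurable_operatorS Xy) (le_lt_trans hy (ltry _)) w.
have mD : measurable_rV (fun z => F z x - F z y).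
  by apply: measurable_rVB; exact: measurable_operatorS.
have mw : measurable_fun setT (fun z => dot w (F z x - F z y)).
  by apply: measurable_dot => //; exact: measurable_rV_cst.
have iD : P.-integrable setT (EFin \o (fun z => dot w (F z x - F z y))).
  rewrite (_ : _ \o _ = ((EFin \o (fun z => dot w (F z x))) \- (EFin \o (fun z => dot w (F z y))))%E).
    exact: integrableB.
  by apply/funext => z /=; rewrite dotDr dotNr EFinB.
have -> : dot w w = \int[P]_z dot w (F z x - F z y).
  transitivity (dot w (T x) - dot w (T y)); first by rewrite -dotNr -dotDr.
  rewrite -[dot w (T x)]ex_ -[dot w (T y)]ey_ -RintegralB//.
  by apply: eq_Rintegral => z _; rewrite dotDr dotNr.
rewrite -lee_fin -ex_Rintegral//.
apply: (@le_trans _ _ (ex P (fun z => `|dot w (F z x - F z y)|)%R)).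
  rewrite (le_trans (lee_abs _))// (le_trans (le_abse_integral _ _ _))//.
  exact/measurable_EFinP.
apply: (@le_trans _ _ (ex P (fun z => enorm (x - y) * enorm w * Lip z)%R)); last first.
  rewrite exZ ?mulr_ge0 ?enorm_ge0//; [|exact: Lip_measurable|exact: Lip_ge0].
  by rewrite ex_Lip -EFinM lee_fin mulrC mulrA.
apply: ex_le_ae => //.
- exact: measurableT_comp.
- by apply: measurable_funM => //; exact: Lip_measurable.
- by move=> z; rewrite !mulr_ge0 ?enorm_ge0 ?Lip_ge0.
apply: filterS Lip_good => z [_ /(_ _ _ Xx Xy) h].
have h1 := cauchy_schwarz w (F z x - F z y).
have h2 := cauchy_schwarz (- w) (F z x - F z y).
rewrite enormN dotNl in h2.
apply: (@le_trans _ _ (enorm w * enorm (F z x - F z y))).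
  by rewrite ler_norml h1 andbT lerNl.
by rewrite mulrC mulrAC ler_wpM2r ?enorm_ge0// mulrC.
Qed.

(** [T] is controlled on [X] only; composing it with the projection gives a map continuous on the
    whole space, hence Borel, that agrees with [T] on [X]. *)
Lemma mean_proj_continuous : continuous (fun x => T (proj X x)).
Proof.
apply: (@continuous_enorm_lipschitz _ _ _ _ L) => x y.
rewrite (le_trans (mean_lipschitz _ _))//; [exact: projX|exact: projX|].
by rewrite ler_wpM2l ?(le_trans _ L_ge1)// proj_lipschitz.
Qed.

Lemma measurable_mean dT (S : measurableType dT) (x : S -> 'rV[R]_d) :
  measurable_rV x -> (forall w, X (x w)) -> measurable_rV (fun w => T (x w)).
Proof.
move=> mx Xx; rewrite (_ : (fun w => _) = (fun w => T (proj X (x w)))).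
  exact: (measurable_rV_comp mean_proj_continuous mx).
by apply/funext => w; rewrite proj_id.
Qed.

Lemma moment_bounds p : exists2 B : R, 0 < B & [/\
  (ex P (fun z => Lip z ^+ 2)%R <= B%:E)%E,
  forall x, X x -> (ex P (fun z => enorm (F z x) ^+ 2)%R <= (B * (1 + enorm (x - p) ^+ 2))%:E)%E &
  ~ compact X -> forall x y, X x ->
    (ex P (fun z => Lip z ^+ 2 * enorm (y + (F z x - T x)) ^+ 2)%R <=
     (2 * B * enorm y ^+ 2 + B * (1 + enorm (x - p) ^+ 2))%:E)%E].
Proof.
have [B0 B00 [hL hFx]] := second_moment_growth p.
have [cX|ncX] := pselect (compact X); first by exists B0.
have [xs Xxs Foo] := ex_F_lt_pinfty 4 (moment_exponent_noncompact ncX).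
have Loo := ex_Lip_lt_pinfty (moment_exponent_noncompact ncX).
have F0 z : 0 <= enorm (F z xs) ^+ 4 by exact/exprn_ge0/enorm_ge0.
have L0 k z : 0 <= Lip z ^+ k by exact/exprn_ge0/Lip_ge0.
have mF4 : measurable_fun setT (fun z => enorm (F z xs) ^+ 4).
  exact/measurable_funX/measurable_enorm/measurable_operatorS.
have := ex_fine F0 Foo; have := ex_fine (L0 4) Loo.
set kL := fine _; set kF := fine _ => kLE kFE.
have kL0 : 0 <= kL by rewrite -lee_fin -kLE ex_ge0.
have kF0 : 0 <= kF by rewrite -lee_fin -kFE ex_ge0.
pose q := enorm (p - xs) ^+ 2; have q0 : 0 <= q by exact: sqr_ge0.
(* The terms after [B0] dominate the part of the weighted bound that does not involve [y]: [c * B0]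
   contributes [4 * B0 ^+ 2], and [8 * s * kL] contributes [16 * kL * (1 + q)] after the change of
   center. *)
pose B := B0 + 4 * B0 ^+ 2 + 4 * kL + 4 * kF + 16 * kL * (1 + q).
have B0B : B0 <= B.
  by rewrite /B -!addrA lerDl !addr_ge0// !mulr_ge0// ?addr_ge0// ltW.
have B0_ge0 := ltW B00.
exists B; first exact: lt_le_trans B0B.
split.
- by rewrite (le_trans hL)// lee_fin.
- move=> x Xx; rewrite (le_trans (hFx x Xx))// lee_fin ler_wpM2r//.
  by rewrite addr_ge0// sqr_ge0.
move=> _ x y Xx; pose a := enorm (x - p) ^+ 2; have a0 : 0 <= a by exact: sqr_ge0.
pose c := 2 * enorm y ^+ 2 + 4 * (B0 * (1 + a)).
pose s := enorm (x - xs) ^+ 2; have s0 : 0 <= s by exact: sqr_ge0.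
have Tx : enorm (T x) ^+ 2 <= B0 * (1 + a).
  exact: (sqr_mean_le (measurable_operatorS Xx) (le_lt_trans (hFx x Xx) (ltry _)) (hFx x Xx)).
have a1 : 0 <= 1 + a by exact: addr_ge0.
have c0 : 0 <= c.
  by apply: addr_ge0; [apply: mulr_ge0 => //; exact: sqr_ge0|apply: mulr_ge0 => //; exact: mulr_ge0].
have d0 : 0 <= 4 + 8 * s by lra.
have mFT : measurable_rV (fun z => y + (F z x - T x)).
  apply: measurable_rVD; first exact: measurable_rV_cst.
  by apply: measurable_rVB; [exact: measurable_operatorS|exact: measurable_rV_cst].
apply: (@le_trans _ _ (ex P (fun z => c * Lip z ^+ 2 +
    ((4 + 8 * s) * Lip z ^+ 4 + 4 * enorm (F z xs) ^+ 4))%R)).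
  apply: ex_le_ae.
  - apply: measurable_funM; first exact: measurable_LipX.
    exact/measurable_funX/measurable_enorm.
  - apply: measurable_funD; first by apply: measurable_funM => //; exact: measurable_LipX.
    by apply: measurable_funD; apply: measurable_funM => //; exact: measurable_LipX.
  - by move=> z; apply: mulr_ge0 => //; exact: sqr_ge0.
  - by move=> z; apply: addr_ge0; [exact: mulr_ge0|apply: addr_ge0; exact: mulr_ge0].
  apply: filterS (operator_growth_ae Xx Xxs) => z.
  have h1 := sqr_enormD y (F z x - T x).
  have h2 := sqr_enormD (F z x) (- T x); rewrite enormN in h2.
  (* Splits the mixed product of squares into fourth powers, which are integrable as [X] is not
     compact. *)
  have h3 := sqr_ge0 (Lip z ^+ 2 - enorm (F z xs) ^+ 2).
  rewrite -/s => h4.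
  apply: (@le_trans _ _ (Lip z ^+ 2 * (2 * enorm y ^+ 2 + 2 * (2 * (2 * enorm (F z xs) ^+ 2 +
      2 * s * Lip z ^+ 2) + 2 * (B0 * (1 + a)))))).
    by rewrite ler_wpM2l//; lra.
  have -> : Lip z ^+ 4 = Lip z ^+ 2 * Lip z ^+ 2 by rewrite -exprD.
  have -> : enorm (F z xs) ^+ 4 = enorm (F z xs) ^+ 2 * enorm (F z xs) ^+ 2 by rewrite -exprD.
  move: h3; rewrite /c; clearbody s a; move: (enorm (F z xs) ^+ 2) => F2.
  by move: (Lip z ^+ 2) (enorm y ^+ 2) => l2 y2; lra.
rewrite exD; last 4 first.
- by apply: measurable_funM => //; exact: measurable_LipX.
- by apply: measurable_funD; apply: measurable_funM => //; exact: measurable_LipX.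
- by move=> z; exact: mulr_ge0.
- by move=> z; apply: addr_ge0; exact: mulr_ge0.
rewrite exD; last 4 first.
- by apply: measurable_funM => //; exact: measurable_LipX.
- by apply: measurable_funM => //; exact: measurable_LipX.
- by move=> z; exact: mulr_ge0.
- by move=> z; exact: mulr_ge0.
rewrite (exZ _ (@measurable_LipX 2) (L0 2) c0) (exZ _ (@measurable_LipX 4) (L0 4) d0).
rewrite (exZ _ mF4 F0 (ler0n R 4)) kLE kFE -!EFinM -EFinD.
apply: (@le_trans _ _ (c%:E * B0%:E + ((4 + 8 * s) * kL + 4 * kF)%:E)%E).
  by apply: leeD2r; apply: lee_pmul => //; apply: ex_ge0.
rewrite -EFinM -EFinD lee_fin -/a.
have h : s <= 2 * a + 2 * q by rewrite /s -(subrKA p x (- xs)); exact: sqr_enormD.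
have := ler_wpM2l kL0 h; have := mulr_ge0 kF0 a0; have := mulr_ge0 kL0 a0.
have := mulr_ge0 (mulr_ge0 kL0 q0) a0.
have hy : B0 * enorm y ^+ 2 <= B * enorm y ^+ 2 by rewrite ler_wpM2r// sqr_ge0.
have := mulr_ge0 B0_ge0 a0; move: hy; rewrite /c /B.
move: (enorm y ^+ 2) B0_ge0 => y2; clear -kL0 kF0 q0 a0; clearbody kL kF s q a.
lra.
Qed.

End random_operator.

(** * The deterministic extragradient step *)

Section extragradient_step.
Context {R : realType} {d : nat} (X : set 'rV[R]_d).
Hypotheses (X0 : X !=set0) (Xcl : closed X) (Xcv : convex_set X).
Implicit Types (x y z p g h G T : 'rV[R]_d) (a lam : R).

(* The squared norm of [p - z + a *: (G - T)] is kept unexpanded: in the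
   application [G - T] is a centered error independent of [z], so the expectation
   of this term splits without any signed integral. *)
Lemma extragradient_inequality x z y p g h G T a lam : X p -> 0 <= a -> lam <= 2^-1 ->
  z = proj X (x - a *: g) -> y = proj X (x - a *: G) ->
  dot T (p - z) <= 0 -> a * enorm (h - g) <= lam * enorm (z - x) ->
  enorm (y - p) ^+ 2 + 2^-1 * enorm (x - z) ^+ 2 + enorm (p - z) ^+ 2 <=
  enorm (x - p) ^+ 2 + 3 * (a ^+ 2 * enorm (G - T) ^+ 2) +
  4 * (a ^+ 2 * enorm (h - T) ^+ 2) + enorm (p - z + a *: (G - T)) ^+ 2.
Proof.
move=> Xp a0 lam2 zE yE hT hls.
have h1 : dot (x - a *: g - z) (y - z) <= 0.
  by rewrite zE; apply: proj_dot_le => //; rewrite yE; exact: projX.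
have h2 : dot (x - a *: G - y) (p - y) <= 0 by rewrite yE; exact: proj_dot_le.
move: {zE yE} h1 h2 hT hls; rewrite (enormB z x).
rewrite (_ : x - a *: g - z = x - z - a *: g); last by rewrite addrAC.
rewrite (_ : x - a *: G - y = (x - z) - a *: G - (y - z)); last first.
  by apply/rowP => i; rewrite !mxE; ring.
rewrite (_ : p - y = (p - z) - (y - z)); last by rewrite opprB addrA subrK.
rewrite (_ : y - p = (y - z) - (p - z)); last by rewrite opprB addrA subrK.
rewrite (_ : x - p = (x - z) - (p - z)); last by rewrite opprB addrA subrK.
move: (x - z) (y - z) (p - z) => u v w h1 h2 hT hls.
(* By the line search test and [lam <= 2^-1], this cross term costs half of |x - z|^2 and half of |y
   - z|^2. *)
have h3 : 2 * (a * dot (g - h) v) <= 2^-1 * dot u u + 2^-1 * dot v v.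
  have := cauchy_schwarz (g - h) v; rewrite (enormB g h) => cs.
  have := ler_wpM2l a0 cs; rewrite mulrA => {}cs.
  have := ler_wpM2r (enorm_ge0 v) hls => cs2.
  have lu : lam * enorm u * enorm v <= 2^-1 * (enorm u * enorm v).
    by rewrite -mulrA ler_wpM2r// mulr_ge0 ?enorm_ge0.
  have := sqr_ge0 (enorm u - enorm v); rewrite sqrrB !sqr_enorm mulr2n; lra.
(* This spends the other half of |y - z|^2. With [h5] both errors get the coefficient 4; for [G - T]
   one of the four is already in the unexpanded square, which leaves 3. *)
have h4 : 2 * (a * dot (h - G) v) <= 2^-1 * dot v v + 2 * (a ^+ 2 * dot (h - G) (h - G)).
  have := dot_ge0 (v - (2 * a) *: (h - G)).
  move: (h - G) => e; rewrite !dotE (dotC v e); lra.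
have h5 : dot (h - G) (h - G) <= 2 * dot (h - T) (h - T) + 2 * dot (G - T) (G - T).
  have := sqr_enormD (h - T) (- (G - T)); rewrite enormN !sqr_enorm.
  by rewrite (_ : h - T - (G - T) = h - G) //; apply/rowP => i; rewrite !mxE; ring.
have := ler_wpM2l (sqr_ge0 a) h5; rewrite !sqr_enorm => {}h5.
have e2 : G = T + (G - T) by rewrite addrC subrK.
have e3 : dot (h - G) v = dot h v - dot G v by rewrite !dotE.
have e4 : dot (g - h) v = dot g v - dot h v by rewrite !dotE.
have e5 : dot G w = dot T w + dot (G - T) w by rewrite {1}e2 dotDl.
have aT := ler_wpM2l a0 hT; rewrite mulr0 in aT.
rewrite e3 in h4; rewrite e4 in h3.
move: h1 h2 h3 h4 h5 e5; move: (h - T) (G - T) (h - G) => f3 f2 f1.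
rewrite !dotE ?(dotC v u) ?(dotC w u) ?(dotC w v) ?(dotC f2 w).
rewrite ?(dotC v g) ?(dotC v G) ?(dotC v h) ?(dotC w G) ?(dotC w T).
move=> h1 h2 h3 h4 h5 e5.
have := congr1 ( *%R a) e5; rewrite mulrDr => {}e5.
lra.
Qed.

(* Comparison of the error at the random point [z] with the error at the point
   [y], which does not depend on the current sample. *)
Lemma trial_error (f T : 'rV[R]_d -> 'rV[R]_d) (l L a : R) x y z :
  X x -> X y -> X z -> 0 <= a -> a <= 1 -> 0 <= L ->
  z = proj X (x - a *: f x) -> y = proj X (x - a *: T x) ->
  (forall u v, X u -> X v -> enorm (f u - f v) <= l * enorm (u - v)) ->
  (forall u v, X u -> X v -> enorm (T u - T v) <= L * enorm (u - v)) ->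
  a ^+ 2 * enorm (f z - T z) ^+ 2 <= 2 * (a ^+ 2 * enorm (f y - T y) ^+ 2) +
    16 * L ^+ 2 * enorm (f x - T x) ^+ 2 + 4 * ((l - L) ^+ 2 * enorm (z - y) ^+ 2) /\
  enorm (z - y) ^+ 2 <= enorm (f x - T x) ^+ 2.
Proof.
move=> Xx Xy Xz a0 a1 L0 zE yE lf lT.
have zy : enorm (z - y) <= enorm (f x - T x).
  rewrite zE yE (le_trans (proj_lipschitz X0 Xcl Xcv _ _))//.
  rewrite (_ : _ - _ = a *: (T x - f x)); last by apply/rowP => i; rewrite !mxE; ring.
  by rewrite enormZ ger0_norm// enormB ler_piMl// enorm_ge0.
have zy2 : enorm (z - y) ^+ 2 <= enorm (f x - T x) ^+ 2.
  by rewrite lerXn2r ?nnegrE ?enorm_ge0.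
split => //.
have a21 : a ^+ 2 <= 1 by rewrite exprn_ile1.
(* The sum l + L is written through the deviation of l from L, which is small in mean square when l
   is the average of a batch. *)
have h1 : enorm ((f z - f y) - (T z - T y)) <= (`|l - L| + 2 * L) * enorm (z - y).
  rewrite (le_trans (enormD _ _))// enormN (le_trans (lerD (lf _ _ Xz Xy) (lT _ _ Xz Xy)))//.
  rewrite -mulrDl ler_wpM2r ?enorm_ge0//; have := ler_norm (l - L); lra.
have h2 := sqr_enormD (f y - T y) ((f z - f y) - (T z - T y)).
have e1 : f y - T y + ((f z - f y) - (T z - T y)) = f z - T z.
  by apply/rowP => i; rewrite !mxE; ring.
rewrite e1 in h2.
have h3 : enorm ((f z - f y) - (T z - T y)) ^+ 2 <= (2 * (l - L) ^+ 2 + 8 * L ^+ 2) * enorm (z - y) ^+ 2.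
  apply: (@le_trans _ _ (((`|l - L| + 2 * L) * enorm (z - y)) ^+ 2)).
    by rewrite lerXn2r ?nnegrE ?enorm_ge0// mulr_ge0 ?enorm_ge0// addr_ge0// mulr_ge0.
  rewrite exprMn ler_wpM2r ?sqr_ge0//.
  have := sqr_ge0 (`|l - L| - 2 * L).
  rewrite sqrrB sqrrD !exprMn real_normK ?num_real// !mulr2n; lra.
have h4 : a ^+ 2 * enorm (f z - T z) ^+ 2 <= a ^+ 2 * (2 * enorm (f y - T y) ^+ 2) +
    2 * ((2 * (l - L) ^+ 2 + 8 * L ^+ 2) * enorm (z - y) ^+ 2).
  have h5 : 0 <= 2 * ((2 * (l - L) ^+ 2 + 8 * L ^+ 2) * enorm (z - y) ^+ 2).
    by apply: mulr_ge0 => //; apply: (le_trans _ h3); exact: sqr_ge0.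
  apply: (@le_trans _ _ (a ^+ 2 * (2 * enorm (f y - T y) ^+ 2 +
      2 * ((2 * (l - L) ^+ 2 + 8 * L ^+ 2) * enorm (z - y) ^+ 2)))).
    by rewrite ler_wpM2l ?sqr_ge0//; lra.
  by rewrite mulrDr lerD2l ler_piMl.
have := ler_wpM2l (sqr_ge0 L) zy2; lra.
Qed.

(** [proj_step_le] passes from the unit step of the residual to the step [a], and nonexpansiveness
    replaces [T x] by [g]. *)
Lemma residual_step_le (T : 'rV[R]_d -> 'rV[R]_d) x g a : X x -> 0 < a -> a <= 1 ->
  a ^+ 2 * residual X T x ^+ 2 <=
  2 * enorm (x - proj X (x - a *: g)) ^+ 2 + 2 * enorm (g - T x) ^+ 2.
Proof.
move=> Xx a0 a1; rewrite -exprMn.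
apply: (@le_trans _ _ ((enorm (x - proj X (x - a *: T x))) ^+ 2)).
  rewrite lerXn2r ?nnegrE ?mulr_ge0 ?enorm_ge0 ?(ltW a0)//.
  exact: proj_step_le.
rewrite -(subrKA (proj X (x - a *: g)) x) (le_trans (sqr_enormD _ _))// lerD2l ler_wpM2l//.
rewrite lerXn2r ?nnegrE ?enorm_ge0// (le_trans (proj_lipschitz X0 Xcl Xcv _ _))//.
rewrite (_ : _ - _ = a *: (T x - g)); last by apply/rowP => i; rewrite !mxE; ring.
by rewrite enormZ gtr0_norm// enormB ler_piMl// enorm_ge0.
Qed.

End extragradient_step.

Ltac measurability_tac :=
  repeat first [ assumption | exact: measurable_cst | exact: measurable_rV_cst
    | apply: measurable_funX | apply: measurable_enorm | apply: measurable_dot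
    | apply: measurable_rVB | apply: measurable_rVD | apply: measurable_rVZ
    | apply: measurable_funM | apply: measurable_funD | apply: measurable_funB ].

(** * Elementary inequalities for the error budgets *)

Lemma sqr_sum_le (R : realType) (I : Type) (s : seq I) (a : I -> R) :
  (\sum_(i <- s) a i) ^+ 2 <= (size s)%:R * \sum_(i <- s) a i ^+ 2.
Proof.
elim: s => [|i s IH]; first by rewrite !big_nil expr0n mulr0.
rewrite !big_cons [size _]/= -natr1.
have [s0|s0] := posnP (size s).
  by rewrite (size0nil s0) !big_nil !addr0 add0r mul1r.
have n0 : 0 < (size s)%:R :> R by rewrite ltr0n.
move: (\sum_(j <- s) a j) (\sum_(j <- s) a j ^+ 2) ((size s)%:R) n0 IH => S S2 n n0 IH.
have h : 0 <= (n * a i - S) ^+ 2 by exact: sqr_ge0.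
rewrite -(ler_pM2l n0).
have : n * S ^+ 2 + S ^+ 2 <= n * (n * S2) + n * S2 by have := ler_wpM2l (ltW n0) IH; lra.
lra.
Qed.

Lemma sqr_addr_le (R : realType) (u v : R) : (u + v) ^+ 2 <= 2 * u ^+ 2 + 2 * v ^+ 2.
Proof. by have := sqr_ge0 (u - v); lra. Qed.

(** Here and in the next lemma [x] and [y] stand for squared distances to the solution before and
    after a step, [t] for the squared norm of the mean operator, [g] for that of the batch average
    and [e] for its squared error. *)
Lemma growth_after_mean_step (R : realType) (B y x t : R) : 0 <= B ->
  y <= 2 * x + 2 * t -> t <= B * (1 + x) -> B * (1 + y) <= (2 + 2 * B) * (B * (1 + x)).
Proof. by move=> B0 h1 h2; have := ler_wpM2l B0 h1; have := ler_wpM2l B0 h2; lra. Qed.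

Lemma growth_after_step (R : realType) (B y x g t e : R) : 0 <= B ->
  y <= 2 * x + 2 * g -> g <= 2 * t + 2 * e -> t <= B * (1 + x) ->
  B * (1 + y) <= (2 + 4 * B) * (B * (1 + x)) + 4 * B * e.
Proof.
move=> B0 h1 h2 h3; have := ler_wpM2l B0 h1; have := ler_wpM2l B0 h2.
by have := ler_wpM2l B0 h3; lra.
Qed.

Lemma growth_constant (R : realType) (B s V : R) : 0 <= B -> s <= V ->
  (2 + 4 * B) * V + 4 * B * s <= (2 + 8 * B) * V.
Proof. by move=> B0 h; have := ler_wpM2l B0 h; lra. Qed.

(* Tangent to [l |-> l ^- 2] at [L]. *)
Lemma inv_sqr_tangent (R : realType) (a l L c : R) : 0 < l -> 0 < L -> 0 <= c -> c <= a * l ->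
  3 * c ^+ 2 / L ^+ 2 <= a ^+ 2 + 2 * c ^+ 2 / L ^+ 3 * l.
Proof.
move=> l0 L0 c0 h.
have a0 : 0 <= a by rewrite -(pmulr_lge0 _ l0) (le_trans c0).
have h1 : c ^+ 2 / l ^+ 2 <= a ^+ 2.
  by rewrite ler_pdivrMr ?exprn_gt0// -exprMn lerXn2r ?nnegrE// mulr_ge0// ltW.
apply: le_trans (lerD h1 (lexx _)); rewrite -subr_ge0.
rewrite (_ : _ - _ = c ^+ 2 * ((L - l) ^+ 2 * (L + 2 * l)) / (l ^+ 2 * L ^+ 3)); last first.
  by field; rewrite !gt_eqF.
apply: divr_ge0; last by rewrite ltW// mulr_gt0// exprn_gt0.
apply: mulr_ge0; first exact: sqr_ge0.
by apply: mulr_ge0; [exact: sqr_ge0|rewrite addr_ge0 ?mulr_ge0 ?ltW].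
Qed.

Lemma lee_sum_size (R : realType) (I : eqType) (s : seq I) (a : I -> \bar R) c :
  (0 <= c)%E -> (forall i, i \in s -> (a i <= c)%E) ->
  (\sum_(i <- s) a i <= (size s)%:R%:E * c)%E.
Proof.
move=> c0; elim: s => [_|i s IH h]; first by rewrite big_nil mul0e.
rewrite big_cons [size _]/= -natr1 EFinD ge0_muleDl ?lee_fin// mul1e addeC.
by apply: leeD; [apply: IH => j js; apply: h; rewrite inE js orbT|apply: h; exact: mem_head].
Qed.

(** * Sample averages *)

Section sample_averages.
Context {R : realType} {d : nat} {dXi dO : measure_display}.
Context {Xi : measurableType dXi} {Omega : measurableType dO} {I : choiceType}.
Variables (P : probability Xi R) (Q : probability Omega R) (X : set 'rV[R]_d).
Variables (F : Xi -> 'rV[R]_d -> 'rV[R]_d) (Lip : Xi -> R).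
Hypotheses (X0 : X !=set0) (Xcl : closed X) (Xcv : convex_set X).
Hypothesis mF : measurable_operator X F.
Hypothesis hF : heavy_tailed_lipschitz P X F Lip.
Variables (Y : I -> Omega -> Xi) (D : set I).
Hypothesis hY : iid_family P Q D Y.

Local Notation T := (mean_operator P F).
Local Notation L := (fine (ex P Lip)).

(** Batches are lists of indices so that the two batches of an iteration, drawn from one i.i.d.
    family, are treated alike. *)
Definition avg (s : seq I) (w : Omega) (x : 'rV[R]_d) : 'rV[R]_d :=
  (size s)%:R^-1 *: \sum_(i <- s) F (Y i w) x.

Definition Lavg (s : seq I) (w : Omega) : R := (size s)%:R^-1 * \sum_(i <- s) Lip (Y i w).

Definition good_sample (z : Xi) := 1 <= Lip z /\
  forall x y, X x -> X y -> enorm (F z x - F z y) <= Lip z * enorm (x - y).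

Lemma sample_ae (G : set Xi) i : D i -> {ae P, forall z, G z} ->
  {ae Q, forall w, G (Y i w)}.
Proof.
move=> Di [N [mN PN NG]]; have [mY YP _] := hY.
exists (Y i @^-1` N); split.
- by rewrite -[X in measurable X]setTI; exact: mY.
- by rewrite YP.
- by move=> w /= h; apply: NG.
Qed.

Lemma batch_ae (G : set Xi) (s : seq I) : (forall i, i \in s -> D i) ->
  {ae P, forall z, G z} -> {ae Q, forall w, forall i, i \in s -> G (Y i w)}.
Proof.
move=> sD hG; elim: s sD => [_|i s IH sD]; first by apply: aeW => w.
have h1 := sample_ae (sD i (mem_head _ _)) hG.
have {}IH := IH (fun j js => sD j (@mem_behead _ (i :: s) j js)).
by apply: filterS2 h1 IH => w h1 h2 j; rewrite inE => /predU1P[->|/h2].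
Qed.

Lemma batch_good (s : seq I) : (forall i, i \in s -> D i) ->
  {ae Q, forall w, forall i, i \in s -> good_sample (Y i w)}.
Proof. by move=> sD; apply: batch_ae => //; exact: Lip_good hF. Qed.

Lemma Lavg_ge0 s w : 0 <= Lavg s w.
Proof.
apply: mulr_ge0; first by rewrite invr_ge0 ler0n.
by apply: sumr_ge0 => i _; exact: (Lip_ge0 hF).
Qed.

Lemma Lavg_ge1 s w : (0 < size s)%N -> (forall i, i \in s -> good_sample (Y i w)) ->
  1 <= Lavg s w.
Proof.
move=> s0 hs; rewrite /Lavg ler_pdivlMl ?ltr0n// mulr1.
rewrite -sum1_size natr_sum big_seq [leRHS]big_seq.
by apply: ler_sum => i /hs[].
Qed.

Lemma avg_lipschitz s w x y : (forall i, i \in s -> good_sample (Y i w)) ->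
  X x -> X y -> enorm (avg s w x - avg s w y) <= Lavg s w * enorm (x - y).
Proof.
move=> hs Xx Xy; rewrite /avg -scalerBr enormZ ger0_norm ?invr_ge0 ?ler0n//.
rewrite /Lavg -mulrA ler_wpM2l ?invr_ge0 ?ler0n// -sumrB (le_trans (enorm_sum _ _ _))//.
rewrite mulr_suml big_seq [leRHS]big_seq; apply: ler_sum => i /hs[_]; exact.
Qed.

Lemma measurable_avg J (s : seq I) (x : Omega -> 'rV[R]_d) :
  (forall i, i \in s -> J i) -> measurable_rV (x : past Y J -> _) -> (forall w, X (x w)) ->
  measurable_rV ((fun w => avg s w (x w)) : past Y J -> _).
Proof.
move=> sJ mx Xx; apply: measurable_rVZ; first exact: measurable_cst.
elim: s sJ => [_|i s IH sJ].
  under [X in measurable_rV X]eq_fun do rewrite big_nil.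
  exact: measurable_rV_cst.
under [X in measurable_rV X]eq_fun do rewrite big_cons.
apply: measurable_rVD; last by apply: IH => j js; apply: sJ; rewrite inE js orbT.
apply: (measurable_operator_comp Xcl mF) => //.
by apply: sample_past; apply: sJ; exact: mem_head.
Qed.

Lemma measurable_Lavg J (s : seq I) : (forall i, i \in s -> J i) ->
  measurable_fun setT (Lavg s : past Y J -> R).
Proof.
move=> sJ; apply: measurable_funM; first exact: measurable_cst.
elim: s sJ => [_|i s IH sJ].
  by under [X in measurable_fun _ X]eq_fun do rewrite big_nil; exact: measurable_cst.
under [X in measurable_fun _ X]eq_fun do rewrite big_cons.
apply: measurable_funD; last by apply: IH => j js; apply: sJ; rewrite inE js orbT.
apply: measurableT_comp; first exact: (Lip_measurable hF).
by apply: sample_past; apply: sJ; exact: mem_head.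
Qed.

Variables (p : 'rV[R]_d) (B : R).
Hypothesis B0 : 0 < B.
Hypothesis hLB : (ex P (fun z => Lip z ^+ 2)%R <= B%:E)%E.
Hypothesis hFB : forall x, X x ->
  (ex P (fun z => enorm (F z x) ^+ 2)%R <= (B * (1 + enorm (x - p) ^+ 2))%:E)%E.
Hypothesis hLFB : ~ compact X -> forall x y, X x ->
  (ex P (fun z => Lip z ^+ 2 * enorm (y + (F z x - T x)) ^+ 2)%R <=
   (2 * B * enorm y ^+ 2 + B * (1 + enorm (x - p) ^+ 2))%:E)%E.

Local Notation v x := (B * (1 + enorm (x - p) ^+ 2)).

Lemma v_ge0 x : 0 <= v x.
Proof. by apply: mulr_ge0; [exact: ltW|apply: addr_ge0 => //; exact: sqr_ge0]. Qed.

Lemma sqr_mean_le_v x : X x -> enorm (T x) ^+ 2 <= v x.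
Proof.
move=> Xx.
exact: (sqr_mean_le (measurable_operatorS Xcl mF Xx) (le_lt_trans (hFB Xx) (ltry _)) (hFB Xx)).
Qed.

(** * Errors of a fresh batch at a point known in advance *)

Section one_batch.
Variables (J : set I) (s : seq I).
Hypotheses (JD : J `<=` D) (us : uniq s) (sD : forall i, i \in s -> D i /\ ~ J i).
Hypothesis s0 : (0 < size s)%N.
Variable x : Omega -> 'rV[R]_d.
Hypotheses (mx : measurable_rV (x : past Y J -> 'rV[R]_d)) (Xx : forall w, X (x w)).

Local Notation n := ((size s)%:R : R).

Let n0 : 0 < n. Proof. by rewrite ltr0n. Qed.

Let mv : measurable_fun setT ((fun w => v (x w)) : past Y J -> R).
Proof. by measurability_tac. Qed.

Lemma sum_error (a : R) w y :
  \sum_(i <- s) (a / n) *: (F (Y i w) y - T y) = a *: (avg s w y - T y).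
Proof.
rewrite -scaler_sumr sumrB big_const_seq count_predT iter_addr_0 /avg.
rewrite -[T y *+ _]scaler_nat !scalerBr !scalerA; congr (_ - _ *: _).
by rewrite -mulrA mulVf ?mulr1// gt_eqF.
Qed.

Lemma measurable_error (J' : set I) (a : Omega -> R) (y : Omega -> 'rV[R]_d) :
  measurable_fun setT (a : past Y J' -> R) -> measurable_rV (y : past Y J' -> 'rV[R]_d) ->
  (forall w, X (y w)) ->
  measurable_rV ((fun u => a u.1 *: (F u.2 (y u.1) - T (y u.1))) : past Y J' * Xi -> 'rV[R]_d).
Proof.
move=> ma my Xy.
have m1 : measurable_rV ((fun u => y u.1) : past Y J' * Xi -> 'rV[R]_d) by exact: past_fst my.
apply: measurable_rVZ; first exact: past_fst ma.
apply: measurable_rVB; first by apply: (measurable_operator_comp Xcl mF) => //; exact: measurable_snd.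
have mT : measurable_rV ((fun w => T (y w)) : past Y J' -> 'rV[R]_d).
  by apply: (measurable_mean X0 Xcl Xcv mF hF).
exact: past_fst mT.
Qed.

(** Each of the n points contributes the variance bound times (a / n)^2. The weight and the shift
    may depend on the past, which admits the random step when the second batch is integrated. *)
Lemma ex_avg_error (a : Omega -> R) (u : Omega -> 'rV[R]_d) :
  measurable_fun setT (a : past Y J -> R) -> measurable_rV (u : past Y J -> 'rV[R]_d) ->
  (ex Q (fun w => enorm (u w + a w *: (avg s w (x w) - T (x w))) ^+ 2)%R <=
   ex Q (fun w => enorm (u w) ^+ 2)%R + n^-1%:E * ex Q (fun w => a w ^+ 2 * v (x w))%R)%E.
Proof.
move=> ma mu.
pose g w z := (a w / n) *: (F z (x w) - T (x w)).
pose v' w := n^-1 ^+ 2 * (a w ^+ 2 * v (x w)).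
have mav : measurable_fun setT ((fun w => a w ^+ 2 * v (x w)) : past Y J -> R).
  by measurability_tac.
have av0 w : 0 <= a w ^+ 2 * v (x w) by apply: mulr_ge0; [exact: sqr_ge0|exact: v_ge0].
have man : measurable_fun setT ((fun w => a w / n) : past Y J -> R) by measurability_tac.
have mg := measurable_error man mx Xx.
have mv' : measurable_fun setT (v' : past Y J -> R) by rewrite /v'; measurability_tac.
have v'0 w : 0 <= v' w by apply: mulr_ge0 => //; exact: sqr_ge0.
have hg w y : (ex P (fun z => enorm (y + g w z) ^+ 2)%R <= (enorm y ^+ 2 + v' w)%:E)%E.
  have := ex_sqr_shift_le (measurable_operatorS Xcl mF (Xx w))
    (le_lt_trans (hFB (Xx w)) (ltry _)) y (a w / n) (hFB (Xx w)).
  by rewrite (_ : v' w = (a w / n) ^+ 2 * v (x w))//; rewrite /v' exprMn; ring.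
have [_] := ex_batch hY JD us sD mg mu mv' v'0 hg.
rewrite /v' (exZ _ (past_measurable_iid hY JD mav) av0); last exact: sqr_ge0.
rewrite muleA -EFinM (_ : n * n^-1 ^+ 2 = n^-1); last first.
  by rewrite expr2 mulrA mulfV ?gt_eqF// mul1r.
by under ex_eq do rewrite sum_error.
Qed.

Let sDs i : i \in s -> D i. Proof. by case/sD. Qed.

Let J1 := J `|` [set` s].

Let J1D : J1 `<=` D. Proof. by move=> i [/JD//|/= /sDs]. Qed.

Let JJ1 : J `<=` J1. Proof. exact: subsetUl. Qed.

Let sJ1 i : i \in s -> J1 i. Proof. by right. Qed.

Lemma measurable_avg_error :
  measurable_rV ((fun w => avg s w (x w) - T (x w)) : past Y J1 -> 'rV[R]_d).
Proof.
have mx1 : measurable_rV (x : past Y J1 -> 'rV[R]_d) := past_mono JJ1 mx.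
apply: measurable_rVB; first exact: measurable_avg.
exact: (measurable_mean X0 Xcl Xcv mF hF).
Qed.

Lemma ex_sqr_avg_error :
  (ex Q (fun w => enorm (avg s w (x w) - T (x w)) ^+ 2)%R <= n^-1%:E * ex Q (fun w => v (x w))%R)%E.
Proof.
have := @ex_avg_error (fun=> 1) (fun=> 0) (@measurable_cst _ _ _ _ _ _) (@measurable_rV_cst _ _ _ _ _).
under [X in (X <= _)%E -> _]ex_eq do rewrite add0r scale1r.
under [X in (_ <= _ + _ * X)%E -> _]ex_eq do rewrite expr1n mul1r.
by rewrite enorm0 expr0n ex_cst add0e.
Qed.

(** [Lip] is read as a random vector of dimension one, so that [ex_batch] applies. *)
Lemma ex_sqr_Lavg_error : (ex Q (fun w => (Lavg s w - L) ^+ 2)%R <= (B / n)%:E)%E.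
Proof.
pose f z : 'rV[R]_1 := \row_(_ < 1) Lip z.
have fE z : enorm (f z) ^+ 2 = Lip z ^+ 2 by rewrite sqr_enorm /dot big_ord1 !mxE.
have mf : measurable_rV f.
  apply: measurable_rV_coord => i.
  by under eq_fun do rewrite mxE; exact: (Lip_measurable hF).
have fB : (ex P (fun z => enorm (f z) ^+ 2)%R <= B%:E)%E by under ex_eq do rewrite fE.
pose m : 'rV[R]_1 := \row_i \int[P]_z f z 0 i.
have mE : m = \row__ L.
  by apply/rowP => i; rewrite !mxE /Rintegral; congr fine; apply: eq_integral => z _; rewrite mxE.
pose g (w : Omega) z := n^-1 *: (f z - m).
have mg : measurable_rV ((fun u => g u.1 u.2) : past Y J * Xi -> 'rV[R]_1).
  apply: measurable_rVZ; first exact: measurable_cst.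
  apply: measurable_rVB; last exact: measurable_rV_cst.
  exact: measurableT_comp mf (@measurable_snd _ _ _ _).
have v0 (w : Omega) : 0 <= n^-1 ^+ 2 * B by apply: mulr_ge0; [exact: sqr_ge0|exact: ltW].
have hg (w : Omega) y : (ex P (fun z => enorm (y + g w z) ^+ 2)%R <= (enorm y ^+ 2 + n^-1 ^+ 2 * B)%:E)%E.
  exact: (ex_sqr_shift_le mf (le_lt_trans fB (ltry _)) y n^-1 fB).
have [_] := ex_batch hY JD us sD mg (@measurable_rV_cst _ _ _ (past Y J) 0) (@measurable_cst _ _ _ _ _ _) v0 hg.
rewrite enorm0 expr0n !ex_cst add0e -EFinM (_ : n * _ = B / n); last first.
  by rewrite expr2 !mulrA mulfV ?gt_eqF// mul1r mulrC.
move=> h; rewrite (le_trans _ h)// le_eqVlt; apply/orP; left; apply/eqP.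
apply: ex_eq => w; rewrite add0r sqr_enorm /dot big_ord1 -expr2; congr (_ ^+ 2).
rewrite summxE; under eq_bigr do rewrite /g mE !mxE.
rewrite -mulr_sumr sumrB big_const_seq count_predT iter_addr_0 -[L *+ _]mulr_natl mulrBr.
by rewrite mulKf// gt_eqF.
Qed.

(** The point [i] is integrated last. The errors of the other points form a sum independent of it,
    which is the shift [y] of [hLFB] and has mean square of order n; dividing by n^2 keeps the rate
    1 / n despite the correlated weight. *)
Lemma ex_Lip_avg_error i : ~ compact X -> i \in s ->
  (ex Q (fun w => Lip (Y i w) ^+ 2 * enorm (avg s w (x w) - T (x w)) ^+ 2)%R <=
   ((2 * B + 1) / n)%:E * ex Q (fun w => v (x w))%R)%E.
Proof.
move=> ncX si; pose s' := rem i s; pose J' := J `|` [set` s'].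
have us' : uniq s' by exact: rem_uniq.
have s'D j : j \in s' -> D j /\ ~ J j by move=> /mem_rem /sD.
have J'D : J' `<=` D by move=> j [/JD//|/= /s'D[]].
have nJ'i : ~ J' i by case=> [|/=]; [by case: (sD si)|rewrite mem_rem_uniqF].
have m1 := @measurable_cst _ _ (past Y J) _ setT (1 : R).
have mg := measurable_error m1 mx Xx.
have hg w y : (ex P (fun z => enorm (y + 1 *: (F z (x w) - T (x w))) ^+ 2)%R <= (enorm y ^+ 2 + v (x w))%:E)%E.
  have := ex_sqr_shift_le (measurable_operatorS Xcl mF (Xx w))
    (le_lt_trans (hFB (Xx w)) (ltry _)) y 1 (hFB (Xx w)).
  by rewrite expr1n mul1r.
have [mS hS] := ex_batch hY JD us' s'D mg (@measurable_rV_cst _ _ _ (past Y J) 0) mv (fun w => v_ge0 (x w)) hg.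
pose S w := 0 + \sum_(j <- s') 1 *: (F (Y j w) (x w) - T (x w)).
have mx' : measurable_rV (x : past Y J' -> 'rV[R]_d) by apply: past_mono mx; exact: subsetUl.
have mTx' := measurable_mean X0 Xcl Xcv mF hF mx' Xx.
pose h w z := Lip z ^+ 2 * enorm (S w + (F z (x w) - T (x w))) ^+ 2.
have mh : measurable_fun setT ((fun u => h u.1 u.2) : past Y J' * Xi -> R).
  apply: measurable_funM; first by apply: measurable_funX; exact: measurableT_comp (Lip_measurable hF) (@measurable_snd _ _ _ _).
  apply/measurable_funX/measurable_enorm/measurable_rVD; first exact: past_fst mS.
  apply: measurable_rVB; last exact: past_fst mTx'.
  by apply: (measurable_operator_comp Xcl mF) => //; exact: past_fst mx'.
have mS2 : measurable_fun setT ((fun w => enorm (S w) ^+ 2) : past Y J' -> R).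
  exact/measurable_funX/measurable_enorm.
have mv' : measurable_fun setT ((fun w => v (x w)) : past Y J' -> R).
  by apply: past_mono mv; exact: subsetUl.
have e w : Lip (Y i w) ^+ 2 * enorm (avg s w (x w) - T (x w)) ^+ 2 = n^-1 ^+ 2 * h w (Y i w).
  rewrite /h [RHS]mulrCA; congr (_ * _).
  rewrite -[avg s w (x w) - T (x w)]scale1r -sum_error -scaler_sumr enormZ exprMn.
  rewrite div1r real_normK ?num_real// /S add0r; congr (_ * enorm _ ^+ 2).
  rewrite (big_rem i)//= addrC; congr (_ + _).
  by apply: eq_bigr => j _; rewrite scale1r.
have mhw : measurable_fun setT (fun w => h w (Y i w)).
  have mi : measurable_fun setT ((fun w => (w, Y i w)) : past Y J1 -> past Y J' * Xi).
    apply: measurable_fun_pair; last by apply: sample_past; exact: sJ1.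
    apply: (@past_mono _ _ _ _ _ _ J'); last exact: measurable_id.
    by move=> j [|/= /mem_rem]; [left|right].
  exact: (past_measurable_iid hY J1D (measurableT_comp mh mi)).
have h0 w z : 0 <= h w z by apply: mulr_ge0; exact: sqr_ge0.
have mvO := past_measurable_iid hY JD mv.
have mS2O := past_measurable_iid hY J'D mS2.
have B2 : 0 <= 2 * B by apply: mulr_ge0 => //; exact: ltW.
have vx0 w : 0 <= v (x w) := v_ge0 (x w).
have hh : (ex Q (fun w => h w (Y i w))%R <= ((2 * B + 1) * n)%:E * ex Q (fun w => v (x w))%R)%E.
  apply: (@le_trans _ _ (ex Q (fun w => 2 * B * enorm (S w) ^+ 2 + v (x w))%R)).
    apply: (ex_sample hY J'D (sDs si) nJ'i mh) => //.
    - by apply: measurable_funD => //; apply: measurable_funM => //; exact: measurable_cst.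
    - by move=> w; exact: hLFB.
  rewrite exD//; last 2 first.
  - by apply: measurable_funM => //; exact: measurable_cst.
  - by move=> w; apply: mulr_ge0 => //; exact: sqr_ge0.
  rewrite exZ//; last by move=> w; exact: sqr_ge0.
  apply: (@le_trans _ _ ((2 * B)%:E * (n%:E * ex Q (fun w => v (x w))%R) + n%:E * ex Q (fun w => v (x w))%R)%E).
    apply: leeD.
      apply: lee_pmul => //; first by apply: ex_ge0 => w; exact: sqr_ge0.
      rewrite (le_trans hS)// enorm0 expr0n ex_cst add0e.
      apply: lee_pmul => //; first exact: ex_ge0.
      by rewrite lee_fin ler_nat size_rem// leq_pred.
    rewrite -[leLHS]mul1e; apply: lee_pmul => //; first exact: ex_ge0.
    by rewrite lee_fin ler1n.
  have -> : (2 * B + 1) * n = 2 * B * n + n by ring.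
  by rewrite EFinD ge0_muleDl ?lee_fin ?(mulr_ge0 B2) ?ler0n// muleA -EFinM.
under ex_eq do rewrite e.
have n20 : 0 <= n^-1 ^+ 2 := sqr_ge0 _.
rewrite (exZ _ mhw (fun w => h0 w _) n20).
apply: (@le_trans _ _ ((n^-1 ^+ 2)%:E * (((2 * B + 1) * n)%:E * ex Q (fun w => v (x w))%R))%E).
  by apply: lee_pmul => //; exact: ex_ge0.
rewrite muleA -EFinM le_eqVlt; apply/orP; left; apply/eqP; congr (_%:E * _)%E.
by field; rewrite gt_eqF.
Qed.

(** The weight is known before the batch, so each [Lip (Y i w)] integrates to [L] separately. *)
Lemma ex_Lavg_weighted (r : Omega -> R) :
  measurable_fun setT (r : past Y J -> R) -> (forall w, 0 <= r w) ->
  (ex Q (fun w => Lavg s w * r w)%R <= L%:E * ex Q r)%E.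
Proof.
move=> mr r0; have mrO := past_measurable_iid hY JD mr.
have L0 : 0 <= L by rewrite (le_trans _ (L_ge1 hF)).
have mLY i : i \in s -> measurable_fun setT (fun w => Lip (Y i w)).
  by move=> /sDs Di; have [mY _ _] := hY; apply: measurableT_comp (Lip_measurable hF) (mY _ Di).
have hi i : i \in s -> (ex Q (fun w => Lip (Y i w) * r w)%R <= L%:E * ex Q r)%E.
  move=> si; rewrite -exZ//; have [Di nJi] := sD si.
  apply: (@ex_sample _ _ _ _ _ _ Y P Q D hY J i (fun w z => Lip z * r w)) => //.
  - apply: measurable_funM; last exact: past_fst mr.
    exact: measurableT_comp (Lip_measurable hF) (@measurable_snd _ _ _ _).
  - by apply: measurable_funM => //; exact: measurable_cst.
  - by move=> w z; apply: mulr_ge0 => //; exact: (Lip_ge0 hF).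
  - move=> w; rewrite (@ex_eq _ _ _ P _ (fun z => r w * Lip z)); last by move=> z; rewrite mulrC.
    rewrite exZ//; [|exact: (Lip_measurable hF)|exact: (Lip_ge0 hF)].
    by rewrite (ex_Lip hF) -EFinM mulrC.
pose lr i w := if i \in s then Lip (Y i w) * r w else 0.
have e w : Lavg s w * r w = n^-1 * \sum_(i <- s) lr i w.
  rewrite /Lavg -mulrA mulr_suml; congr (_ * _).
  by rewrite big_seq [RHS]big_seq; apply: eq_bigr => i si; rewrite /lr si.
have mlr i : measurable_fun setT (lr i).
  rewrite /lr; case: (boolP (i \in s)) => [si|_]; last exact: measurable_cst.
  by apply: measurable_funM => //; exact: mLY.
have lr0 i w : 0 <= lr i w.
  by rewrite /lr; case: ifP => // _; apply: mulr_ge0 => //; exact: (Lip_ge0 hF).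
rewrite (ex_eq _ e) exZ//; last 2 first.
- exact: measurable_sum.
- by move=> w; apply: sumr_ge0.
rewrite ex_sum//.
apply: (@le_trans _ _ (n^-1%:E * (n%:E * (L%:E * ex Q r)))%E); last first.
  by rewrite muleA -EFinM mulVf ?gt_eqF// mul1e.
apply: lee_pmul => //; first by apply: sume_ge0 => i _; exact: ex_ge0.
apply: lee_sum_size => [|i si]; first by apply: mule_ge0; [rewrite lee_fin|exact: ex_ge0].
by rewrite /lr si; exact: hi.
Qed.

(** (Lavg - L)^2 is at most Lavg^2 + L^2, and Lavg^2 at most the average of the squares of [Lip];
    this leaves weights that depend on one sample point each. *)
Lemma ex_Lavg_avg_error : ~ compact X ->
  (ex Q (fun w => (Lavg s w - L) ^+ 2 * enorm (avg s w (x w) - T (x w)) ^+ 2)%R <=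
   ((2 * B + 1 + L ^+ 2) / n)%:E * ex Q (fun w => v (x w))%R)%E.
Proof.
move=> ncX; pose e w := enorm (avg s w (x w) - T (x w)) ^+ 2.
have e0 w : 0 <= e w by exact: sqr_ge0.
have meJ : measurable_fun setT (e : past Y J1 -> R).
  by apply: measurable_funX; apply: measurable_enorm; exact: measurable_avg_error.
have me := past_measurable_iid hY J1D meJ.
have mLa := past_measurable_iid hY J1D (measurable_Lavg sJ1).
have La0 w : 0 <= Lavg s w by exact: Lavg_ge0.
have L0 : 0 <= L by rewrite (le_trans _ (L_ge1 hF)).
have mLY i : i \in s -> measurable_fun setT (fun w => Lip (Y i w)).
  by move=> /sDs Di; have [mY _ _] := hY; apply: measurableT_comp (Lip_measurable hF) (mY _ Di).
pose le i w := if i \in s then Lip (Y i w) ^+ 2 * e w else 0.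
have mle i : measurable_fun setT (le i).
  rewrite /le; case: (boolP (i \in s)) => [si|_]; last exact: measurable_cst.
  by apply: measurable_funM => //; apply: measurable_funX; exact: mLY.
have le0 i w : 0 <= le i w.
  by rewrite /le; case: ifP => // _; apply: mulr_ge0 => //; exact: sqr_ge0.
have n10 : 0 <= n^-1 by rewrite invr_ge0 ler0n.
have Ev0 : (0 <= ex Q (fun w => v (x w))%R)%E by apply: ex_ge0 => w; exact: v_ge0.
have L20 : 0 <= L ^+ 2 := sqr_ge0 L.
have sle0 w : 0 <= \sum_(i <- s) le i w by apply: sumr_ge0.
have msle : measurable_fun setT (fun w => \sum_(i <- s) le i w) by exact: measurable_sum.
apply: (@le_trans _ _ (ex Q (fun w => n^-1 * (\sum_(i <- s) le i w) + L ^+ 2 * e w)%R)).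
  apply: ex_le.
  - by measurability_tac.
  - by measurability_tac.
  - by move=> w; apply: mulr_ge0 => //; exact: sqr_ge0.
  - move=> w; rewrite -/(e w).
    have h1 : (Lavg s w - L) ^+ 2 <= Lavg s w ^+ 2 + L ^+ 2.
      by have := mulr_ge0 (La0 w) L0; lra.
    have h2 : Lavg s w ^+ 2 <= n^-1 * \sum_(i <- s) Lip (Y i w) ^+ 2.
      rewrite /Lavg exprMn expr2 -!mulrA ler_wpM2l// ler_pdivrMl//.
      exact: sqr_sum_le.
    have h3 : \sum_(i <- s) le i w = (\sum_(i <- s) Lip (Y i w) ^+ 2) * e w.
      by rewrite mulr_suml big_seq [RHS]big_seq; apply: eq_bigr => i si; rewrite /le si.
    have h4 := ler_wpM2r (e0 w) (le_trans h1 (lerD h2 (lexx (L ^+ 2)))).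
    by rewrite h3 (mulrA n^-1) -(mulrDl _ (L ^+ 2)).
rewrite exD//; last 4 first.
- by measurability_tac.
- by measurability_tac.
- by move=> w; apply: mulr_ge0.
- by move=> w; apply: mulr_ge0.
rewrite (exZ _ msle sle0 n10) (exZ _ me e0 L20) ex_sum//.
apply: (@le_trans _ _ (n^-1%:E * (n%:E * (((2 * B + 1) / n)%:E * ex Q (fun w => v (x w))%R)) +
    (L ^+ 2)%:E * (n^-1%:E * ex Q (fun w => v (x w))%R))%E).
  apply: leeD; apply: lee_pmul => //.
  - by apply: sume_ge0 => i _; exact: ex_ge0.
  - apply: lee_sum_size => [|i si].
      by rewrite mule_ge0// lee_fin mulr_ge0// addr_ge0// mulr_ge0// ltW.
    by rewrite /le si; exact: ex_Lip_avg_error.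
  - exact: ex_ge0.
  - exact: ex_sqr_avg_error.
have c0 : 0 <= (2 * B + 1) / n by rewrite mulr_ge0// addr_ge0// mulr_ge0// ltW.
rewrite !muleA -!EFinM -ge0_muleDl ?lee_fin//; last 2 first.
- by rewrite mulVf ?gt_eqF// mul1r.
- exact: mulr_ge0.
rewrite -EFinD le_eqVlt; apply/orP; left; apply/eqP; congr (_%:E * _)%E.
by field; rewrite gt_eqF.
Qed.

End one_batch.
Opaque avg Lavg mean_operator Defs.proj enorm dot.

(** * One iteration in expectation *)

Section one_iteration.
Variables (ahat theta lam Dm : R).
Hypotheses (ahat01 : 0 < ahat <= 1) (theta01 : 0 < theta < 1) (lam2 : lam <= 2^-1).
Hypotheses (Dm0 : 0 <= Dm) (hDm : compact X -> forall y z, X y -> X z -> enorm (y - z) ^+ 2 <= Dm).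
Hypotheses (Xp : X p) (hp : forall z, X z -> dot (T z) (p - z) <= 0).
Variables (J : set I) (s1 s2 : seq I).
Hypotheses (JD : J `<=` D) (us1 : uniq s1) (us2 : uniq s2).
Hypothesis s1D : forall i, i \in s1 -> D i /\ ~ J i.
Hypothesis s2D : forall i, i \in s2 -> D i /\ ~ (J `|` [set` s1]) i.
Hypotheses (s10 : (0 < size s1)%N) (s12 : size s2 = size s1).
Variables (x : Omega -> 'rV[R]_d) (ell : Omega -> nat).
Hypotheses (mx : measurable_rV (x : past Y J -> 'rV[R]_d)) (Xx : forall w, X (x w)).

Local Notation n := ((size s1)%:R : R).
Local Notation J1 := (J `|` [set` s1]).
(** The exponent [ell] is arbitrary here. The line search enters through [mal], [hls] and, for the
    residual, a lower bound on [al w * Lavg s1 w]. *)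
Let al w := theta ^+ ell w * ahat.
Let z w := proj X (x w - al w *: avg s1 w (x w)).
Let y w := proj X (x w - al w *: avg s2 w (z w)).
Let e1 w := enorm (avg s1 w (x w) - T (x w)) ^+ 2.

Hypothesis mal : measurable_fun setT (al : past Y J1 -> R).
Hypothesis hls : {ae Q, forall w,
  al w * enorm (avg s1 w (z w) - avg s1 w (x w)) <= lam * enorm (z w - x w)}.
Variable a : R.
Hypothesis hxa : ex Q (fun w => enorm (x w - p) ^+ 2)%R = a%:E.

Let V := B * (1 + a).
Let B_ge0 : 0 <= B.
Proof. exact: (ltW B0). Qed.
Let n0 : 0 < n. Proof. by rewrite ltr0n. Qed.
Let n1 : 0 <= n^-1. Proof. by rewrite invr_ge0 ltW. Qed.
Let n_1 : n^-1 <= 1. Proof. by rewrite invf_le1// ler1n. Qed.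
Let ahat0 : 0 <= ahat. Proof. by case/andP: ahat01 => /ltW. Qed.
Let ahat1 : ahat <= 1. Proof. by case/andP: ahat01. Qed.
Let theta0 : 0 <= theta. Proof. by case/andP: theta01 => /ltW. Qed.
Let theta1 : theta <= 1. Proof. by case/andP: theta01 => _ /ltW. Qed.

Let step_ge0 l : 0 <= theta ^+ l * ahat.
Proof. by apply: mulr_ge0 => //; exact: exprn_ge0. Qed.

Let step_le1 l : theta ^+ l * ahat <= 1.
Proof. by rewrite -[leRHS]mul1r ler_pM ?exprn_ge0// exprn_ile1. Qed.

Let J1D : J1 `<=` D. Proof. by move=> i [/JD//|/= /s1D[]]. Qed.
Let JJ1 : J `<=` J1. Proof. exact: subsetUl. Qed.
Let J2 := J1 `|` [set` s2].
Let J2D : J2 `<=` D. Proof. by move=> i [/J1D//|/= /s2D[]]. Qed.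
Let J1J2 : J1 `<=` J2. Proof. exact: subsetUl. Qed.
Let s1J1 i : i \in s1 -> J1 i. Proof. by right. Qed.

Let a0 : 0 <= a.
Proof. by rewrite -lee_fin -hxa ex_ge0// => w; exact: sqr_ge0. Qed.
Let V0 : 0 <= V. Proof. by apply: mulr_ge0 => //; exact: addr_ge0. Qed.
Let BV : B <= V. Proof. by rewrite /V mulrDr mulr1 lerDl mulr_ge0. Qed.

Let mxO : measurable_rV x.
Proof. exact: (past_measurable_iid hY JD mx). Qed.
Let mx1 : measurable_rV (x : past Y J1 -> 'rV[R]_d).
Proof. exact: (past_mono JJ1 mx). Qed.

Let Xz w : X (z w). Proof. exact: projX. Qed.
Let Xy w : X (y w). Proof. exact: projX. Qed.

Let mproj (J' : set I) (u : Omega -> 'rV[R]_d) : measurable_rV (u : past Y J' -> 'rV[R]_d) ->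
  measurable_rV ((fun w => proj X (u w)) : past Y J' -> 'rV[R]_d).
Proof. by move=> mu; exact: (measurable_rV_comp (nearest_continuous X0 Xcl Xcv) mu). Qed.

Let mT (J' : set I) (u : Omega -> 'rV[R]_d) : measurable_rV (u : past Y J' -> 'rV[R]_d) ->
  (forall w, X (u w)) -> measurable_rV ((fun w => T (u w)) : past Y J' -> 'rV[R]_d).
Proof. by move=> mu Xu; exact: (measurable_mean X0 Xcl Xcv mF hF mu Xu). Qed.

Let mg1 : measurable_rV ((fun w => avg s1 w (x w)) : past Y J1 -> 'rV[R]_d).
Proof. exact: measurable_avg. Qed.

Lemma measurable_extrapolation : measurable_rV (z : past Y J1 -> 'rV[R]_d).
Proof. by apply: mproj; measurability_tac. Qed.

Lemma measurable_iteration : measurable_rV (y : past Y J2 -> 'rV[R]_d).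
Proof.
have mal2 : measurable_fun setT (al : past Y J2 -> R) := past_mono J1J2 mal.
have mx2 : measurable_rV (x : past Y J2 -> 'rV[R]_d) := past_mono J1J2 mx1.
have mz2 : measurable_rV (z : past Y J2 -> 'rV[R]_d) := past_mono J1J2 measurable_extrapolation.
have mg2 : measurable_rV ((fun w => avg s2 w (z w)) : past Y J2 -> 'rV[R]_d).
  by apply: measurable_avg => // i si; right.
by apply: mproj; measurability_tac.
Qed.

Let mzO : measurable_rV z.
Proof. exact: (past_measurable_iid hY J1D measurable_extrapolation). Qed.
Let myO : measurable_rV y.
Proof. exact: (past_measurable_iid hY J2D measurable_iteration). Qed.
Let malO : measurable_fun setT al.
Proof. exact: (past_measurable_iid hY J1D mal). Qed.
Let mg1O : measurable_rV (fun w => avg s1 w (x w)).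
Proof. exact: (past_measurable_iid hY J1D mg1). Qed.
Let mTxO : measurable_rV (fun w => T (x w)).
Proof. exact: (past_measurable_iid hY JD (mT mx Xx)). Qed.
Let mTzO : measurable_rV (fun w => T (z w)).
Proof. exact: (past_measurable_iid hY J1D (mT measurable_extrapolation Xz)). Qed.
Let mg1zO : measurable_rV (fun w => avg s1 w (z w)).
Proof.
apply: (past_measurable_iid hY J1D).
exact: measurable_avg s1J1 measurable_extrapolation Xz.
Qed.
Let mg2O : measurable_rV (fun w => avg s2 w (z w)).
Proof.
have mz2 : measurable_rV (z : past Y J2 -> 'rV[R]_d) := past_mono J1J2 measurable_extrapolation.
have s2J2 i : i \in s2 -> J2 i by right.
exact: (past_measurable_iid hY J2D (measurable_avg s2J2 mz2 Xz)).
Qed.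
Let me1 : measurable_fun setT e1. Proof. by measurability_tac. Qed.
Let e10 w : 0 <= e1 w. Proof. exact: sqr_ge0. Qed.
Let sq0 m (u : Omega -> 'rV[R]_m) w : 0 <= enorm (u w) ^+ 2. Proof. exact: sqr_ge0. Qed.

Let exvx : ex Q (fun w => v (x w))%R = V%:E.
Proof.
have m1 : measurable_fun setT (fun w => enorm (x w - p) ^+ 2) by measurability_tac.
rewrite exZ//; last 2 first.
- by apply: measurable_funD.
- by move=> w; rewrite addr_ge0// sqr_ge0.
rewrite exD//; last by move=> w; exact: sqr_ge0.
by rewrite ex_cst hxa.
Qed.

Let mvx : measurable_fun setT (fun w => v (x w)). Proof. by measurability_tac. Qed.

Let exe1 : (ex Q e1 <= (n^-1 * V)%:E)%E.
Proof. by rewrite EFinM -exvx; exact: (ex_sqr_avg_error JD us1 s1D s10 mx Xx). Qed.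

(** [p] is its own projection and the step is at most 1, so |z - p| exceeds |x - p| by at most the
    norm of the average at x, which is [T] at x plus a small error. *)
Lemma ex_growth_extrapolation : (ex Q (fun w => v (z w))%R <= ((2 + 8 * B) * V)%:E)%E.
Proof.
have h := @ex_le_combination _ _ _ Q (2 + 4 * B) (4 * B) 0 V (n^-1 * V) 0
  (fun w => v (z w)) (fun w => v (x w)) e1 (fun=> 0).
apply: (le_trans (h _ _ _ _ _ _ _ _ _ _ _ _ _ _ _)) => //.
- by measurability_tac.
- by move=> w; exact: v_ge0.
- by move=> w; exact: v_ge0.
- by apply: addr_ge0 => //; exact: mulr_ge0.
- exact: mulr_ge0.
- apply: aeW => w.
  have pz : enorm (z w - p) <= enorm (x w - p) + enorm (avg s1 w (x w)).
    rewrite -{1}(proj_id X0 Xcl Xcv Xp) (le_trans (proj_lipschitz X0 Xcl Xcv _ _))//.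
    rewrite (_ : _ - _ = (x w - p) + - (al w *: avg s1 w (x w))); last by rewrite addrAC.
    rewrite (le_trans (enormD _ _))// enormN enormZ ger0_norm ?step_ge0// lerD2l.
    by rewrite ler_piMl ?enorm_ge0// step_le1.
  have h1 : enorm (z w - p) ^+ 2 <= 2 * enorm (x w - p) ^+ 2 + 2 * enorm (avg s1 w (x w)) ^+ 2.
    apply: (@le_trans _ _ ((enorm (x w - p) + enorm (avg s1 w (x w))) ^+ 2)).
      by rewrite lerXn2r ?nnegrE ?addr_ge0 ?enorm_ge0.
    exact: sqr_addr_le.
  have h2 := sqr_enormD (T (x w)) (avg s1 w (x w) - T (x w)).
  rewrite addrCA subrr addr0 -/(e1 w) in h2.
  have h3 := sqr_mean_le_v (Xx w).
  by rewrite mul0r addr0; exact: growth_after_step B_ge0 h1 h2 h3.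
- by rewrite exvx.
- by rewrite ex_cst.
rewrite lee_fin mul0r addr0.
have := ler_wpM2r V0 n_1; rewrite mul1r; exact: growth_constant.
Qed.

(** The second batch is fresh even when the first one is known, so [ex_avg_error] applies at [z]
    with weight [al], for the shifts 0 and p - z. *)
Lemma ex_second_error : (ex Q (fun w => al w ^+ 2 * enorm (avg s2 w (z w) - T (z w)) ^+ 2)%R <=
  (n^-1 * ((2 + 8 * B) * V))%:E)%E /\
  (ex Q (fun w => enorm (p - z w + al w *: (avg s2 w (z w) - T (z w))) ^+ 2)%R <=
   ex Q (fun w => enorm (p - z w) ^+ 2)%R + (n^-1 * ((2 + 8 * B) * V))%:E)%E.
Proof.
have s20 : (0 < size s2)%N by rewrite s12.
have mpz : measurable_rV ((fun w => p - z w) : past Y J1 -> 'rV[R]_d).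
  by have mz1 := measurable_extrapolation; measurability_tac.
have hv : (ex Q (fun w => al w ^+ 2 * v (z w))%R <= ((2 + 8 * B) * V)%:E)%E.
  apply: le_trans ex_growth_extrapolation; apply: ex_le.
  - by measurability_tac.
  - by measurability_tac.
  - by move=> w; apply: mulr_ge0; [exact: sqr_ge0|exact: v_ge0].
  - by move=> w; rewrite ler_piMl ?v_ge0// exprn_ile1 ?step_ge0 ?step_le1.
have hn : (n^-1%:E * ex Q (fun w => al w ^+ 2 * v (z w))%R <= (n^-1 * ((2 + 8 * B) * V))%:E)%E.
  rewrite EFinM; apply: lee_pmul => //; apply: ex_ge0 => w.
  by apply: mulr_ge0; [exact: sqr_ge0|exact: v_ge0].
have h (u : Omega -> 'rV[R]_d) (mu : measurable_rV (u : past Y J1 -> 'rV[R]_d)) :=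
  @ex_avg_error J1 s2 J1D us2 s2D s20 z measurable_extrapolation Xz al u mal mu.
split.
  have := h (fun=> 0) (@measurable_rV_cst _ _ _ _ _).
  rewrite enorm0 expr0n ex_cst add0e s12 => h0.
  apply: le_trans (le_trans h0 hn).
  rewrite le_eqVlt; apply/orP; left; apply/eqP; apply: ex_eq => w.
  by rewrite add0r enormZ [RHS]exprMn ger0_norm ?step_ge0.
have := h _ mpz; rewrite s12 => h0.
by apply: (le_trans h0); apply: leeD2l.
Qed.

Let zb l w := proj X (x w - (theta ^+ l * ahat) *: T (x w)).

Let Xzb l w : X (zb l w). Proof. exact: projX. Qed.

Let mzb l : measurable_rV (zb l : past Y J -> 'rV[R]_d).
Proof. by have mTx := mT mx Xx; apply: mproj; measurability_tac. Qed.

Let exvzb l : (ex Q (fun w => v (zb l w))%R <= ((2 + 2 * B) * V)%:E)%E.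
Proof.
have mzbO := past_measurable_iid hY JD (mzb l).
rewrite EFinM -exvx -exZ//; last 2 first.
- by move=> w; exact: v_ge0.
- by apply: addr_ge0 => //; exact: mulr_ge0.
apply: ex_le.
- by measurability_tac.
- by apply: measurable_funM => //; exact: measurable_cst.
- by move=> w; exact: v_ge0.
move=> w.
have pz : enorm (zb l w - p) <= enorm (x w - p) + enorm (T (x w)).
  rewrite -{1}(proj_id X0 Xcl Xcv Xp) (le_trans (proj_lipschitz X0 Xcl Xcv _ _))//.
  rewrite (_ : _ - _ = (x w - p) + - ((theta ^+ l * ahat) *: T (x w))); last by rewrite addrAC.
  rewrite (le_trans (enormD _ _))// enormN enormZ ger0_norm ?step_ge0// lerD2l.
  by rewrite ler_piMl ?enorm_ge0// step_le1.
have h1 : enorm (zb l w - p) ^+ 2 <= 2 * enorm (x w - p) ^+ 2 + 2 * enorm (T (x w)) ^+ 2.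
  apply: (@le_trans _ _ ((enorm (x w - p) + enorm (T (x w))) ^+ 2)).
    by rewrite lerXn2r ?nnegrE ?addr_ge0 ?enorm_ge0.
  exact: sqr_addr_le.
have h3 := sqr_mean_le_v (Xx w).
exact: growth_after_mean_step B_ge0 h1 h3.
Qed.

Let g1zb l : measurable_rV ((fun w => avg s1 w (zb l w)) : past Y J1 -> 'rV[R]_d).
Proof. exact: (measurable_avg s1J1 (past_mono JJ1 (mzb l)) (Xzb l)). Qed.

Let mzbell : measurable_rV ((fun w => zb (ell w) w) : past Y J1 -> 'rV[R]_d).
Proof. by have mTx := mT mx1 Xx; apply: mproj; measurability_tac. Qed.

Let ref_err l w := (theta ^+ l * ahat) ^+ 2 * enorm (avg s1 w (zb l w) - T (zb l w)) ^+ 2.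

Let mzb_err l : measurable_fun setT (fun w => enorm (avg s1 w (zb l w) - T (zb l w)) ^+ 2).
Proof.
have mTzb := past_measurable_iid hY JD (mT (mzb l) (Xzb l)).
have mgO := past_measurable_iid hY J1D (g1zb l).
exact: (measurable_funX 2 (measurable_enorm (measurable_rVB mgO mTzb))).
Qed.

Let mref_err : measurable_fun setT (fun w => ref_err (ell w) w).
Proof.
have mTzb := past_measurable_iid hY J1D (mT mzbell (fun w => Xzb _ w)).
have mg := past_measurable_iid hY J1D (measurable_avg s1J1 mzbell (fun w => Xzb _ w)).
have m1 := measurable_funX 2 (measurable_enorm (measurable_rVB mg mTzb)).
exact: (measurable_funM (measurable_funX 2 malO) m1).
Qed.

Lemma ex_reference_error : (ex Q (fun w => ref_err (ell w) w)%R <=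
  (n^-1 * ((2 + 2 * B) * V) / (1 - theta))%:E)%E.
Proof.
apply: ex_random_index => [l|l w||||l].
- exact: (measurable_funM (@measurable_cst _ _ _ _ _ _) (mzb_err l)).
- by apply: mulr_ge0; exact: sqr_ge0.
- exact: mref_err.
- by rewrite theta0; case/andP: theta01.
- by rewrite !mulr_ge0// addr_ge0// mulr_ge0.
have E0 w : 0 <= enorm (avg s1 w (zb l w) - T (zb l w)) ^+ 2 by exact: sqr_ge0.
have al0 : 0 <= (theta ^+ l * ahat) ^+ 2 by exact: sqr_ge0.
rewrite (exZ Q (mzb_err l) E0 al0).
rewrite [X in (_ <= X%:E)%E]mulrC (EFinM (theta ^+ l)); apply: lee_pmul.
- by rewrite lee_fin sqr_ge0.
- by apply: ex_ge0 => w; exact: sqr_ge0.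
(* One factor of the squared step is bounded by 1, the other by the summable [theta ^+ l]. *)
- rewrite lee_fin; have tl0 : 0 <= theta ^+ l by exact: exprn_ge0.
  have h1 : theta ^+ l * ahat <= theta ^+ l by rewrite ler_piMr.
  apply: le_trans h1; rewrite -[leRHS]mul1r expr2.
  by apply: ler_wpM2r; [exact: step_ge0|exact: step_le1].
rewrite EFinM (le_trans (ex_sqr_avg_error JD us1 s1D s10 (mzb l) (Xzb l)))//.
by apply: lee_pmul => //; apply: ex_ge0 => w; exact: v_ge0.
Qed.

Let lip_err w := (Lavg s1 w - L) ^+ 2 * enorm (z w - zb (ell w) w) ^+ 2.

(** One constant for both cases: [Dm] pays if [X] is compact, the other summand if it is not. *)
Let KL := Dm + (2 * B + 1 + L ^+ 2).

Let L0 : 0 <= L. Proof. by rewrite (le_trans _ (L_ge1 hF)). Qed.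

Let zzb w : enorm (z w - zb (ell w) w) ^+ 2 <= e1 w.
Proof.
rewrite /e1 lerXn2r ?nnegrE ?enorm_ge0//.
rewrite (le_trans (proj_lipschitz X0 Xcl Xcv _ _))//.
rewrite (_ : _ - _ = (theta ^+ ell w * ahat) *: (T (x w) - avg s1 w (x w))); last first.
  by rewrite /al; apply/rowP => i; rewrite !mxE; ring.
by rewrite enormZ ger0_norm ?step_ge0// enormB ler_piMl ?enorm_ge0// step_le1.
Qed.

Let mlip_err : measurable_fun setT lip_err.
Proof.
have m1 := past_measurable_iid hY J1D (measurable_Lavg s1J1).
have m2 := past_measurable_iid hY J1D mzbell.
by measurability_tac.
Qed.

Lemma ex_lip_error : (ex Q lip_err <= (n^-1 * (KL * V))%:E)%E.
Proof.
have m1 := past_measurable_iid hY J1D (measurable_Lavg s1J1).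
have lip0 w : 0 <= lip_err w by apply: mulr_ge0; exact: sqr_ge0.
have mL2 : measurable_fun setT (fun w => (Lavg s1 w - L) ^+ 2) by measurability_tac.
have [cX|ncX] := pselect (compact X).
  apply: (@le_trans _ _ (ex Q (fun w => Dm * (Lavg s1 w - L) ^+ 2)%R)).
    apply: ex_le => //.
    - by apply: measurable_funM => //; exact: measurable_cst.
    - by move=> w; rewrite [leRHS]mulrC; apply: ler_wpM2l; [exact: sqr_ge0|exact: (hDm cX (Xz w) (Xzb (ell w) w))].
  rewrite exZ//; last by move=> w; exact: sqr_ge0.
  apply: (@le_trans _ _ (Dm%:E * (B / n)%:E)%E).
    apply: lee_pmul => //; first by apply: ex_ge0 => w; exact: sqr_ge0.
    exact: (ex_sqr_Lavg_error JD us1 s1D s10).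
  rewrite -EFinM lee_fin mulrA mulrC; apply: ler_wpM2l => //; apply: ler_pM => //.
  rewrite /KL lerDl; apply: addr_ge0; last exact: sqr_ge0.
  by apply: addr_ge0 => //; exact: mulr_ge0.
apply: (@le_trans _ _ (ex Q (fun w => (Lavg s1 w - L) ^+ 2 * e1 w)%R)).
  apply: (ex_le Q mlip_err (measurable_funM mL2 me1) lip0) => w.
  by apply: ler_wpM2l; [exact: sqr_ge0|exact: zzb].
rewrite (le_trans (ex_Lavg_avg_error JD us1 s1D s10 mx Xx ncX))// exvx -EFinM lee_fin.
rewrite (mulrC _ n^-1) -mulrA; apply: ler_wpM2l => //; apply: ler_wpM2r => //.
by rewrite /KL lerDr.
Qed.

(** The coefficients 2, [16 * L ^+ 2] and 4 of [trial_error], applied to the bounds on its three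
    errors. *)
Let C3 := 4 * (1 + B) / (1 - theta) + 16 * L ^+ 2 + 4 * KL.

Lemma ex_third_error : (ex Q (fun w => al w ^+ 2 * enorm (avg s1 w (z w) - T (z w)) ^+ 2)%R <=
  (n^-1 * (C3 * V))%:E)%E.
Proof.
have m3rd : measurable_fun setT (fun w => al w ^+ 2 * enorm (avg s1 w (z w) - T (z w)) ^+ 2).
  exact: (measurable_funM (measurable_funX 2 malO)
    (measurable_funX 2 (measurable_enorm (measurable_rVB mg1zO mTzO)))).
have prod0 (u v : R) : 0 <= u ^+ 2 * v ^+ 2 by apply: mulr_ge0; exact: sqr_ge0.
have L20 : 0 <= 16 * L ^+ 2 by apply: mulr_ge0 => //; exact: sqr_ge0.
have hae : {ae Q, forall w, al w ^+ 2 * enorm (avg s1 w (z w) - T (z w)) ^+ 2 <=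
    2 * ref_err (ell w) w + 16 * L ^+ 2 * e1 w + 4 * lip_err w}.
  have hg := batch_good (fun i si => (s1D si).1).
  apply: filterS hg => w hg.
  have lf u u' : X u -> X u' -> enorm (avg s1 w u - avg s1 w u') <= Lavg s1 w * enorm (u - u').
    by move=> Xu Xu'; exact: avg_lipschitz.
  have lT u u' : X u -> X u' -> enorm (T u - T u') <= L * enorm (u - u').
    by move=> Xu Xu'; exact: (mean_lipschitz Xcl mF hF).
  exact: (trial_error X0 Xcl Xcv (Xx w) (Xzb (ell w) w) (Xz w)
    (step_ge0 (ell w)) (step_le1 (ell w)) L0 erefl erefl lf lT).1.
have := ex_le_combination m3rd mref_err me1 mlip_err (fun w => prod0 _ _) (fun w => prod0 _ _)
  e10 (fun w => prod0 _ _) (ler0n R 2) L20 (ler0n R 4) hae ex_reference_error exe1 ex_lip_error.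
move=> h; apply: (le_trans h).
rewrite lee_fin le_eqVlt; apply/orP; left; apply/eqP; rewrite /C3.
have th : 1 - theta != 0 by rewrite subr_eq0 gt_eqF//; case/andP: theta01.
by field; rewrite th gt_eqF.
Qed.

(** The second batch counts 4 times: 3 from [extragradient_inequality] and 1 from the mean of its
    unexpanded square. The factor [B] comes from [V]. *)
Definition Cstep := B * (4 * (2 + 8 * B) + 4 * C3).

Lemma one_iteration : 
  (ex Q (fun w => enorm (y w - p) ^+ 2)%R + (2^-1)%:E * ex Q (fun w => enorm (x w - z w) ^+ 2)%R <=
   (a + Cstep / n * (1 + a))%:E)%E.
Proof.
have [h2 h3] := ex_second_error; have h4 := ex_third_error.
set m2 := n^-1 * ((2 + 8 * B) * V) in h2 h3; set m3 := n^-1 * (C3 * V) in h4.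
have mp : measurable_rV (fun _ : Omega => p) := @measurable_rV_cst _ _ _ Omega p.
have mpzV := measurable_rVB mp mzO.
have mpz : measurable_fun setT (fun w => enorm (p - z w) ^+ 2) := measurable_funX 2 (measurable_enorm mpzV).
(* E|p - z|^2 occurs on both sides of the averaged inequality; it can be cancelled because it is
   finite. *)
have Wfin : (ex Q (fun w => enorm (p - z w) ^+ 2)%R < +oo)%E.
  have B1 : 0 <= B^-1 by rewrite invr_ge0.
  have mvz : measurable_fun setT (fun w => v (z w)).
    apply: measurable_funM; first exact: measurable_cst.
    apply: measurable_funD; first exact: measurable_cst.
    exact: (measurable_funX 2 (measurable_enorm (measurable_rVB mzO mp))).
  have vz0 w : 0 <= v (z w) := v_ge0 (z w).
  apply: (@le_lt_trans _ _ (ex Q (fun w => B^-1 * v (z w))%R)).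
    apply: (ex_le Q mpz (measurable_funM (@measurable_cst _ _ _ _ _ B^-1) mvz)) => w.
      exact: sqr_ge0.
    by rewrite /= mulKf ?gt_eqF// enormB lerDr.
  rewrite (exZ Q mvz vz0 B1).
  apply: (@le_lt_trans _ _ (B^-1%:E * ((2 + 8 * B) * V)%:E)%E); last by rewrite -EFinM ltry.
  by apply: lee_pmul ex_growth_extrapolation => //; exact: ex_ge0.
have := ex_fine (fun w => sq0 (fun w => p - z w) w) Wfin.
set W := fine _ => WE; rewrite WE -EFinD in h3.
have myp : measurable_fun setT (fun w => enorm (y w - p) ^+ 2) :=
  measurable_funX 2 (measurable_enorm (measurable_rVB myO mp)).
have mxz' : measurable_fun setT (fun w => enorm (x w - z w) ^+ 2) :=
  measurable_funX 2 (measurable_enorm (measurable_rVB mxO mzO)).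
have mxz : measurable_fun setT (fun w => 2^-1 * enorm (x w - z w) ^+ 2) :=
  measurable_funM (@measurable_cst _ _ _ _ _ (2^-1 : R)) mxz'.
have xz0 w : 0 <= 2^-1 * enorm (x w - z w) ^+ 2 by apply: mulr_ge0 => //; exact: sqr_ge0.
have h := @ex_le_combination _ _ _ Q 1 3 4 (a + (W + m2)) m2 m3
  (fun w => enorm (y w - p) ^+ 2 + 2^-1 * enorm (x w - z w) ^+ 2 + enorm (p - z w) ^+ 2)
  (fun w => enorm (x w - p) ^+ 2 + enorm (p - z w + al w *: (avg s2 w (z w) - T (z w))) ^+ 2)
  (fun w => al w ^+ 2 * enorm (avg s2 w (z w) - T (z w)) ^+ 2)
  (fun w => al w ^+ 2 * enorm (avg s1 w (z w) - T (z w)) ^+ 2).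
have q0 w : 0 <= enorm (x w - z w) ^+ 2 by exact: sqr_ge0.
have q1 w : 0 <= enorm (y w - p) ^+ 2 by exact: sqr_ge0.
have q2 w : 0 <= enorm (p - z w) ^+ 2 by exact: sqr_ge0.
have mxp : measurable_fun setT (fun w => enorm (x w - p) ^+ 2) :=
  measurable_funX 2 (measurable_enorm (measurable_rVB mxO mp)).
have me2 := measurable_rVB mg2O mTzO.
have mlast : measurable_fun setT
    (fun w => enorm (p - z w + al w *: (avg s2 w (z w) - T (z w))) ^+ 2) :=
  measurable_funX 2 (measurable_enorm (measurable_rVD mpzV (measurable_rVZ malO me2))).
have m2nd : measurable_fun setT (fun w => al w ^+ 2 * enorm (avg s2 w (z w) - T (z w)) ^+ 2) :=
  measurable_funM (measurable_funX 2 malO) (measurable_funX 2 (measurable_enorm me2)).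
have m3rd : measurable_fun setT (fun w => al w ^+ 2 * enorm (avg s1 w (z w) - T (z w)) ^+ 2) :=
  measurable_funM (measurable_funX 2 malO)
    (measurable_funX 2 (measurable_enorm (measurable_rVB mg1zO mTzO))).
have hae : {ae Q, forall w,
    enorm (y w - p) ^+ 2 + 2^-1 * enorm (x w - z w) ^+ 2 + enorm (p - z w) ^+ 2 <=
    1 * (enorm (x w - p) ^+ 2 + enorm (p - z w + al w *: (avg s2 w (z w) - T (z w))) ^+ 2) +
    3 * (al w ^+ 2 * enorm (avg s2 w (z w) - T (z w)) ^+ 2) +
    4 * (al w ^+ 2 * enorm (avg s1 w (z w) - T (z w)) ^+ 2)}.
  apply: filterS hls => w hw.
  have e (u1 u2 u3 u4 : R) : 1 * (u1 + u4) + u2 + u3 = u1 + u2 + u3 + u4 by ring.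
  rewrite e; exact: (extragradient_inequality X0 Xcl Xcv Xp (step_ge0 (ell w)) lam2 erefl erefl
    (hp (Xz w)) hw).
have hx : (ex Q (fun w => (enorm (x w - p) ^+ 2 +
    enorm (p - z w + al w *: (avg s2 w (z w) - T (z w))) ^+ 2)%R)%R <= (a + (W + m2))%:E)%E.
  rewrite exD//; last 2 first.
  - by move=> w; exact: sqr_ge0.
  - by move=> w; exact: sqr_ge0.
  by rewrite hxa EFinD; apply: leeD2l.
have prod0 m (u : Omega -> 'rV[R]_m) w : 0 <= al w ^+ 2 * enorm (u w) ^+ 2.
  by apply: mulr_ge0; exact: sqr_ge0.
have {}h := h (measurable_funD (measurable_funD myp mxz) mpz) (measurable_funD mxp mlast)
  m2nd m3rd (fun w => addr_ge0 (addr_ge0 (q1 w) (xz0 w)) (q2 w))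
  (fun w => addr_ge0 (sq0 (fun w => x w - p) w) (sq0 (fun w => p - z w + al w *: _) w))
  (prod0 _ _) (prod0 _ _) (ler0n R 1) (ler0n R 3) (ler0n R 4) hae hx h2 h4.
rewrite -(@leeD2rE _ W%:E)// -EFinD.
have -> : (ex Q (fun w => enorm (y w - p) ^+ 2)%R + (2^-1)%:E * ex Q (fun w => enorm (x w - z w) ^+ 2)%R + W%:E =
   ex Q (fun w => (enorm (y w - p) ^+ 2 + 2^-1 * enorm (x w - z w) ^+ 2 + enorm (p - z w) ^+ 2)%R)%R)%E.
  rewrite (exD Q (measurable_funD myp mxz) mpz (fun w => addr_ge0 (q1 w) (xz0 w)) q2).
  by rewrite (exD Q myp mxz q1 xz0) (exZ Q mxz' q0) ?WE// invr_ge0.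
rewrite (le_trans h)// lee_fin le_eqVlt; apply/orP; left; apply/eqP.
by rewrite /m2 /m3 /V /Cstep; ring.
Qed.

Let r w := residual X T (x w).

Lemma residual_growth w : r w ^+ 2 <= v (x w).
Proof.
apply: le_trans (sqr_mean_le_v (Xx w)).
rewrite lerXn2r ?nnegrE ?enorm_ge0// /r /residual.
rewrite -{1}(proj_id X0 Xcl Xcv (Xx w)) (le_trans (proj_lipschitz X0 Xcl Xcv _ _))//.
by rewrite opprB addrCA subrr addr0.
Qed.

Lemma measurable_residual : measurable_fun setT (r : past Y J -> R).
Proof.
have mTx := mT mx Xx.
exact: (measurable_enorm (measurable_rVB mx (mproj (measurable_rVB mx mTx)))).
Qed.

Lemma iteration_bounds (c : R) : 0 < c -> {ae Q, forall w, c <= al w * Lavg s1 w} ->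
  exists a' b rho : R,
  [/\ ex Q (fun w => enorm (y w - p) ^+ 2)%R = a'%:E, ex Q (fun w => r w ^+ 2)%R = rho%:E,
      0 <= b, a' + 2^-1 * b <= a + Cstep / n * (1 + a) &
      (c / L) ^+ 2 * rho <= 2 * b + 2 * (n^-1 * V)].
Proof.
move=> c0 hc.
have mxz : measurable_fun setT (fun w => enorm (x w - z w) ^+ 2) :=
  measurable_funX 2 (measurable_enorm (measurable_rVB mxO mzO)).
have mrJ := measurable_residual; have mr := past_measurable_iid hY JD mrJ.
have mr2 : measurable_fun setT (fun w => r w ^+ 2) := measurable_funX 2 mr.
have mLr : measurable_fun setT (fun w => Lavg s1 w * r w ^+ 2).
  exact: (measurable_funM (past_measurable_iid hY J1D (measurable_Lavg s1J1)) mr2).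
have r0 w : 0 <= r w ^+ 2 by exact: sqr_ge0.
have q0 w : 0 <= enorm (x w - z w) ^+ 2 by exact: sqr_ge0.
have q1 w : 0 <= enorm (y w - p) ^+ 2 by exact: sqr_ge0.
have Lr0 w : 0 <= Lavg s1 w * r w ^+ 2.
  by apply: mulr_ge0 => //; exact: Lavg_ge0.
have hstep := one_iteration.
have yfin : (ex Q (fun w => enorm (y w - p) ^+ 2)%R < +oo)%E.
  apply: le_lt_trans (ltry (a + Cstep / n * (1 + a))); apply: le_trans hstep.
  by rewrite leeDl// mule_ge0// ?lee_fin ?invr_ge0//; exact: ex_ge0.
have bfin : (ex Q (fun w => enorm (x w - z w) ^+ 2)%R < +oo)%E.
  rewrite ltey; apply/eqP => boo; move: hstep.
  by rewrite boo gt0_muley ?lte_fin ?invr_gt0// addey ?leye_eq// -ltNye (lt_le_trans _ (ex_ge0 Q q1)).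
have rfin : (ex Q (fun w => r w ^+ 2)%R < +oo)%E.
  apply: le_lt_trans (ltry V); rewrite -exvx; apply: ex_le => //; exact: residual_growth.
have [a' aE] : exists a' : R, ex Q (fun w => enorm (y w - p) ^+ 2)%R = a'%:E.
  by eexists; exact: ex_fine q1 yfin.
have [b bE] : exists b : R, ex Q (fun w => enorm (x w - z w) ^+ 2)%R = b%:E.
  by eexists; exact: ex_fine q0 bfin.
have [rho rE] : exists rho : R, ex Q (fun w => r w ^+ 2)%R = rho%:E.
  by eexists; exact: ex_fine r0 rfin.
exists a', b, rho; split; [exact: aE|exact: rE| | |].
- by rewrite -lee_fin -bE; exact: ex_ge0.
- by move: hstep; rewrite aE bE -EFinM -EFinD lee_fin.
have L1 : 0 < L by rewrite (lt_le_trans _ (L_ge1 hF)).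
have d0 : 0 <= 3 * c ^+ 2 / L ^+ 2.
  by apply: mulr_ge0; [apply: mulr_ge0 => //; exact: sqr_ge0|rewrite invr_ge0 sqr_ge0].
have d1 : 0 <= 2 * c ^+ 2 / L ^+ 3.
  apply: mulr_ge0; [apply: mulr_ge0 => //; exact: sqr_ge0|rewrite invr_ge0 exprn_ge0//].
have := @ex_le_combination _ _ _ Q 2 2 (2 * c ^+ 2 / L ^+ 3) b (n^-1 * V) (L * rho)
  (fun w => 3 * c ^+ 2 / L ^+ 2 * r w ^+ 2) (fun w => enorm (x w - z w) ^+ 2) e1
  (fun w => Lavg s1 w * r w ^+ 2)
  (measurable_funM (@measurable_cst _ _ _ _ _ _) mr2) mxz me1 mLr
  (fun w => mulr_ge0 d0 (r0 w)) q0 e10 Lr0 (ler0n R 2) (ler0n R 2) d1.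
rewrite bE (exZ Q mr2 r0 d0) rE -EFinM lee_fin => h.
(* The linear term of the tangent has mean at most [2 * (c / L) ^+ 2 * rho], so one of the three
   copies survives on the left. *)
suff : 3 * c ^+ 2 / L ^+ 2 * rho <= 2 * b + 2 * (n^-1 * V) + 2 * c ^+ 2 / L ^+ 3 * (L * rho).
  rewrite (_ : 2 * c ^+ 2 / L ^+ 3 * (L * rho) = 2 * (c / L) ^+ 2 * rho); last first.
    by field; rewrite gt_eqF.
  rewrite (_ : 3 * c ^+ 2 / L ^+ 2 * rho = (c / L) ^+ 2 * rho + 2 * (c / L) ^+ 2 * rho); last first.
    by field; rewrite gt_eqF.
  by rewrite lerD2r.
apply: h => //.
  have hg := batch_good (fun i si => (s1D si).1).
  apply: filterS2 hc hg => w hw hg.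
  have l1 := Lavg_ge1 s10 hg.
  have alpos : 0 < al w.
    rewrite /al; apply: mulr_gt0; last by case/andP: ahat01.
    by apply: exprn_gt0; case/andP: theta01.
  have h1 := residual_step_le X0 Xcl Xcv T (avg s1 w (x w)) (Xx w) alpos (step_le1 (ell w)).
  have h2 := inv_sqr_tangent (lt_le_trans ltr01 l1) L1 (ltW c0) hw.
  have e (A q t l u v k : R) : 0 <= k -> A <= q + t * l -> q * k <= u + v -> A * k <= u + v + t * (l * k).
    by move=> k0 hA hq; have := ler_wpM2r k0 hA; rewrite mulrDl -mulrA => /le_trans; apply; rewrite lerD2r.
  exact: e (r0 w) h2 h1.
rewrite EFinM -rE; exact: (ex_Lavg_weighted JD s1D s10 (measurable_funX 2 mrJ) r0).
Qed.

End one_iteration.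

Transparent avg Lavg mean_operator Defs.proj enorm dot.

End sample_averages.

(** * Real recursions and sample sizes *)

Section rates.
Context {R : realType}.
Implicit Types (a rho u : nat -> R) (t b mu eps : R).

(** The quantity 1 + a_K plus kappa times the partial sum of [rho] grows at each step by a factor at
    most 1 + C u_K, hence at most exp (C u_K). *)
Lemma gronwall_sum a rho u (kappa C S : R) : 0 <= kappa -> 0 <= C ->
  (forall k, 0 <= a k) -> (forall k, 0 <= rho k) -> (forall k, 0 <= u k) ->
  (forall k, a k.+1 + kappa * rho k <= a k + C * u k * (1 + a k)) ->
  (forall K, \sum_(k < K) u k <= S) ->
  forall K, kappa * \sum_(k < K) rho k <= (1 + a 0) * expR (C * S).
Proof.
move=> kappa0 C0 a0 rho0 u0 rec uS K.
have sum0 m : 0 <= \sum_(k < m) rho k by exact: sumr_ge0.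
suff h : 1 + a K + kappa * \sum_(k < K) rho k <= (1 + a 0) * expR (C * \sum_(k < K) u k).
  apply: (@le_trans _ _ ((1 + a 0) * expR (C * \sum_(k < K) u k))).
    by apply: le_trans h; rewrite lerDr; apply: addr_ge0.
  rewrite ler_wpM2l ?addr_ge0// ler_expR; exact: ler_wpM2l.
elim: K => [|K IH]; first by rewrite !big_ord0 !mulr0 expR0 mulr1 addr0.
rewrite !big_ord_recr/= [C * (_ + _)]mulrDr expRD mulrA.
apply: (@le_trans _ _ ((1 + a K + kappa * \sum_(k < K) rho k) * (1 + C * u K))).
  have := rec K; have := mulr_ge0 (mulr_ge0 kappa0 (sum0 K)) (mulr_ge0 C0 (u0 K)); lra.
apply: ler_pM => //; last exact: expR_ge1Dx.
- by rewrite !addr_ge0// mulr_ge0.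
- by rewrite addr_ge0// mulr_ge0.
Qed.

(* The increment of [- b^-1 * ln t ^- b] dominates its derivative at the right end. *)
Lemma log_power_telescope t b : 0 < b -> 2 < t ->
  (t * ln t `^ (1 + b))^-1 <= b^-1 * (ln (t - 1) `^ (- b) - ln t `^ (- b)).
Proof.
move=> b0 t2; have t0 : 0 < t by lra.
(* The assumption [2 < mu] is made for this: [ln (t - 1)] must be positive. *)
have s1 : 1 < t - 1 by lra.
have lt0 : 0 < ln t by rewrite ln_gt0; lra.
have ls0 : 0 < ln (t - 1) by rewrite ln_gt0.
have ltb : 0 < ln t `^ (1 + b) by rewrite powR_gt0.
rewrite ler_pdivlMl//.
have h1 : t^-1 <= ln t - ln (t - 1).
  have ht : -1 < - t^-1 by rewrite ltrN2 invf_lt1//; lra.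
  have := le_ln1Dx ht; have -> : 1 + - t^-1 = (t - 1) / t by field; rewrite gt_eqF.
  by rewrite ln_div ?posrE//; lra.
have h2 : ln (t - 1) `^ (- b) = ln t `^ (- b) * (ln (t - 1) / ln t) `^ (- b).
  by rewrite -powRM ?divr_ge0 ?ltW// mulrC divfK ?gt_eqF.
have q0 : 0 < ln (t - 1) / ln t by rewrite divr_gt0.
(* With q the quotient of logarithms, q^(-b) = exp (- b ln q) is at least 1 - b ln q, and ln q is at
   most q - 1. *)
have h3 : 1 + b * (1 - ln (t - 1) / ln t) <= (ln (t - 1) / ln t) `^ (- b).
  rewrite /powR gt_eqF//; apply: le_trans (expR_ge1Dx _); rewrite lerD2l mulNr -mulrN.
  apply: ler_wpM2l; [exact: ltW|rewrite lerNr opprB].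
  have hq : -1 < ln (t - 1) / ln t - 1 by lra.
  by have := le_ln1Dx hq; rewrite (_ : 1 + (_ - 1) = ln (t - 1) / ln t); last by ring.
have h4 : b * t^-1 / ln t <= b * (1 - ln (t - 1) / ln t).
  rewrite -mulrA; apply: ler_wpM2l; first exact: ltW.
  rewrite -[X in X - _](divff (_ : ln t != 0)) ?gt_eqF//.
  by rewrite -mulrBl ler_pM2r ?invr_gt0.
rewrite h2 -[X in _ - X]mulr1 -mulrBr.
apply: (@le_trans _ _ (ln t `^ (- b) * (b * t^-1 / ln t))); last first.
  by rewrite ler_wpM2l ?powR_ge0//; lra.
have -> : ln t `^ (1 + b) = ln t * ln t `^ b.
  rewrite powRD; last by rewrite (gt_eqF lt0) implybT.
  by rewrite powRr1// ltW.
rewrite powRN.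
rewrite le_eqVlt; apply/orP; left; apply/eqP.
have p0 : ln t `^ b != 0 by rewrite gt_eqF// powR_gt0.
by field; rewrite p0 !gt_eqF.
Qed.

Lemma sample_size_ge N mu b k : (0 < N)%N -> 2 < mu ->
  (k%:R + mu) * ln (k%:R + mu) `^ (1 + b) <= (sample_size N mu b k)%:R.
Proof.
move=> N0 mu2; rewrite /sample_size natrM.
set u := _ * _.
have u0 : 0 <= u by rewrite mulr_ge0 ?powR_ge0// addr_ge0//; lra.
have /andP[_ /ltW h] := truncn_itv u0.
apply: (le_trans h); rewrite -[leLHS]mul1r ler_wpM2r// ler1n//.
Qed.

Lemma sample_size_gt0 N mu b k : (0 < N)%N -> (0 < sample_size N mu b k)%N.
Proof. by move=> N0; rewrite muln_gt0 N0. Qed.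

Lemma sum_sample_sizeV N mu b K : (0 < N)%N -> 2 < mu -> 0 < b ->
  \sum_(k < K) (sample_size N mu b k)%:R^-1 <= b^-1 * ln (mu - 1) `^ (- b).
Proof.
move=> N0 mu2 b0.
suff h : \sum_(k < K) (sample_size N mu b k)%:R^-1 <=
    b^-1 * (ln (mu - 1) `^ (- b) - ln (K%:R + mu - 1) `^ (- b)).
  apply: (le_trans h); apply: ler_wpM2l; first by rewrite invr_ge0 ltW.
  by rewrite lerBlDr lerDl powR_ge0.
elim: K => [|K IH]; first by rewrite big_ord0 add0r subrr mulr0.
rewrite big_ord_recr/=.
have K0 : 0 <= K%:R :> R by exact: ler0n.
have t2 : 2 < K%:R + mu by lra.
have h1 := sample_size_ge b K N0 mu2.
have u0 : 0 < (K%:R + mu) * ln (K%:R + mu) `^ (1 + b).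
  by rewrite mulr_gt0 ?powR_gt0 ?ln_gt0//; lra.
have h2 : (sample_size N mu b K)%:R^-1 <= ((K%:R + mu) * ln (K%:R + mu) `^ (1 + b))^-1.
  by rewrite lef_pV2 ?posrE// (lt_le_trans u0).
have := log_power_telescope b0 t2.
rewrite (_ : K.+1%:R + mu - 1 = K%:R + mu); last by rewrite -natr1; ring.
by rewrite !mulrBr in IH *; lra.
Qed.

(** Each term is bounded by the value at [K], and there are [K.+1], at most K + mu, of them. The 1
    added to the power of the logarithm pays for rounding up. *)
Lemma sum_sample_size N mu b K : 2 < mu -> 0 < b ->
  \sum_(k < K.+1) (sample_size N mu b k)%:R <=
  N%:R * ((K%:R + mu) ^+ 2 * (1 + ln (K%:R + mu) `^ (1 + b))).
Proof.
move=> mu2 b0; set t := K%:R + mu.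
have t2 : 2 < t by have : 0 <= K%:R :> R by []; rewrite /t; lra.
have Kt : K.+1%:R <= t by rewrite /t -natr1 lerD2l; lra.
have P0 : 0 <= ln t `^ (1 + b) by exact: powR_ge0.
have h k : (k <= K)%N -> (sample_size N mu b k)%:R <= N%:R * (t * (1 + ln t `^ (1 + b))).
  move=> kK; rewrite /sample_size natrM ler_wpM2l// -natr1.
  set u := _ * _.
  have kt : k%:R + mu <= t by rewrite lerD2r ler_nat.
  have k2 : 2 < k%:R + mu by have : 0 <= k%:R :> R by []; lra.
  have u0 : 0 <= u by rewrite mulr_ge0 ?powR_ge0//; lra.
  have ut : u <= t * ln t `^ (1 + b).
    rewrite ler_pM ?powR_ge0//; first lra.
    rewrite ge0_ler_powR ?nnegrE ?ln_ge0//; [lra|lra|lra|].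
    by rewrite ler_ln ?posrE//; lra.
  have : (Num.truncn u)%:R <= u by rewrite truncn_le.
  lra.
apply: (@le_trans _ _ (\sum_(k < K.+1) N%:R * (t * (1 + ln t `^ (1 + b))))).
  by apply: ler_sum => k _; apply: h; rewrite -ltnS.
rewrite sumr_const card_ord -[leLHS]mulr_natl mulrCA ler_wpM2l// expr2 -mulrA ler_wpM2r//.
by rewrite mulr_ge0//; lra.
Qed.

(** With t = K + mu, the smallness conditions give in turn t <= (M + mu) / eps, then t <= (b eps)^-2
    and so ln t <= 2 l for l = ln (1 / (b eps)), and finally l >= 1, which absorbs the additive 1.
    The factor [b ^+ 2] in the constant compensates the displayed [b ^- 2]. *)
Lemma sum_sample_size_le N mu b K (M cN : R) d eps : 2 < mu -> 0 < b -> 0 <= M -> 0 < eps ->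
  N%:R <= cN * d%:R -> K%:R <= M / eps ->
  eps <= 1 -> (M + mu) * b ^+ 2 * eps <= 1 -> b * eps <= expR (-1) ->
  \sum_(k < K.+1) (sample_size N mu b k)%:R <=
  b ^- 2 * ln (b^-1 * eps^-1) `^ (1 + b) *
    (b ^+ 2 * cN * (M + mu) ^+ 2 * 2 * 2 `^ (1 + b) * d%:R * eps ^- 2).
Proof.
move=> mu2 b0 M0 e0 Nd Ke e1 eb be.
apply: (le_trans (sum_sample_size N K mu2 b0)).
set t := K%:R + mu; set l := ln (b^-1 * eps^-1).
have t2 : 2 < t by have : 0 <= K%:R :> R by []; rewrite /t; lra.
have te : t <= (M + mu) / eps.
  rewrite mulrDl lerD// ler_peMr ?invf_ge1//; lra.
have l1 : 1 <= l.
  rewrite -[leLHS]expRK /l ler_ln ?posrE ?expR_gt0// ?mulr_gt0 ?invr_gt0//.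
  by rewrite -invfM -[expR 1]invrK -expRN lef_pV2 ?posrE ?expR_gt0// mulr_gt0.
have lt : ln t <= 2 * l.
  rewrite mulr_natl -lnXn ?mulr_gt0 ?invr_gt0// ler_ln ?posrE; last 2 first.
  - by lra.
  - by rewrite exprn_gt0// mulr_gt0 ?invr_gt0.
  apply: (le_trans te); rewrite -invfM exprVn.
  rewrite -[leRHS]mul1r ler_pdivlMr ?exprn_gt0 ?mulr_gt0//.
  rewrite (_ : (M + mu) / eps * (b * eps) ^+ 2 = (M + mu) * b ^+ 2 * eps)//.
  by field; rewrite gt_eqF.
have lp1 : 1 <= l `^ (1 + b).
  by rewrite -[leLHS]/((fun=> 1) (1 + b)) -powR1 ge0_ler_powR ?nnegrE//; lra.
have p21 : 1 <= 2 `^ (1 + b) :> R.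
  by rewrite -[leLHS]/((fun=> 1) (1 + b)) -powR1 ge0_ler_powR ?nnegrE//; lra.
have h1 : 1 + ln t `^ (1 + b) <= 2 * (2 `^ (1 + b) * l `^ (1 + b)).
  have h : ln t `^ (1 + b) <= 2 `^ (1 + b) * l `^ (1 + b).
    rewrite -powRM//; last lra.
    by rewrite ge0_ler_powR ?nnegrE ?ln_ge0//; lra.
  have := ler_pM ler01 ler01 p21 lp1; lra.
have h2 : t ^+ 2 <= (M + mu) ^+ 2 * eps ^- 2.
  by rewrite -exprVn -exprMn lerXn2r ?nnegrE//; lra.
apply: (@le_trans _ _ ((cN * d%:R) * (((M + mu) ^+ 2 * eps ^- 2) * (2 * (2 `^ (1 + b) * l `^ (1 + b)))))).
  apply: ler_pM => //.
    by rewrite mulr_ge0 ?sqr_ge0// addr_ge0 ?powR_ge0.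
  by apply: ler_pM => //; [exact: sqr_ge0|rewrite addr_ge0 ?powR_ge0].
rewrite le_eqVlt; apply/orP; left; apply/eqP.
have bN : b != 0 by rewrite gt_eqF. have eN : eps != 0 by rewrite gt_eqF.
move: (l `^ (1 + b)) (2 `^ (1 + b)) (d%:R : R) => A A2 d'; clear -bN eN.
by field; rewrite bN eN.
Qed.

End rates.

(** * Line search *)

Section line_search.
Context {R : realType}.
Variables (ahat theta lam : R).
Hypotheses (ahat0 : 0 < ahat) (theta0 : 0 < theta) (theta1 : theta < 1) (lam0 : 0 < lam).

(** The choice made by [linesearch] for an abstract test. As [theta < 1], the largest accepted step
    is the one with least exponent. *)
Definition first_accepted (T : nat -> Prop) : nat :=
  xget 0 [set l : nat | T l /\ forall m, T m -> theta ^+ m * ahat <= theta ^+ l * ahat].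

Let step_le m l : (theta ^+ m * ahat <= theta ^+ l * ahat) = (l <= m)%N.
Proof. by rewrite ler_pM2r// ler_iXn2l. Qed.

Lemma first_acceptedP (T : nat -> Prop) : (exists m, T m) ->
  T (first_accepted T) /\ forall m, (m < first_accepted T)%N -> ~ T m.
Proof.
move=> hT; have hTb : exists m, `[< T m >] by case: hT => m Tm; exists m; exact/asboolP.
have hex : exists l, T l /\ forall m, T m -> theta ^+ m * ahat <= theta ^+ l * ahat.
  case: (ex_minnP hTb) => l /asboolP Tl lmin; exists l; split => // m Tm.
  by rewrite step_le; apply: lmin; exact/asboolP.
have [h1 h2] := @xgetPex _ 0%N [set l : nat | T l /\
  forall m, T m -> theta ^+ m * ahat <= theta ^+ l * ahat] hex.
by split => // m; rewrite ltnNge => /negP lm Tm; apply: lm; rewrite -step_le; exact: h2.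
Qed.

Lemma first_accepted0 (T : nat -> Prop) : (forall m, ~ T m) -> first_accepted T = 0%N.
Proof. by move=> hT; rewrite /first_accepted; case: xgetP => // l _ [/hT]. Qed.

(** Describes the level sets by countably many tests, default value included, which is what
    measurability needs. *)
Lemma first_accepted_eq (T : nat -> Prop) l : first_accepted T = l <->
  (T l /\ forall m, (m < l)%N -> ~ T m) \/ (l = 0%N /\ forall m, ~ T m).
Proof.
split.
  move=> <-; have [/first_acceptedP|hT] := pselect (exists m, T m); first by left.
  have nT m : ~ T m by move=> Tm; apply: hT; exists m.
  by right; split => //; exact: first_accepted0.
case=> [[Tl lmin]|[-> /first_accepted0 //]].
have [h1 h2] := first_acceptedP (ex_intro _ l Tl).
by case: (ltngtP (first_accepted T) l) => [/lmin//|/h2//|].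
Qed.

(** The function [g] lets one statement serve both the step [theta ^+ l * ahat] and the count
    [l%:R]. *)
Lemma measurable_first_accepted dT (S : measurableType dT) (T : nat -> S -> bool) (g : nat -> R) :
  (forall m, measurable_fun setT (T m)) ->
  measurable_fun setT (fun w => g (first_accepted (fun m => T m w))).
Proof.
move=> mT; pose E l := [set w | first_accepted (fun m => T m w) = l].
have mTs m : measurable [set w | T m w].
  by have := mT m measurableT [set true] I; rewrite setTI.
have mE l : measurable (E l).
  have -> : E l = ([set w | T l w] `&` \bigcap_(m in [set m | (m < l)%N]) ~` [set w | T m w]) `|`
      (if l == 0%N then \bigcap_m ~` [set w | T m w] else set0).
    apply/seteqP; split => w /=.
      move=> /first_accepted_eq[[Tl lmin]|[-> nT]]; [left|right] => //=.
      by move=> m _; exact: nT.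
    move=> h; apply/first_accepted_eq; case: h => [[Tl lmin]|]; first by left.
    by case: eqP => // -> nT; right; split => // m; exact: nT.
  apply: measurableU.
    apply: measurableI => //; apply: bigcap_measurableType => m _.
    exact: measurableC.
  by case: ifP => // _; apply: bigcap_measurableType => m _; exact: measurableC.
move=> _ A mA; rewrite setTI.
have -> : (fun w => g (first_accepted (fun m => T m w))) @^-1` A = \bigcup_(l in [set l | A (g l)]) E l.
  apply/seteqP; split => w /=; first by exists (first_accepted (fun m => T m w)).
  by move=> [l /= Al El]; rewrite El.
exact: bigcup_measurable.
Qed.

Variables (d : nat) (X : set 'rV[R]_d) (Xi : Type) (F : Xi -> 'rV[R]_d -> 'rV[R]_d).
Hypotheses (X0 : X !=set0) (Xcl : closed X) (Xcv : convex_set X).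
Variables (n : nat) (s : nat -> Xi) (x : 'rV[R]_d) (l : R).
Hypotheses (Xx : X x) (l1 : 1 <= l).
Hypothesis lipF : forall y z, X y -> X z ->
  enorm (Fhat F n s y - Fhat F n s z) <= l * enorm (y - z).

Let accepted m := linesearch_test X F lam n s x (theta ^+ m * ahat).

Let short_step_accepted m : theta ^+ m * ahat * l <= lam -> accepted m.
Proof.
move=> h; rewrite /accepted /linesearch_test.
have := lipF (projX X0 Xcl (x - (theta ^+ m * ahat) *: Fhat F n s x)) Xx.
rewrite -/(ztrial X F n s x _) => hl.
have a0 : 0 <= theta ^+ m * ahat by rewrite mulr_ge0 ?exprn_ge0// ltW.
apply: (le_trans (ler_wpM2l a0 hl)); rewrite mulrA.
by apply: ler_wpM2r => //; exact: enorm_ge0.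
Qed.

Let some_accepted : exists m, accepted m.
Proof.
have l0 : 0 < l by rewrite (lt_le_trans ltr01).
have q0 : 0 < lam / (ahat * l) by rewrite divr_gt0// mulr_gt0.
have : \forall m \near \oo, `|theta ^+ m| < lam / (ahat * l).
  have th : `|theta| < 1 by rewrite gtr0_norm.
  have /cvgrPdist_lt/(_ _ q0) := cvg_expr th.
  by apply: filterS => m; rewrite sub0r normrN.
move=> [m _ /(_ m (leqnn m))] /=; rewrite ger0_norm ?exprn_ge0 ?ltW// => hm.
exists m; apply: short_step_accepted.
by rewrite -mulrA -ler_pdivlMr ?mulr_gt0// ltW.
Qed.

Let ls := linesearch X F ahat theta lam n s x.

Lemma linesearch_accepted : linesearch_test X F lam n s x (theta ^+ ls * ahat).
Proof. by have [] := first_acceptedP some_accepted. Qed.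

(** Either the first trial is accepted, with step [ahat] and [1 <= l], or the previous trial was
    rejected; then its step times [l] exceeds [lam], and one more contraction costs a factor
    [theta]. *)
Lemma linesearch_step_ge : Num.min (lam * theta) ahat <= theta ^+ ls * ahat * l.
Proof.
have hmin : forall m, (m < ls)%N -> ~ accepted m := (first_acceptedP some_accepted).2.
case: ls hmin => [_|m hm].
  rewrite expr0 mul1r ge_min; apply/orP; right.
  by rewrite ler_peMr// ltW.
have : ~ (theta ^+ m * ahat * l <= lam).
  by move=> h; apply: (hm m (leqnn _)); exact: short_step_accepted.
move=> /negP; rewrite -ltNge => h; rewrite ge_min; apply/orP; left.
by rewrite exprS -!mulrA mulrC ler_pM2l// mulrA ltW.
Qed.

Lemma linesearch_le_log : ls%:R <= search_log ahat theta lam l.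
Proof.
have l0 : 0 < l by rewrite (lt_le_trans ltr01).
have c0 : 0 < Num.min (lam * theta) ahat by rewrite lt_min mulr_gt0.
rewrite /search_log /logb ler_pdivlMr; last by rewrite ln_gt0// invf_gt1.
rewrite mulr_natl -lnXn ?invr_gt0// ler_ln ?posrE ?exprn_gt0 ?invr_gt0//; last first.
  by rewrite divr_gt0// mulr_gt0.
rewrite /search_ratio ler_pdivlMr// exprVn ler_pdivrMl ?exprn_gt0// mulrA.
exact: linesearch_step_ge.
Qed.

End line_search.

Section search_log.
Context {R : realType}.
Variables (ahat theta lam : R).
Hypotheses (ahat0 : 0 < ahat) (theta0 : 0 < theta) (theta1 : theta < 1) (lam0 : 0 < lam).

Let c0 : 0 < Num.min (lam * theta) ahat.
Proof. by rewrite lt_min mulr_gt0. Qed.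

Let lt0 : 0 < ln theta^-1.
Proof. by rewrite ln_gt0// invf_gt1. Qed.

Lemma search_ratio_ge1 l : 1 <= l -> 1 <= search_ratio ahat theta lam l.
Proof.
move=> l1; rewrite /search_ratio ler_pdivlMr// mul1r (le_trans (_ : _ <= ahat))//.
  by rewrite ge_min lexx orbT.
by rewrite ler_peMr // ltW.
Qed.

Lemma search_log_ge0 l : 1 <= l -> 0 <= search_log ahat theta lam l.
Proof.
move=> l1; rewrite /search_log /logb; apply: divr_ge0; last exact: ltW.
by apply: ln_ge0; exact: search_ratio_ge1.
Qed.

Lemma search_log_le l m : 0 < l -> l <= m ->
  search_log ahat theta lam l <= search_log ahat theta lam m.
Proof.
move=> l0 lm; have m0 := lt_le_trans l0 lm.
rewrite /search_log /logb ler_pM2r ?invr_gt0//.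
have r0 t : 0 < t -> 0 < search_ratio ahat theta lam t by move=> t0; rewrite divr_gt0// mulr_gt0.
rewrite ler_ln ?posrE; [|exact: r0|exact: r0].
by rewrite /search_ratio ler_pM2r ?invr_gt0// ler_pM2l.
Qed.

(** The tangent of the concave logarithm at [m], with its negative constant moved to the left so
    that both sides are nonnegative once the logarithms are, and [ex] applies. *)
Lemma search_log_tangent l m : 0 < l -> 0 < m ->
  search_log ahat theta lam l + (ln theta^-1)^-1 <=
  search_log ahat theta lam m + (ln theta^-1)^-1 / m * l.
Proof.
move=> l0 m0; rewrite /search_log /logb.
have rE t : search_ratio ahat theta lam t = ahat / Num.min (lam * theta) ahat * t.
  exact: mulrAC.
have q0 : 0 < ahat / Num.min (lam * theta) ahat by rewrite divr_gt0.
rewrite !rE (lnM q0 l0) (lnM q0 m0) !mulrDl -!addrA lerD2l.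
rewrite -mulrA ![_ / ln _]mulrC -mulrDr -[X in _ * _ + X]mulr1 -!mulrDr.
apply: ler_wpM2l; first by rewrite invr_ge0 ltW.
have : ln (l / m) <= l / m - 1.
  have h : -1 < l / m - 1 by rewrite ltrBrDl subrr divr_gt0.
  by have := le_ln1Dx h; rewrite addrC subrK.
by rewrite ln_div ?posrE//; lra.
Qed.

End search_log.

(** A quarter of the second inequality turns its [2 * b] into the [2^-1 * b] of the first; hence the
    division of [q] by 4. *)
Lemma recursion_combine (R : realType) (a a' b r q C n B : R) :
  a' + 2^-1 * b <= a + C / n * (1 + a) -> q * r <= 2 * b + 2 * (n^-1 * (B * (1 + a))) ->
  a' + q / 4 * r <= a + (C + 2^-1 * B) * n^-1 * (1 + a).
Proof.
rewrite -[X in X * (1 + a)]/(C * n^-1) => h1 h2; have := ler_wpM2l (_ : 0 <= 4^-1) h2.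
by rewrite mulrCA mulrA; lra.
Qed.

(** * The iterates *)

Section iterates.
Context {R : realType} {d : nat} {dXi dO : measure_display}.
Context {Xi : measurableType dXi} {Omega : measurableType dO}.
Variables (P : probability Xi R) (Q : probability Omega R) (X : set 'rV[R]_d).
Variables (F : Xi -> 'rV[R]_d -> 'rV[R]_d) (Lip : Xi -> R).
Hypotheses (X0 : X !=set0) (Xcl : closed X) (Xcv : convex_set X).
Hypothesis mF : measurable_operator X F.
Hypothesis hF : heavy_tailed_lipschitz P X F Lip.
Variables (x0 : 'rV[R]_d) (ahat theta lam : R) (Ns : nat -> nat).
Hypothesis Xx0 : X x0.
Hypotheses (ahat01 : 0 < ahat <= 1) (theta01 : 0 < theta < 1) (lam0 : 0 < lam).
Hypothesis Ns0 : forall k, (0 < Ns k)%N.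
Variables (xi eta : Omega -> nat -> nat -> Xi).

Local Notation I := ((nat * nat) + (nat * nat))%type.
Local Notation T := (mean_operator P F).
Local Notation L := (fine (ex P Lip)).

Definition sample_index : set I :=
  [set i | match i with inl (k, j) | inr (k, j) => (j < Ns k)%N end].

Definition sample_point (i : I) w :=
  match i with inl (k, j) => xi w k j | inr (k, j) => eta w k j end.

Local Notation D := sample_index.
Local Notation Y := sample_point.

Definition stage (i : I) : nat := match i with inl (k, _) | inr (k, _) => k end.

Definition before k : set I := [set i | D i /\ (stage i < k)%N].
Definition xi_batch k : seq I := [seq inl (k, j) | j <- iota 0 (Ns k)].
Definition eta_batch k : seq I := [seq inr (k, j) | j <- iota 0 (Ns k)].

Lemma before_sub k : before k `<=` D. Proof. by move=> i []. Qed.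

Lemma size_xi_batch k : size (xi_batch k) = Ns k.
Proof. by rewrite size_map size_iota. Qed.

Lemma size_eta_batch k : size (eta_batch k) = size (xi_batch k).
Proof. by rewrite !size_map. Qed.

Lemma uniq_xi_batch k : uniq (xi_batch k).
Proof. by rewrite map_inj_uniq ?iota_uniq// => i j []. Qed.

Lemma uniq_eta_batch k : uniq (eta_batch k).
Proof. by rewrite map_inj_uniq ?iota_uniq// => i j []. Qed.

Lemma xi_batch_new k i : i \in xi_batch k -> D i /\ ~ before k i.
Proof.
by move=> /mapP[j]; rewrite mem_iota add0n => /andP[_ jk] ->; split => // -[_] /=; rewrite ltnn.
Qed.

Lemma eta_batch_new k i : i \in eta_batch k -> D i /\ ~ (before k `|` [set` xi_batch k]) i.
Proof.
move=> /mapP[j]; rewrite mem_iota add0n => /andP[_ jk] ->; split => // -[[_] /=|/= /mapP[] //].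
by rewrite ltnn.
Qed.

Lemma before_next k : (before k `|` [set` xi_batch k]) `|` [set` eta_batch k] `<=` before k.+1.
Proof.
move=> i [[[Di ik]|/= /mapP[j]]|/= /mapP[j]].
- by split => //; exact: ltnW.
- by rewrite mem_iota add0n => /andP[_ jk] ->; split => //=.
- by rewrite mem_iota add0n => /andP[_ jk] ->; split => //=.
Qed.

Lemma avg_xi_batch k w : avg F Y (xi_batch k) w = Fhat F (Ns k) (xi w k).
Proof.
apply/funext => y; rewrite /avg /Fhat size_xi_batch big_map.
by rewrite -[n in iota 0 n]subn0 -/(index_iota 0 (Ns k)) big_mkord.
Qed.

Lemma avg_eta_batch k w : avg F Y (eta_batch k) w = Fhat F (Ns k) (eta w k).
Proof.
apply/funext => y; rewrite /avg /Fhat size_eta_batch size_xi_batch big_map.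
by rewrite -[n in iota 0 n]subn0 -/(index_iota 0 (Ns k)) big_mkord.
Qed.

Lemma Lavg_xi_batch k w : Lavg Lip Y (xi_batch k) w = (Ns k)%:R^-1 * \sum_(j < Ns k) Lip (xi w k j).
Proof.
rewrite /Lavg size_xi_batch big_map.
by rewrite -[n in iota 0 n]subn0 -/(index_iota 0 (Ns k)) big_mkord.
Qed.

Hypothesis hS : iid_samples P Q Ns xi eta.

Let hY : iid_family P Q D Y. Proof. exact: hS. Qed.

Let x k w := iterate X F x0 ahat theta lam Ns (xi w) (eta w) k.
Let ell k w := oracle_calls X F x0 ahat theta lam Ns (xi w) (eta w) k.
Let al k w := theta ^+ ell k w * ahat.
Let z k w := proj X (x k w - al k w *: avg F Y (xi_batch k) w (x k w)).

Let ahat0 : 0 < ahat. Proof. by case/andP: ahat01. Qed.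
Let theta0 : 0 < theta. Proof. by case/andP: theta01. Qed.
Let theta1 : theta < 1. Proof. by case/andP: theta01. Qed.

Lemma iterate_in k w : X (x k w).
Proof. by case: k => [|k] //; exact: projX. Qed.

Lemma iterateS k : x k.+1 = fun w => proj X (x k w - al k w *: avg F Y (eta_batch k) w (z k w)).
Proof. by apply/funext => w; rewrite avg_eta_batch /z avg_xi_batch. Qed.

Lemma batch_lipschitz k : {ae Q, forall w, 1 <= Lavg Lip Y (xi_batch k) w /\
  forall u v, X u -> X v -> enorm (Fhat F (Ns k) (xi w k) u - Fhat F (Ns k) (xi w k) v) <=
    Lavg Lip Y (xi_batch k) w * enorm (u - v)}.
Proof.
have hb i : i \in xi_batch k -> D i by case/xi_batch_new.
apply: filterS (batch_good hF hY hb) => w hw; split.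
  by apply: Lavg_ge1 hw; rewrite size_xi_batch.
by move=> u v Xu Xv; have := avg_lipschitz hw Xu Xv; rewrite avg_xi_batch.
Qed.

Lemma step_accepted k : {ae Q, forall w,
  al k w * enorm (avg F Y (xi_batch k) w (z k w) - avg F Y (xi_batch k) w (x k w)) <=
  lam * enorm (z k w - x k w)}.
Proof.
apply: filterS (batch_lipschitz k) => w [l1 hl]; rewrite /z avg_xi_batch.
exact: (linesearch_accepted ahat0 theta0 theta1 lam0 X0 Xcl (iterate_in k w) l1 hl).
Qed.

Lemma step_ge k : {ae Q, forall w,
  Num.min (lam * theta) ahat <= al k w * Lavg Lip Y (xi_batch k) w}.
Proof.
apply: filterS (batch_lipschitz k) => w [l1 hl].
exact: (linesearch_step_ge ahat0 theta0 theta1 lam0 X0 Xcl (iterate_in k w) l1 hl).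
Qed.

Lemma oracle_calls_le k : {ae Q, forall w, 1 <= Lavg Lip Y (xi_batch k) w /\
  (ell k w)%:R <= search_log ahat theta lam (Lavg Lip Y (xi_batch k) w)}.
Proof.
apply: filterS (batch_lipschitz k) => w [l1 hl]; split => //.
exact: (linesearch_le_log ahat0 theta0 theta1 lam0 X0 Xcl (iterate_in k w) l1 hl).
Qed.

Lemma Lavg_ge k l : {ae P, forall z, l <= Lip z} ->
  {ae Q, forall w, l <= Lavg Lip Y (xi_batch k) w}.
Proof.
move=> hl; have hb i : i \in xi_batch k -> D i by case/xi_batch_new.
apply: filterS (batch_ae hY hb hl) => w hw.
have s0 : (0 < size (xi_batch k))%N by rewrite size_xi_batch.
rewrite /Lavg ler_pdivlMl ?ltr0n// mulr_natl.
have -> : l *+ size (xi_batch k) = \sum_(i <- xi_batch k) l.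
  by rewrite big_const_seq count_predT iter_addr_0.
by rewrite big_seq [leRHS]big_seq; apply: ler_sum.
Qed.

Lemma measurable_calls k (g : nat -> R) : measurable_rV (x k : past Y (before k) -> 'rV[R]_d) ->
  measurable_fun setT ((fun w => g (ell k w)) : past Y (before k `|` [set` xi_batch k]) -> R).
Proof.
set J1 := before k `|` _ => mx.
have mx1 : measurable_rV (x k : past Y J1 -> 'rV[R]_d).
  by apply: past_mono mx; exact: subsetUl.
have sJ1 i : i \in xi_batch k -> J1 i by right.
have mg : measurable_rV ((fun w => avg F Y (xi_batch k) w (x k w)) : past Y J1 -> 'rV[R]_d).
  exact: (measurable_avg Xcl mF sJ1 mx1 (iterate_in k)).
pose t m w := proj X (x k w - (theta ^+ m * ahat) *: avg F Y (xi_batch k) w (x k w)).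
pose test m w := (theta ^+ m * ahat) *
    enorm (avg F Y (xi_batch k) w (t m w) - avg F Y (xi_batch k) w (x k w)) <=
  lam * enorm (t m w - x k w).
have mt m : measurable_rV (t m : past Y J1 -> 'rV[R]_d).
  apply: (measurable_rV_comp (nearest_continuous X0 Xcl Xcv)).
  exact: (measurable_rVB mx1 (measurable_rVZ (measurable_cst _) mg)).
have mgt m : measurable_rV ((fun w => avg F Y (xi_batch k) w (t m w)) : past Y J1 -> 'rV[R]_d).
  by apply: (measurable_avg Xcl mF sJ1 (mt m)) => w; exact: projX.
have mtest m : measurable_fun setT (test m : past Y J1 -> bool).
  apply: measurable_fun_ler.
    exact: (measurable_funM (measurable_cst _) (measurable_enorm (measurable_rVB (mgt m) mg))).
  exact: (measurable_funM (measurable_cst _) (measurable_enorm (measurable_rVB (mt m) mx1))).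
have callsE : (fun w => g (ell k w)) =
    fun w => g (first_accepted ahat theta (fun m => test m w)).
  apply/funext => w; rewrite /test /t avg_xi_batch; reflexivity.
rewrite callsE; exact: (measurable_first_accepted ahat0 theta0 theta1 g mtest).
Qed.

Lemma ex_calls_le k : measurable_rV (x k : past Y (before k) -> 'rV[R]_d) ->
  (ex Q (fun w => (ell k w)%:R)%R <= (search_log ahat theta lam L)%:E)%E.
Proof.
move=> mx; set J1 := before k `|` [set` xi_batch k].
have J1D : J1 `<=` D by move=> i [[]|/= /xi_batch_new[]].
have L1 : 1 <= L := L_ge1 hF.
have L0 : 0 < L by rewrite (lt_le_trans ltr01).
have lt0 : 0 < ln theta^-1 by rewrite ln_gt0// invf_gt1.
set q := (ln theta^-1)^-1; have q0 : 0 < q by rewrite invr_gt0.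
have ml := past_measurable_iid hY J1D (measurable_calls (fun l => l%:R) mx).
have sJ1 i : i \in xi_batch k -> J1 i by right.
have mLa := past_measurable_iid hY J1D (measurable_Lavg hF sJ1).
have s0 : (0 < size (xi_batch k))%N by rewrite size_xi_batch.
have La0 w : 0 <= Lavg Lip Y (xi_batch k) w := Lavg_ge0 hF Y _ w.
have sl0 : 0 <= search_log ahat theta lam L by exact: search_log_ge0.
have h1 : (ex Q (fun w => (ell k w)%:R + q)%R <=
    ex Q (fun w => search_log ahat theta lam L + q / L * Lavg Lip Y (xi_batch k) w)%R)%E.
  apply: ex_le_ae.
  - exact: (measurable_funD ml (measurable_cst q)).
  - exact: (measurable_funD (measurable_cst _) (measurable_funM (measurable_cst _) mLa)).
  - by move=> w; rewrite addr_ge0// ltW.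
  - by move=> w; rewrite addr_ge0// mulr_ge0// divr_ge0// ltW.
  apply: filterS (oracle_calls_le k) => w [l1 hl].
  apply: (@le_trans _ _ (search_log ahat theta lam (Lavg Lip Y (xi_batch k) w) + q)).
    by rewrite lerD2r.
  by apply: search_log_tangent => //; rewrite (lt_le_trans ltr01).
have h2 : (ex Q (Lavg Lip Y (xi_batch k)) <= L%:E)%E.
  have := ex_Lavg_weighted hF hY (@before_sub k) (@xi_batch_new k) s0
    (measurable_cst (1 : R)) (fun=> ler01).
  rewrite ex_cst mule1; apply: le_trans.
  by rewrite le_eqVlt; apply/orP; left; apply/eqP; apply: ex_eq => w; rewrite mulr1.
have qL0 : 0 <= q / L by rewrite divr_ge0// ltW.
move: h1; rewrite (exD Q ml (measurable_cst q)); [|by []|by move=> w; exact: ltW].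
rewrite (exD Q (measurable_cst _) (measurable_funM (measurable_cst _) mLa)); last 2 first.
- by [].
- by move=> w; rewrite mulr_ge0.
rewrite (exZ Q mLa La0 qL0) !ex_cst => h1; rewrite -(@leeD2rE _ q%:E)//.
apply: (le_trans h1); apply: leeD2l.
apply: (@le_trans _ _ ((q / L)%:E * L%:E)%E); last by rewrite -EFinM divfK// gt_eqF.
by apply: lee_wpmul2l => //; rewrite lee_fin divr_ge0// ltW.
Qed.

Variables (p : 'rV[R]_d) (B Dm : R).
Hypothesis B0 : 0 < B.
Hypothesis hLB : (ex P (fun z => Lip z ^+ 2)%R <= B%:E)%E.
Hypothesis hFB : forall x, X x ->
  (ex P (fun z => enorm (F z x) ^+ 2)%R <= (B * (1 + enorm (x - p) ^+ 2))%:E)%E.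
Hypothesis hLFB : ~ compact X -> forall x y, X x ->
  (ex P (fun z => Lip z ^+ 2 * enorm (y + (F z x - T x)) ^+ 2)%R <=
   (2 * B * enorm y ^+ 2 + B * (1 + enorm (x - p) ^+ 2))%:E)%E.
Hypothesis lam2 : lam <= 2^-1.
Hypotheses (Dm0 : 0 <= Dm)
  (hDm : compact X -> forall y z, X y -> X z -> enorm (y - z) ^+ 2 <= Dm).
Hypotheses (Xp : X p) (hp : forall z, X z -> dot (T z) (p - z) <= 0).

Local Notation c := (Num.min (lam * theta) ahat).

Let c0 : 0 < c. Proof. by rewrite lt_min mulr_gt0. Qed.

Lemma iteration_at k a : measurable_rV (x k : past Y (before k) -> 'rV[R]_d) ->
  ex Q (fun w => enorm (x k w - p) ^+ 2)%R = a%:E ->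
  measurable_rV (x k.+1 : past Y (before k.+1) -> 'rV[R]_d) /\
  exists a' b rho : R,
  [/\ ex Q (fun w => enorm (x k.+1 w - p) ^+ 2)%R = a'%:E,
      ex Q (fun w => residual X T (x k w) ^+ 2)%R = rho%:E, 0 <= b,
      a' + 2^-1 * b <= a + Cstep P Lip B theta Dm / (Ns k)%:R * (1 + a) &
      (c / L) ^+ 2 * rho <= 2 * b + 2 * ((Ns k)%:R^-1 * (B * (1 + a)))].
Proof.
move=> mx hxa; have s0 : (0 < size (xi_batch k))%N by rewrite size_xi_batch.
have mal := measurable_calls (fun l => theta ^+ l * ahat) mx.
split.
  have h := measurable_iteration (s2 := eta_batch k) X0 Xcl Xcv mF mx (iterate_in k) mal.
  by rewrite iterateS; exact: (past_mono (@before_next k) h).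
have [a' [b [rho [h1 h2 h3 h4 h5]]]] := iteration_bounds X0 Xcl Xcv mF hF hY B0 hLB hFB hLFB ahat01 theta01 lam2 Dm0 hDm
  Xp hp (@before_sub k) (uniq_xi_batch k) (uniq_eta_batch k) (@xi_batch_new k)
  (@eta_batch_new k) s0 (size_eta_batch k) mx (iterate_in k) mal (step_accepted k) hxa
  c0 (step_ge k).
exists a', b, rho; split; [|exact: h2|exact: h3| |].
- by rewrite iterateS; exact: h1.
- move: h4; rewrite size_xi_batch; exact.
- move: h5; rewrite size_xi_batch; exact.
Qed.

(** Measurability and the finite second moment are propagated together, since an iteration needs
    both of its starting point. *)
Lemma iterate_state k : measurable_rV (x k : past Y (before k) -> 'rV[R]_d) /\
  exists a, ex Q (fun w => enorm (x k w - p) ^+ 2)%R = a%:E.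
Proof.
elim: k => [|k [mx [a hxa]]].
  split; first exact: measurable_rV_cst.
  by exists (enorm (x0 - p) ^+ 2); exact: (ex_cst Q (enorm (x0 - p) ^+ 2)).
by have [mx1 [a' [b [rho [ha' _ _ _ _]]]]] := iteration_at mx hxa; split => //; exists a'.
Qed.

Lemma residual_recursion : exists a rho : nat -> R,
  [/\ a 0 = enorm (x0 - p) ^+ 2, forall k, 0 <= a k, forall k, 0 <= rho k,
      forall k, ex Q (fun w => residual X T (x k w) ^+ 2)%R = (rho k)%:E &
      forall k, a k.+1 + (c / L) ^+ 2 / 4 * rho k <=
        a k + (Cstep P Lip B theta Dm + 2^-1 * B) * (Ns k)%:R^-1 * (1 + a k)].
Proof.
pose a k := fine (ex Q (fun w => enorm (x k w - p) ^+ 2)%R).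
pose rho k := fine (ex Q (fun w => residual X T (x k w) ^+ 2)%R).
have hxa k : ex Q (fun w => enorm (x k w - p) ^+ 2)%R = (a k)%:E.
  by have [_ [a' ha']] := iterate_state k; rewrite /a ha'.
exists a, rho; split.
- by rewrite /a [ex Q _](ex_cst Q (enorm (x0 - p) ^+ 2)).
- by move=> k; rewrite -lee_fin -hxa; apply: ex_ge0 => w; exact: sqr_ge0.
- by move=> k; apply: fine_ge0; apply: ex_ge0 => w; exact: sqr_ge0.
- move=> k; have [mx _] := iterate_state k.
  by have [_ [a' [b [r [_ hr _ _ _]]]]] := iteration_at mx (hxa k); rewrite /rho hr.
move=> k; have [mx _] := iterate_state k.
have [_ [a' [b [r [ha' hr b0 h1 h2]]]]] := iteration_at mx (hxa k).
have -> : a k.+1 = a' by rewrite /a ha'.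
have -> : rho k = r by rewrite /rho hr.
exact: recursion_combine h1 h2.
Qed.

End iterates.

(** * Choice of the constants and conclusion *)

Lemma compact_diameter (R : realType) (d : nat) (X : set 'rV[R]_d) :
  exists2 Dm, 0 <= Dm &
    (compact X -> forall y z, X y -> X z -> enorm (y - z) ^+ 2 <= Dm).
Proof.
have [cX|] := pselect (compact X); last by exists 0.
have [M [_ hM]] := compact_bounded cX.
have {}hM y : X y -> `|y| <= M + 1 by apply: hM; rewrite ltrDl.
exists ((Num.sqrt d%:R * (2 * (M + 1))) ^+ 2) => [|_ y z /hM hy /hM hz]; first exact: sqr_ge0.
have h0 : 0 <= Num.sqrt d%:R :> R by exact: sqrtr_ge0.
have hyz : enorm (y - z) <= Num.sqrt d%:R * (2 * (M + 1)).
  apply: (le_trans (enorm_le_norm _)); apply: ler_wpM2l => //.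
  by apply: (le_trans (ler_normB _ _)); lra.
by rewrite lerXn2r// nnegrE; [exact: enorm_ge0|apply: le_trans hyz; exact: enorm_ge0].
Qed.

Lemma expectation_ex (R : realType) d (T : measurableType d) (Q : probability T R) (f : T -> R) :
  ('E_Q[f] = ex Q f)%E.
Proof. by rewrite unlock. Qed.

Lemma Cstep_ge0 (R : realType) d (T : measurableType d) (P : probability T R) (Lip : T -> R)
  (B theta Dm : R) : 0 <= B -> theta <= 1 -> 0 <= Dm -> 0 <= Cstep P Lip B theta Dm.
Proof.
move=> B0 th Dm0; rewrite /Cstep.
have h1 : 0 <= 4 * (1 + B) / (1 - theta) by rewrite divr_ge0 ?subr_ge0//; lra.
have h2 : 0 <= fine (ex P Lip) ^+ 2 by exact: sqr_ge0.
by apply: mulr_ge0 => //; lra.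
Qed.

Lemma half_le_invsqrt6 (R : realType) : (Num.sqrt 6)^-1 <= 2^-1 :> R.
Proof.
have h : 2 <= Num.sqrt 6 :> R.
  by rewrite -[leLHS]ger0_norm// -sqrtr_sqr ler_wsqrtr// -natrX ler_nat.
by rewrite lef_pV2 ?posrE//; apply: lt_le_trans h.
Qed.

(** Separates the calls [t] per sample point from the total sample size [A], so that each complexity
    bound reduces to comparing [t] with [s]. *)
Lemma oracle_bound_ge (R : realType) (b C0 C eps s t A : R) (d : nat) :
  0 < b -> A <= b ^- 2 * ln (b^-1 * eps^-1) `^ (1 + b) * (C0 * d%:R * eps ^- 2) ->
  0 <= t -> C0 * t <= C * s -> t * A <= oracle_bound b C d eps s.
Proof.
move=> b0 hA t0 ts; apply: (le_trans (ler_wpM2l t0 hA)); rewrite /oracle_bound.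
set l := _ `^ _; have l0 : 0 <= l by exact: powR_ge0.
have q0 : 0 <= b ^- 2 * l * (d%:R * eps ^- 2).
  by rewrite !mulr_ge0// invr_ge0 sqr_ge0.
have := ler_wpM2r q0 ts; congr (_ <= _); ring.
Qed.

Lemma sum_one_add_mul_le (R : realType) (n : nat) (l m : nat -> nat) (t : R) :
  (forall i, (i < n)%N -> (l i)%:R <= t) ->
  (\sum_(i < n) (1 + l i) * m i)%:R <= (1 + t) * \sum_(i < n) (m i)%:R.
Proof.
move=> h; rewrite natr_sum mulr_sumr; apply: ler_sum => i _.
by rewrite natrM ler_wpM2r// natrD lerD2l; exact: h.
Qed.

Lemma bigmin_le_of_sum (R : realType) (rho : nat -> R) (K : nat) (M eps : R) :
  \sum_(k < K.+1) rho k <= M -> M < K.+1%:R * eps ->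
  exists i : 'I_K.+1, rho i <= eps.
Proof.
move=> hs hM; have [//|h] := pselect (exists i : 'I_K.+1, rho i <= eps).
have : \sum_(k < K.+1) eps <= \sum_(k < K.+1) rho k.
  by apply: ler_sum => i _; rewrite leNgt; apply/negP => /ltW hi; apply: h; exists i.
by rewrite sumr_const card_ord -mulr_natl => hh; have := lt_le_trans hM (le_trans hh hs); rewrite ltxx.
Qed.

Section constants.
Context {R : realType}.
Variables (ahat theta lam : R).
Hypotheses (ahat0 : 0 < ahat) (theta0 : 0 < theta) (theta1 : theta < 1) (lam0 : 0 < lam).

Let c0 : 0 < Num.min (lam * theta) ahat.
Proof. by rewrite lt_min mulr_gt0. Qed.

Let lt0 : 0 < ln theta^-1.
Proof. by rewrite ln_gt0// invf_gt1. Qed.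

Lemma search_log_gt0 m : 1 < search_ratio ahat theta lam m -> 0 < search_log ahat theta lam m.
Proof. by move=> h; rewrite /search_log /logb divr_gt0// ln_gt0. Qed.

(** The condition stands under the existential, so that a constant can be fixed before it is known
    to hold; in the degenerate case [k] is 0. *)
Lemma inv_search_log_ge m : exists2 k, 0 <= k &
  (1 < search_ratio ahat theta lam m -> 1 <= k * search_log ahat theta lam m).
Proof.
have [h|h] := pselect (1 < search_ratio ahat theta lam m); last by exists 0.
have h0 := search_log_gt0 h.
exists (search_log ahat theta lam m)^-1 => [|_]; first by rewrite invr_ge0 ltW.
by rewrite mulVf// gt_eqF.
Qed.

(** A lower bound on the search ratio is a lower bound [l] on [Lip], which passes to averages, and
    [search_log] is increasing. Again [k] is chosen before the condition is assumed. *)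
Lemma search_log_lower (Xi : Type) (Lip : Xi -> R) (ae : set Xi -> Prop) :
  (forall A B : set Xi, A `<=` B -> ae A -> ae B) ->
  exists2 k, 0 <= k & ((exists2 delta, 1 < delta &
      ae [set z | delta <= search_ratio ahat theta lam (Lip z)]) ->
    exists l, ae [set z | l <= Lip z] /\
      forall m, l <= m -> 1 <= k * search_log ahat theta lam m).
Proof.
move=> aeS; have [[delta d1 hd]|h] := pselect (exists2 delta, 1 < delta &
  ae [set z | delta <= search_ratio ahat theta lam (Lip z)]); last by exists 0.
pose l := delta * Num.min (lam * theta) ahat / ahat.
have l0 : 0 < l by rewrite divr_gt0// mulr_gt0// (lt_trans ltr01).
have rl : search_ratio ahat theta lam l = delta.
  by rewrite /search_ratio /l; field; rewrite !gt_eqF.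
have h0 : 0 < search_log ahat theta lam l by apply: search_log_gt0; rewrite rl.
exists (search_log ahat theta lam l)^-1 => [|_]; first by rewrite invr_ge0 ltW.
exists l; split => [|m lm].
  apply: aeS hd => z /=; rewrite -rl /search_ratio ler_pM2r ?invr_gt0// ler_pM2l//.
by rewrite ler_pdivlMl// mulr1; exact: search_log_le.
Qed.

End constants.

Theorem corollary4p12 (R : realType) (d : nat) (X : set 'rV[R]_d)
    (dXi : measure_display) (Xi : measurableType dXi) (P : probability Xi R)
    (F : Xi -> 'rV[R]_d -> 'rV[R]_d) (Lip : Xi -> R)
    (x0 : 'rV[R]_d) (ahat theta lam b mu cN : R) :
  X !=set0 -> closed X -> convex_set X ->
  measurable_operator X F ->
  heavy_tailed_lipschitz P X F Lip ->
  vi_solution X (mean_operator P F) !=set0 ->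
  pseudo_monotone X (mean_operator P F) ->
  X x0 -> 0 < ahat <= 1 -> 0 < theta < 1 -> 0 < lam < (Num.sqrt 6)^-1 ->
  0 < b -> 2 < mu -> 0 < cN ->
  exists C1 C2 eps0 : R, [/\ 0 < C1, 0 < C2, 0 < eps0 &
  forall N : nat, (0 < N)%N -> N%:R <= cN * d%:R ->
  forall (dO : measure_display) (Omega : measurableType dO)
    (Q : probability Omega R) (xi eta : Omega -> nat -> nat -> Xi),
  let Ns := sample_size N mu b in
  let x k w := iterate X F x0 ahat theta lam Ns (xi w) (eta w) k in
  let ell k w := oracle_calls X F x0 ahat theta lam Ns (xi w) (eta w) k in
  let Lhat k w := (Ns k)%:R^-1 * \sum_(j < Ns k) Lip (xi w k j) in
  let L := fine 'E_P[Lip] in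
  let slog := search_log ahat theta lam in
  iid_samples P Q Ns xi eta ->
  {ae Q, forall w, forall k,
    ~ stops_at X F x0 ahat theta lam Ns (xi w) (eta w) k} ->
  forall eps : R, 0 < eps -> exists K : nat,
  [/\ K%:R <= b^-1 * (C1 * eps^-1),
     (\big[Order.min/+oo]_(i < K.+1)
        'E_Q[(fun w => residual X (mean_operator P F) (x i w) ^+ 2)%R] <= eps%:E)%E &
     eps < eps0 ->
     let cost w : R := (\sum_(i < K.+1) (1 + ell i w) * Ns i)%:R in
     let mean_cost : \bar R :=
       (\sum_(i < K.+1) (1 + 'E_Q[(fun w => (ell i w)%:R)%R]) * ((Ns i)%:R)%:E)%E in
     let maxL w : R := \big[Num.max/0]_(i < K.+1) Lhat i w in
     [/\ {ae Q, forall w, cost w <= oracle_bound b C2 d eps (1 + slog (maxL w))},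
        (mean_cost <= (oracle_bound b C2 d eps (1 + slog L))%:E)%E,
        (exists2 delta : R, 1 < delta &
          {ae P, forall z, delta <= search_ratio ahat theta lam (Lip z)}) ->
          {ae Q, forall w, cost w <= oracle_bound b C2 d eps (slog (maxL w))} &
        1 < search_ratio ahat theta lam L ->
          (mean_cost <= (oracle_bound b C2 d eps (slog L))%:E)%E]]].
Proof.
move=> X0 Xcl Xcv mF hF [p [Xp pvi]] psm Xx0 ahat01 theta01 /andP[lam0 lam6] b0 mu2 cN0.
have [/andP[ahat0 _] /andP[theta0 theta1]] := (ahat01, theta01).
have hp z : X z -> dot (mean_operator P F z) (p - z) <= 0.
  move=> Xz; rewrite -opprB dotNr oppr_le0; exact: (psm p z Xp Xz (pvi z Xz)).
have lam2 : lam <= 2^-1 := le_trans (ltW lam6) (half_le_invsqrt6 R).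
have [B B0 [hLB hFB hLFB]] := moment_bounds Xcl mF hF p.
have [Dm Dm0 hDm] := compact_diameter X.
have LE : fine 'E_P[Lip]%E = fine (ex P Lip) by rewrite expectation_ex.
have L1 : 1 <= fine (ex P Lip) := L_ge1 hF.
set L := fine (ex P Lip) in LE L1.
have aeS (A A' : set Xi) : A `<=` A' -> {ae P, forall z, A z} -> {ae P, forall z, A' z}.
  by move=> AA'; exact: filterS.
have [k1 k10 hk1] := search_log_lower ahat0 theta0 theta1 lam0 Lip aeS.
have [k2 k20 hk2] := inv_search_log_ge ahat lam theta0 theta1 L.
pose C := Cstep P Lip B theta Dm + 2^-1 * B.
have C0 : 0 <= C.
  by apply: addr_ge0; [apply: Cstep_ge0 => //; exact: ltW|rewrite mulr_ge0// ltW].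
pose kappa := (Num.min (lam * theta) ahat / L) ^+ 2 / 4.
have kappa0 : 0 < kappa.
  rewrite divr_gt0// exprn_gt0// divr_gt0//; last exact: lt_le_trans L1.
  by rewrite lt_min mulr_gt0.
(* The [gronwall_sum] bound on the sum of all mean squared residuals. It involves neither [N] nor
   [eps], so the constants can be fixed before them. *)
pose M := (1 + enorm (x0 - p) ^+ 2) * expR (C * (b^-1 * ln (mu - 1) `^ (- b))) / kappa.
have M0 : 0 < M.
  by rewrite divr_gt0// mulr_gt0 ?expR_gt0// ltr_pwDl// sqr_ge0.
pose C20 := b ^+ 2 * cN * (M + mu) ^+ 2 * 2 * 2 `^ (1 + b).
have Mmu : 0 < M + mu by rewrite addr_gt0// (lt_trans _ mu2).
have C200 : 0 < C20.
  by rewrite /C20 mulr_gt0 ?powR_gt0// mulr_gt0// mulr_gt0 ?exprn_gt0// mulr_gt0// exprn_gt0.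
(* One entry for each smallness condition of [sum_sample_size_le]. *)
pose eps0 := Num.min 1 (Num.min ((M + mu) * b ^+ 2)^-1 (expR (-1) / b)).
(* The factor [b] cancels the displayed [b^-1]. The terms [k1] and [k2] absorb the 1 of [1 + slog]
   in the two bounds whose factor is [slog] alone. *)
exists (b * M), (C20 * (1 + k1 + k2)), eps0; split.
- exact: mulr_gt0.
- by rewrite mulr_gt0// -addrA ltr_pwDl// addr_ge0.
- by rewrite !lt_min ltr01 invr_gt0 divr_gt0 ?expR_gt0// mulr_gt0// exprn_gt0.
move=> N N0 hN dO Omega Q xi eta Ns x ell Lhat L' slog hS _ eps e0.
have {}LE : L' = L by exact: LE.
have Ns0 k : (0 < Ns k)%N by exact: sample_size_gt0.
have [a [rho [a0E age0 rho0 hrho rec]]] := residual_recursion X0 Xcl Xcv mF hF Xx0 ahat01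
  theta01 lam0 Ns0 hS B0 hLB hFB hLFB lam2 Dm0 hDm Xp hp.
have sumrho K : \sum_(k < K) rho k <= M.
  rewrite ler_pdivlMr// mulrC -a0E.
  apply: (@gronwall_sum R a rho (fun k => (Ns k)%:R^-1)) => //; first exact: ltW.
  by move=> K'; exact: sum_sample_sizeV.
have Me0 : 0 <= M / eps by rewrite divr_ge0// ltW.
(* [K] is at most M / eps, while the [K.+1] residuals with sum at most [M] have an average below
   [eps]. *)
pose K := Num.truncn (M / eps); have /andP[KM MK] := truncn_itv Me0.
exists K; split.
- by rewrite mulrA mulKf// gt_eqF.
- have hM : M < K.+1%:R * eps by rewrite -ltr_pdivrMr.
  have [i hi] := bigmin_le_of_sum (sumrho K.+1) hM.
  by apply: (bigmin_inf i) => //; rewrite expectation_ex hrho lee_fin.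
move=> eeps0 cost mean_cost maxL.
have [e1 e2 e3] : [/\ eps <= 1, (M + mu) * b ^+ 2 * eps <= 1 & b * eps <= expR (-1)].
  move: eeps0; rewrite !lt_min => /and3P[/ltW h1 /ltW h2 /ltW h3]; split => //.
    by rewrite -ler_pdivlMl ?mulr1// mulr_gt0// exprn_gt0.
  by rewrite mulrC -ler_pdivlMr.
have hA := sum_sample_size_le mu2 b0 (ltW M0) e0 hN KM e1 e2 e3.
have LhatE k w : Lavg Lip (sample_point xi eta) (xi_batch Ns k) w = Lhat k w.
  exact: Lavg_xi_batch.
have calls : {ae Q, forall w, forall k, 1 <= Lhat k w /\ (ell k w)%:R <= slog (Lhat k w)}.
  apply: ae_foralln => k.
  have := oracle_calls_le X0 Xcl hF Xx0 ahat01 theta01 lam0 Ns0 hS k.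
  by apply: filterS => w; rewrite LhatE.
have maxL_ge w (i : 'I_K.+1) : Lhat i w <= maxL w by exact: le_bigmax.
have ascost w : (forall k, 1 <= Lhat k w /\ (ell k w)%:R <= slog (Lhat k w)) ->
    [/\ 0 <= slog (maxL w) & cost w <= (1 + slog (maxL w)) * \sum_(i < K.+1) (Ns i)%:R].
  move=> h; split.
    apply: search_log_ge0 => //; apply: le_trans (maxL_ge w ord0); exact: (h 0%N).1.
  apply: sum_one_add_mul_le => i iK; apply: (le_trans (h i).2).
  apply: search_log_le => //; first exact: lt_le_trans (h i).1.
  exact: (maxL_ge w (Ordinal iK)).
have slogL0 : 0 <= slog L by exact: search_log_ge0.
have mcost : (mean_cost <= ((1 + slog L) * \sum_(i < K.+1) (Ns i)%:R)%:E)%E.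
  rewrite mulr_sumr -sumEFin; apply: lee_sum => i _; rewrite EFinM EFinD.
  apply: lee_wpmul2r; first by rewrite lee_fin.
  apply: leeD2l; rewrite expectation_ex.
  apply: (ex_calls_le X0 Xcl Xcv mF hF Xx0 ahat01 theta01 lam0 Ns0 hS).
  exact: (iterate_state X0 Xcl Xcv mF hF Xx0 ahat01
    theta01 lam0 Ns0 hS B0 hLB hFB hLFB lam2 Dm0 hDm Xp hp i).1.
have large s t : 0 <= t -> t <= (1 + k1 + k2) * s -> C20 * t <= C20 * (1 + k1 + k2) * s.
  by move=> t0 ts; rewrite -mulrA ler_pM2l.
split.
- apply: filterS calls => w /ascost[s0 hc]; apply: (le_trans hc).
  apply: (oracle_bound_ge b0 hA); first exact: addr_ge0.
  apply: large; first exact: addr_ge0.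
  by rewrite ler_peMl ?addr_ge0// -addrA lerDl addr_ge0.
- apply: (le_trans mcost); rewrite lee_fin LE.
  apply: (oracle_bound_ge b0 hA); first exact: addr_ge0.
  apply: large; first exact: addr_ge0.
  by rewrite ler_peMl ?addr_ge0// -addrA lerDl addr_ge0.
- move=> /hk1[l [hl hslog]].
  (* The first average suffices, since the maximum dominates it. *)
  have lmax : {ae Q, forall w, l <= Lhat 0%N w}.
    by apply: filterS (Lavg_ge Ns0 hS 0%N hl) => w; rewrite LhatE.
  apply: filterS2 calls lmax => w /ascost[s0 hc] lw; apply: (le_trans hc).
  apply: (oracle_bound_ge b0 hA); first exact: addr_ge0.
  apply: large; first exact: addr_ge0.
  have := hslog _ (le_trans lw (maxL_ge w ord0)); have := mulr_ge0 k20 s0.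
  rewrite -/slog; clear; set s := slog _; nra.
- rewrite LE => /hk2 h; apply: (le_trans mcost); rewrite lee_fin.
  apply: (oracle_bound_ge b0 hA); first exact: addr_ge0.
  apply: large; first exact: addr_ge0.
  have := mulr_ge0 k10 slogL0; move: h.
  rewrite -/slog; clear; set s := slog _; nra.
Qed.
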